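(* Let $A$ be a linear, selfadjoint, nonnegative, trace class operator on $H$. Let $h>0$ and $p\in[1,+\infty[$. Every function $f\in S(Q_A)$ admits a stochastic extension $\widetilde f$ in $L^p(B,\mu_{B,h})$. The function $\widetilde f$ is bounded $\mu_{B,h}$-almost everywhere by $\|f\|_{Q_A}$. Moreover, for all $E\in\mathcal F(H)$, $$\|f\circ\tilde\pi_E-\widetilde f\|_{L^p(B,\mu_{B,h})}\le C(p)\,h^{1/2}\,\|f\|_{Q_A}\left(\sum_{j\ge0}\lambda_j|\pi_E(u_j)-u_j|^{\alpha(p)}\right)^{1/\alpha(p)},$$ where $(u_j)_{j\ge0}$ is a Hilbert basis of $H$ consisting of eigenvectors of $A$, with corresponding eigenvalues $\lambda_j$, and $C(p),\alpha(p)$ are given by $$C(p)=K(p)\Big(\sum_{j\ge0}\lambda_j\Big)^{\frac12-\frac1p},\ \alpha(p)=p\quad\text{if }p>2;\qquad C(p)=1,\ \alpha(p)=2\quad\text{if }p\le2 .$$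
   Context: Wiener space. $H$ is a real, separable, infinite dimensional Hilbert space with scalar product $\langle\cdot,\cdot\rangle$ and norm $|\cdot|$; $B$ is the Banach space obtained by completing $H$ for a measurable norm (in the sense of Gross), and $H$ is identified with its dual, so that $B'\subset H\subset B$. For $h>0$, $\mu_{B,h}$ is the Gaussian probability measure of variance $h$ on the Borel $\sigma$-algebra of $B$: for $y_1,\dots,y_n\in B'$ orthonormal in $H$, the image of $\mu_{B,h}$ under $x\mapsto (y_1(x),\dots,y_n(x))$ is $(2\pi h)^{-n/2}e^{-|v|^2/(2h)}dv$ on $\mathbb R^n$. For $a\in H$, $\ell_a\in L^2(B,\mu_{B,h})$ is the image of $a$ under the continuous extension to $H$ of the map $B'\ni y\mapsto y(\cdot)$. $\mathcal F(H)$ is the set of finite dimensional subspaces of $H$; for $E\in\mathcal F(H)$ with orthonormal basis $(w_1,\dots,w_n)$, $\pi_E$ is the orthogonal projection onto $E$ and $\tilde\pi_E(x)=\sum_j\ell_{w_j}(x)w_j$ for $x\in B$. A Borel function $f$ on $H$ admits $\tilde f$ as a stochastic extension in $L^p(B,\mu_{B,h})$ if, for every increasing sequence $(E_n)$ in $\mathcal F(H)$ with dense union in $H$, $f\circ\tilde\pi_{E_n}\in L^p(B,\mu_{B,h})$ and $f\circ\tilde\pi_{E_n}\to\tilde f$ in $L^p(B,\mu_{B,h})$. Symbol class. $Q_A(x)=\langle Ax,x\rangle$. $S(Q_A)$ is the class of all $f\in C^\infty(H)$ for which there is $C(f)>0$ with $|f(x)|\le C(f)$ for all $x\in H$ and $|(d^mf)(x)(U_1,\dots,U_m)|\le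 C(f)\prod_{j=1}^mQ_A(U_j)^{1/2}$ for all $m\in\mathbb N^*$, $x\in H$, $U_1,\dots,U_m\in H$. The smallest such $C(f)$ is denoted $\|f\|_{Q_A}$. Constant: $K(p)=2^{1/2}\pi^{-1/(2p)}\left(\Gamma\left(\frac{p+1}2\right)\right)^{1/p}$ (Euler's Gamma function). *)

(* Defs.v *)
From HB Require Import structures.
From mathcomp Require Import all_boot all_order all_algebra.
From mathcomp Require Import all_classical all_reals all_analysis.
Set Implicit Arguments.
Unset Strict Implicit.
Unset Printing Implicit Defensive.
Import Order.TTheory GRing.Theory Num.Theory.
Import numFieldNormedType.Exports.
Local Open Scope classical_set_scope.
Local Open Scope ring_scope.

Notation borelType T := (g_sigma_algebraType (@open T)).

Section Hilbert.
Context {R : realType} {H : completeNormedModType R}.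
Variable ip : {dot H for idfun}.

(* [ip] is positive definite, bilinear and symmetric by its type; together with
   the completeness of H this makes (H, ip) a real Hilbert space whose norm is
   the library norm of H. *)
Definition hilbert_norm := forall x : H, `|x| ^+ 2 = ip x x.

Definition linear_span (S : set H) : set H :=
  [set x | exists (n : nat) (c : 'I_n -> R) (w : 'I_n -> H),
    (forall i, S (w i)) /\ x = \sum_(i < n) c i *: w i].

Definition fin_dim (E : set H) :=
  exists (n : nat) (w : 'I_n -> H), E = linear_span (range w).

Definition orthonormal (I : eqType) (e : I -> H) :=
  forall i j, ip (e i) (e j) = (i == j)%:R.

Definition orthonormal_basis (E : set H) (n : nat) (w : 'I_n -> H) :=
  orthonormal w /\ E = linear_span (range w).

Definition hilbert_basis (e : nat -> H) :=
  orthonormal e /\ dense (linear_span (range e)).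

Definition separable_infinite_dim :=
  (exists D : set H, countable D /\ dense D) /\ ~ fin_dim setT.

(* Orthogonal projection onto E; for finite dimensional E the point selected by
   [get] exists and is unique. *)
Definition orth_proj (E : set H) (x : H) : H :=
  get [set y | E y /\ forall z, E z -> ip (x - y) z = 0].

(* For an everywhere defined operator, selfadjointness is symmetry. *)
Definition selfadjoint (A : H -> H) := forall x y, ip (A x) y = ip x (A y).

Definition nonnegative (A : H -> H) := forall x, 0 <= ip (A x) x.

(* P is the positive square root of A^* A. *)
Definition is_absolute_value (A P : {linear H -> H}) :=
  [/\ continuous P, selfadjoint P, nonnegative P &
      forall x y, ip (P x) (P y) = ip (A x) (A y)].

(* The trace of |A| is finite. A bounded A has exactly one absolute value
   (A itself if A is nonnegative), and the trace of a nonnegative operator does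
   not depend on the Hilbert basis. *)
Definition trace_class (A : {linear H -> H}) :=
  continuous A /\
  forall P, is_absolute_value A P ->
  exists e : nat -> H, hilbert_basis e /\
    (\sum_(j <oo) (ip (P (e j)) (e j))%:E < +oo)%E.

Definition quad_form (A : H -> H) (x : H) : R := ip (A x) x.

End Hilbert.

Section SymbolClass.
Context {R : realType} {H : completeNormedModType R}.

(* [dform f [:: U1; ..; Um] x] is (d^m f)(x)(U1, .., Um), written as an iterated
   directional derivative. *)
Definition dform (f : H -> R^o) (U : seq H) : H -> R^o :=
  foldr (fun u (g : H -> R^o) => 'D_u g) f U.

(* C^oo in the sense of Frechet: at every order m, d^m f takes its values in the
   bounded m-linear forms, and d^(m+1) f is the Frechet derivative of d^m f for
   the operator norm on m-linear forms. *)
Definition Cinfty (f : H -> R^o) :=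
  [/\ forall (x : H) (V W : seq H) (a : R) (u v : H),
        dform f (V ++ (a *: u + v) :: W) x =
          a * dform f (V ++ u :: W) x + dform f (V ++ v :: W) x,
      forall (m : nat) (x : H), exists C : R, forall U : seq H, size U = m ->
        `|dform f U x| <= C * \prod_(u <- U) `|u| &
      forall (m : nat) (x : H) (eps : R), 0 < eps -> \forall k \near (0 : H),
        forall U : seq H, size U = m ->
        `|dform f U (x + k) - dform f U x - dform f (k :: U) x|
          <= eps * `|k| * \prod_(u <- U) `|u| ].

Variables (ip : {dot H for idfun}) (A : H -> H).

Definition symbol_bound (f : H -> R^o) (C : R) :=
  [/\ 0 < C, forall x, `|f x| <= C &
      forall (x : H) (U : seq H), (0 < size U)%N ->
        `|dform f U x| <= C * \prod_(u <- U) Num.sqrt (quad_form ip A u)].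

Definition symbol_class (f : H -> R^o) :=
  Cinfty f /\ exists C, symbol_bound f C.

(* The infimum is attained unless f = 0, where it is 0. *)
Definition symbol_norm (f : H -> R^o) : R := inf [set C | symbol_bound f C].

End SymbolClass.

Section GaussianRn.
Context {R : realType}.

(* Lebesgue integral over R^n of a nonnegative function, as an iterated
   integral. *)
Fixpoint tuple_integral (n : nat) : (n.-tuple R -> \bar R) -> \bar R :=
  match n with
  | 0 => fun F => F [tuple]
  | n.+1 => fun F => (\int[lebesgue_measure]_x
                       tuple_integral (fun v => F (cons_tuple x v)))%E
  end.

Definition gauss_density (h : R) (n : nat) (v : n.-tuple R) : R :=
  (2 * pi * h) `^ (- (n%:R / 2)) *
  expR (- (\sum_(i < n) tnth v i ^+ 2) / (2 * h)).

Definition gauss_measure (h : R) (n : nat) (S : set (n.-tuple R)) : \bar R :=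
  tuple_integral (fun v => (gauss_density h v * \1_S v)%:E).

End GaussianRn.

Section WienerSpace.
Context {R : realType} {H B : completeNormedModType R}.
Variables (ip : {dot H for idfun}) (iota : {linear H -> B}).

(* Measurability of the norm N in the sense of Gross; the canonical Gauss
   cylinder measure of {x | eps < N (pi_E x)} is computed in an orthonormal
   basis w of E. *)
Definition measurable_norm (N : H -> R) :=
  forall eps : R, 0 < eps -> exists E0 : set H, fin_dim E0 /\
    forall (n : nat) (w : 'I_n -> H), orthonormal ip w ->
      (forall i x, E0 x -> ip (w i) x = 0) ->
      (gauss_measure 1 [set v : n.-tuple R |
         (eps < N (\sum_(i < n) tnth v i *: w i))%R] < eps%:E)%E.

(* [iota] is the inclusion of H into its completion B for a measurable norm. *)
Definition wiener_completion :=
  [/\ injective iota, dense (range iota) &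
      measurable_norm (fun x => `|iota x|)].

(* The functional y of B' is the element a of H under B' c H' = H. *)
Definition dual_repr (y : {scalar B}) (a : H) :=
  continuous (y : B -> R^o) /\ forall x, y (iota x) = ip a x.

Definition wiener_measure (h : R) (mu : probability (borelType B) R) :=
  forall (n : nat) (y : 'I_n -> {scalar B}) (a : 'I_n -> H),
    (forall i, dual_repr (y i) (a i)) -> orthonormal ip a ->
    forall S : set (n.-tuple R), measurable S ->
      mu [set x | S [tuple y i x | i < n]] = gauss_measure h S.

Variable mu : probability (borelType B) R.

(* [ell a] is a representative of the class l_a in L^2(B, mu), where a |-> l_a is
   the continuous extension to H of B' -> L^2(B, mu), y |-> y(.). *)
Definition is_ell (ell : H -> borelType B -> R) :=
  [/\ forall a, ell a \in Lfun mu 2%:E,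
      forall (y : {scalar B}) (a : H), dual_repr y a ->
        {ae mu, forall x, ell a x = y x} &
      forall a : H,
        ('N[mu]_2%:E[EFin \o (ell b \- ell a)%R])%E @[b --> a] --> 0%E].

Variable ell : H -> borelType B -> R.

(* pi~_E, computed in an orthonormal basis w of E; as the l_a, it is defined up
   to null sets. *)
Definition tilde_pi (n : nat) (w : 'I_n -> H) (x : borelType B) : H :=
  \sum_(i < n) ell (w i) x *: w i.

Definition Lp_dist (p : R) (f g : borelType B -> R) : \bar R :=
  'N[mu]_p%:E[EFin \o (f \- g)%R]%E.

(* The bases w n are arbitrary: f o pi~_(E n) does not depend on them up to null
   sets. *)
Definition stochastic_extension (p : R) (f : H -> R) (ft : borelType B -> R) :=
  [/\ measurable_fun setT (f : borelType H -> R),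
      ft \in Lfun mu p%:E &
      forall E : nat -> set H, (forall n, fin_dim (E n)) ->
        (forall n, E n `<=` E n.+1) -> dense (\bigcup_n E n) ->
      forall (d : nat -> nat) (w : forall n, 'I_(d n) -> H),
        (forall n, orthonormal_basis ip (E n) (w n)) ->
        (forall n, f \o tilde_pi (w n) \in Lfun mu p%:E) /\
        Lp_dist p (f \o tilde_pi (w n)) ft @[n --> \oo] --> 0%E].

End WienerSpace.

Section Constants.
Context {R : realType}.

Definition Gamma (s : R) : R :=
  \int[lebesgue_measure]_(t in `]0, +oo[) (t `^ (s - 1) * expR (- t)).

Definition K_const (p : R) : R :=
  2 `^ 2^-1 * pi `^ (- (2 * p)^-1) * Gamma ((p + 1) / 2) `^ p^-1.

Definition alpha_const (p : R) : R := if 2 < p then p else 2.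

Definition C_const (p : R) (lam : nat -> R) : R :=
  if 2 < p then K_const p * limn (series lam) `^ (2^-1 - p^-1) else 1.

End Constants.

(* Main.v *)
(* Taylor's formula along segments and the bound on d^1 f give
   |f x - f y| <= |f| Q_A(x - y)^(1/2). A nonnegative trace class A has a
   Cholesky decomposition Q_A(x) = sum_k <x, y_k>^2 with sum_k |y_k|^2 < oo; when
   an eigenbasis is given, one may take y_k = lambda_k^(1/2) u_k. Since
   <pi~_E x - pi~_F x, y> = l_(pi_E y - pi_F y)(x) almost everywhere, and l_a is
   normal of variance h |a|^2 (here only upper bounds on its absolute moments are
   needed), the p-th moment of f o pi~_E - f o pi~_F is controlled by the
   distances |pi_E y_k - pi_F y_k|. So f o pi~_(E_n) is Cauchy in L^2 with an
   explicit rate; the limit is bounded, hence a limit in every L^p, and the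
   estimate for E follows by letting F exhaust H along the eigenbasis. For p > 2
   the weighted power mean inequality replaces the sum of squares by a sum of
   p-th powers. *)
From HB Require Import structures.
Require Import Defs.
From mathcomp Require Import all_boot all_order all_algebra.
From mathcomp Require Import all_classical all_reals all_analysis.
From mathcomp Require Import measurable_realfun ring lra.
Set Implicit Arguments.
Unset Strict Implicit.
Unset Printing Implicit Defensive.
Import Order.TTheory GRing.Theory Num.Theory.
Import numFieldNormedType.Exports.
Local Open Scope classical_set_scope.
Local Open Scope ring_scope.

(** * Projections onto finite families *)

(** The stated [C_const] leaves no room for a lost factor. Comparing E with the span F of the first
    m eigenvectors costs nothing: pi_F u_k is u_k or 0, so each term of the weighted sum of gaps is
    either the one in the theorem or at most an eigenvalue lambda_k with k >= m, and those form the
    tail of a convergent series. Existence of the extension may lose constants, but must start from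
    what the trace class hypothesis provides, namely some Hilbert basis along which the diagonal of
    A is summable; symmetric elimination along that basis produces the y_k. The measure prescribes
    the law of l_a only for a coming from B'. Reaching every a in H requires B' to be dense in H.
    This rests on three facts: the inclusion of H in B is bounded (Gross measurability tested on
    lines), norming functionals exist on B (Hahn-Banach), and bounded functionals on H are
    represented by vectors (Riesz). Linearity of a |-> l_a and the moment bounds then follow by
    approximation, the latter through Fatou's lemma. Independence of the approximating sequence
    comes from an L^2 bound that holds for every orthonormal family at once. *)

Section InnerProduct.
Context {R : realType} {H : completeNormedModType R} (ip : {dot H for idfun}).
Implicit Types (x y z : H) (c : R).

Lemma ipDl x y z : ip (x + y) z = ip x z + ip y z.
Proof. exact: linearDl. Qed.
Lemma ipZl c x z : ip (c *: x) z = c * ip x z.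
Proof. exact: linearZl_LR. Qed.
Lemma ipDr x y z : ip z (x + y) = ip z x + ip z y.
Proof. exact: linearDr. Qed.
Lemma ipZr c x z : ip z (c *: x) = c * ip z x.
Proof. exact: linearZr_LR. Qed.
Lemma ipC x y : ip x y = ip y x.
Proof. by rewrite hermC expr0 mul1r. Qed.
Lemma ip0l z : ip 0 z = 0.
Proof. exact: linear0l. Qed.
Lemma ip0r z : ip z 0 = 0.
Proof. exact: linear0r. Qed.
Lemma ipBl x y z : ip (x - y) z = ip x z - ip y z.
Proof. exact: linearBl. Qed.
Lemma ipBr x y z : ip z (x - y) = ip z x - ip z y.
Proof. exact: linearBr. Qed.
Lemma ip_suml (I : Type) (r : seq I) (P : pred I) (F : I -> H) z :
  ip (\sum_(i <- r | P i) F i) z = \sum_(i <- r | P i) ip (F i) z.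
Proof. exact: linear_sumlz. Qed.
Lemma ip_sumr (I : Type) (r : seq I) (P : pred I) (F : I -> H) z :
  ip z (\sum_(i <- r | P i) F i) = \sum_(i <- r | P i) ip z (F i).
Proof. by rewrite ipC ip_suml; apply: eq_bigr => i _; rewrite ipC. Qed.
End InnerProduct.

(** Stated for semidefinite forms because it serves both the inner product and the residual forms of
    the Cholesky elimination, which may degenerate. *)
Lemma form_CauchySchwarz (R : realType) (H : lmodType R) (q : H -> H -> R) :
  (forall a x y z, q (a *: x + y) z = a * q x z + q y z) ->
  (forall x y, q x y = q y x) -> (forall x, 0 <= q x x) ->
  forall x y, q x y ^+ 2 <= q x x * q y y.
Proof.
move=> ql qC q0 x y.
have expand (s t : R) : q (s *: x + (t *: y + 0)) (s *: x + (t *: y + 0)) =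
    s ^+ 2 * q x x + 2 * s * t * q x y + t ^+ 2 * q y y.
  have q00 z : q 0 z = 0.
    have := ql 1 0 0 z; rewrite scaler0 addr0 mul1r => h.
    by apply: (addIr (q 0 z)); rewrite -h add0r.
  by rewrite !(ql, qC _ (_ + _), q00, qC _ 0) (qC y x); ring.
have [q1|q1] := eqVneq (q y y) 0.
  have [->|q2] := eqVneq (q x y) 0; first by rewrite expr0n mulr_ge0.
  (* If [q y y] vanishes while [q x y] does not, this multiple of [y] makes the form take the value
     -1. *)
  have := q0 (1 *: x + ((- (q x x + 1) / (2 * q x y)) *: y + 0)).
  rewrite expand q1 => h.
  have : - 1 >= 0 :> R; last by rewrite ler0N1.
  apply: le_trans h _; rewrite le_eqVlt; apply/orP; left; apply/eqP.
  by field; rewrite q2.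
have := q0 (q y y *: x + ((- q x y) *: y + 0)); rewrite expand.
rewrite (_ : _ + _ = q y y * (q x x * q y y - q x y ^+ 2)); last by ring.
by rewrite pmulr_rge0 ?subr_ge0// lt_def q1 q0.
Qed.

Section Hilbert.
Context {R : realType} {H : completeNormedModType R} (ip : {dot H for idfun}).
Hypothesis hn : hilbert_norm ip.
Implicit Types (x y z : H) (c : R).

Lemma ip_CauchySchwarz x y : `|ip x y| <= `|x| * `|y|.
Proof.
rewrite -ler_sqr ?nnegrE ?mulr_ge0// exprMn !hn real_normK ?num_real//.
apply: form_CauchySchwarz => [a u v w|u v|u]; first by rewrite ipDl ipZl.
- exact: ipC.
- by rewrite -hn sqr_ge0.
Qed.

Lemma cvg_ipl (T : Type) (F : set_system T) {FF : Filter F} (u : T -> H) x y :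
  u t @[t --> F] --> x -> ip (u t) y @[t --> F] --> ip x y.
Proof.
move=> ux; apply/cvgrPdist_lt => e e0.
have e1 : 0 < e / (`|y| + 1) by rewrite divr_gt0// ltr_wpDl.
move/cvgrPdist_lt : ux => /(_ _ e1); apply: filterS => t xt.
rewrite -ipBl; apply: le_lt_trans (ip_CauchySchwarz _ _) _.
apply: (@le_lt_trans _ _ (`|x - u t| * (`|y| + 1))).
  by rewrite ler_wpM2l// lerDl.
by rewrite -ltr_pdivlMr// ltr_wpDl.
Qed.

Lemma norm_sqrB x y : `|x - y| ^+ 2 = `|x| ^+ 2 - 2 * ip x y + `|y| ^+ 2.
Proof. by rewrite !hn ipBl !ipBr (ipC ip y x); ring. Qed.

Lemma norm_sqrD x y : `|x + y| ^+ 2 = `|x| ^+ 2 + 2 * ip x y + `|y| ^+ 2.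
Proof. by rewrite !hn ipDl !ipDr (ipC ip y x); ring. Qed.

Lemma parallelogram x y :
  `|x + y| ^+ 2 + `|x - y| ^+ 2 = 2 * `|x| ^+ 2 + 2 * `|y| ^+ 2.
Proof. by rewrite norm_sqrD norm_sqrB; ring. Qed.

(** A minimising sequence for the distance from [x] to [S] is Cauchy by the parallelogram identity.
    [S] is any subspace, closed or not, which suits both uses: the kernel of a functional and the
    image of B' in H. *)
Lemma projection_closure (S : set H) x :
  S 0 -> (forall c u v, S u -> S v -> S (c *: u + v)) ->
  exists2 z, closure S z & forall s, S s -> ip (x - z) s = 0.
Proof.
move=> S0 Slin.
pose D := [set `|x - s| | s in S].
have hD : has_inf D.
  split; first by exists `|x - 0|; exists 0.
  by exists 0 => _ [s _ <-].
pose d := inf D.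
have dle s : S s -> d <= `|x - s| by move=> Ss; apply: ge_inf; [case: hD|exists s].
have d0 : 0 <= d by apply: lb_le_inf; [case: hD|move=> _ [s _ <-]].
have /choice[s sP] n : exists s, S s /\ `|x - s| ^+ 2 < d ^+ 2 + n.+1%:R^-1.
  have : d < Num.sqrt (d ^+ 2 + n.+1%:R^-1).
    rewrite -ltr_sqr ?nnegrE ?sqrtr_ge0// sqr_sqrtr ?addr_ge0 ?sqr_ge0//.
    by rewrite ltrDl.
  rewrite -subr_gt0 => /(inf_adherent)/(_ hD)[_ [s Ss <-]].
  rewrite -/d [X in _ < X]addrC subrK => h; exists s => //.
  rewrite -[X in _ < X]sqr_sqrtr ?addr_ge0 ?sqr_ge0//.
  by rewrite ltr_sqr ?nnegrE ?sqrtr_ge0.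
have Ss n : S (s n) by case: (sP n).
have sd n : `|x - s n| ^+ 2 < d ^+ 2 + n.+1%:R^-1 by case: (sP n).
(* The midpoint of [s n] and [s m] lies in [S], hence at distance at least [d] from [x]; what
   remains in the parallelogram identity is the excess of the two squared distances over
   [d ^+ 2]. *)
have sub n m : `|s n - s m| ^+ 2 <= 2 * n.+1%:R^-1 + 2 * m.+1%:R^-1.
  have := parallelogram (x - s n) (x - s m).
  have -> : x - s n - (x - s m) = s m - s n.
    by rewrite opprB addrC addrA subrK.
  have -> : x - s n + (x - s m) = 2 *: (x - (2^-1 *: s n + 2^-1 *: s m)).
    rewrite scalerBr scalerDr !scalerA divff ?pnatr_eq0// !scale1r.
    by rewrite scaler_nat mulr2n opprD addrACA.
  rewrite normrZ exprMn ger0_norm//.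
  have : d ^+ 2 <= `|x - (2^-1 *: s n + 2^-1 *: s m)| ^+ 2.
    rewrite ler_sqr ?nnegrE//; apply: dle; apply: (Slin) => //.
    by rewrite -[_ *: _]addr0; exact: (Slin).
  rewrite (distrC (s m)); have := sd n; have := sd m.
  by move: (d ^+ 2) (n.+1%:R^-1) (m.+1%:R^-1) => D0 a b; lra.
have /cauchy_cvgP cs : cauchy (s @ \oo).
  apply/cauchy_exP => e e0.
  have [N _ hN] : \forall n \near \oo, (4 * n.+1%:R^-1 : R) < e ^+ 2.
    have : (4 * n.+1%:R^-1 : R) @[n --> \oo] --> (4 * 0 : R).
      by apply: cvgMr; exact: cvg_harmonic.
    by rewrite mulr0 => /cvgr_lt; apply; rewrite exprn_gt0.
  exists (s N); exists N => // m /= Nm; rewrite -ball_normE /ball_ /=.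
  rewrite -ltr_sqr ?nnegrE// ?ltW//; apply: le_lt_trans (sub _ _) (le_lt_trans _ (hN N (leqnn _))).
  have : m.+1%:R^-1 <= N.+1%:R^-1 :> R by rewrite lef_pV2 ?posrE ?ltr0n// ler_nat.
  by move: (m.+1%:R^-1) (N.+1%:R^-1) => a b; lra.
pose z := lim (s @ \oo).
have sz : s @ \oo --> z by [].
exists z.
  move=> U /= Uz; have [N _ hN] := sz _ Uz.
  by exists (s N); split => //; apply: hN => /=.
move=> v Sv.
have xz : `|x - z| <= d.
  have : `|x - s n| @[n --> \oo] --> `|x - z|.
    by apply: cvg_norm; apply: cvgB => //; exact: cvg_cst.
  have sq2 : (d ^+ 2 + n.+1%:R^-1 : R) @[n --> \oo] --> d ^+ 2.
    by rewrite -[X in _ --> X]addr0; apply: cvgD; [exact: cvg_cst|exact: cvg_harmonic].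
  move=> cn; rewrite -ler_sqr ?nnegrE//.
  have cn2 : `|x - s n| ^+ 2 @[n --> \oo] --> `|x - z| ^+ 2.
    by rewrite expr2; under eq_fun do rewrite expr2; exact: cvgM.
  by apply: (ler_cvg_to cn2 sq2); apply: nearW => n; exact: ltW.
have dz t : d <= `|x - z - t *: v|.
  have : `|x - s n - t *: v| @[n --> \oo] --> `|x - z - t *: v|.
    apply: cvg_norm; apply: cvgB; last exact: cvg_cst.
    by apply: cvgB => //; exact: cvg_cst.
  move=> h; apply: (cvgr_to_ge h); apply: nearW => n.
  by rewrite -addrA -opprD; apply: dle; rewrite addrC; exact: (Slin).
have key t : 0 <= t ^+ 2 * `|v| ^+ 2 - 2 * t * ip (x - z) v.
  have : `|x - z| ^+ 2 <= `|x - z - t *: v| ^+ 2.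
    by rewrite ler_sqr ?nnegrE//; exact: le_trans (dz t).
  rewrite (norm_sqrB (x - z)) normrZ exprMn real_normK ?num_real// ipZr.
  by rewrite -subr_ge0; congr (0 <= _); ring.
have [v0|v0] := eqVneq (`|v| ^+ 2) 0.
  by move: v0 => /eqP; rewrite expf_eq0/= normr_eq0 => /eqP ->; rewrite ip0r.
(* This is the minimiser in [t] of the quadratic polynomial of [key]; its value there is minus a
   square. *)
have := key (ip (x - z) v / `|v| ^+ 2).
rewrite (_ : _ - _ = - (ip (x - z) v ^+ 2 / `|v| ^+ 2)); last first.
  by move: (ip _ _) (`|v| ^+ 2) v0 => a b b0; field.
rewrite oppr_ge0 pmulr_lle0 ?invr_gt0 ?lt_def ?v0 ?sqr_ge0// => h.
apply/eqP; rewrite -sqrf_eq0; apply/eqP/le_anti.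
by rewrite h sqr_ge0.
Qed.

Definition pr (n : nat) (w : 'I_n -> H) x := \sum_(i < n) ip x (w i) *: w i.

Lemma pr_span n (w : 'I_n -> H) x : linear_span (range w) (pr w x).
Proof. by exists n, (fun i => ip x (w i)), w; split=> // i; exists i. Qed.

Lemma pr_ortho n (w : 'I_n -> H) x s : Defs.orthonormal ip w ->
  linear_span (range w) s -> ip (x - pr w x) s = 0.
Proof.
move=> ow [m [c [v [vw ->]]]]; rewrite ip_sumr big1// => i _.
have [j _ <-] := vw i; rewrite ipZr ipBl /pr ip_suml (bigD1 j)//= big1 => [|k kj].
  by rewrite ipZl ow eqxx mulr1 addr0 subrr mulr0.
by rewrite ipZl ow (negbTE kj) mulr0.
Qed.

Lemma linear_spanP (S : set H) c x y : linear_span S x -> linear_span S y ->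
  linear_span S (c *: x + y).
Proof.
move=> [n [a [v [vS ->]]]] [m [b [w [wS ->]]]].
exists (n + m)%N, (fun i => match fintype.split i with inl j => c * a j | inr j => b j end),
  (fun i => match fintype.split i with inl j => v j | inr j => w j end).
split=> [i|]; first by case: fintype.split => j.
rewrite big_split_ord/= scaler_sumr; congr (_ + _); apply: eq_bigr => i _.
  by case: splitP => j /= => [/val_inj ->|h]; [rewrite scalerA|have := ltn_ord i; rewrite h ltnNge leq_addr].
case: splitP => j /= => [h|/addnI/val_inj -> //].
by have := ltn_ord j; rewrite -h ltnNge leq_addr.
Qed.

Lemma linear_span0 (S : set H) : linear_span S 0.
Proof.
exists 0%N, (fun=> 0), (fun=> 0); split=> [[]//|]; by rewrite big_ord0.
Qed.

Lemma linear_span_sub (S T : set H) : S `<=` T -> linear_span S `<=` linear_span T.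
Proof.
by move=> ST x [n [c [w [wS ->]]]]; exists n, c, w; split=> // i; exact/ST.
Qed.

Lemma norm_pr_le n (w : 'I_n -> H) x : Defs.orthonormal ip w -> `|pr w x| <= `|x|.
Proof.
move=> ow; have := pr_ortho x ow (pr_span w x); rewrite ipBl => /eqP.
rewrite subr_eq0 -hn => /eqP h; have := norm_sqrB x (pr w x); rewrite h.
rewrite -ler_sqr ?nnegrE//; have := sqr_ge0 (`|x - pr w x|).
by move: (`|x - pr w x| ^+ 2) (`|x| ^+ 2) (`|pr w x| ^+ 2) => a b c; lra.
Qed.

Lemma dist_pr_le n (w : 'I_n -> H) x s : Defs.orthonormal ip w ->
  linear_span (range w) s -> `|x - pr w x| <= `|x - s|.
Proof.
move=> ow ss; have -> : x - s = (x - pr w x) + (pr w x - s) by rewrite addrA subrK.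
rewrite -ler_sqr ?nnegrE// [leRHS]norm_sqrD (pr_ortho x ow) ?mulr0 ?addr0 ?lerDl ?sqr_ge0//.
by rewrite addrC -scaleN1r; apply: linear_spanP => //; exact: pr_span.
Qed.

Lemma dist_pr_norm n (w : 'I_n -> H) x : Defs.orthonormal ip w -> `|x - pr w x| <= `|x|.
Proof.
move=> ow; have := @dist_pr_le _ w x 0 ow (linear_span0 _); by rewrite subr0.
Qed.

(** Uniqueness: the difference of two candidates lies in the span and is orthogonal to the span, so
    to itself. This identifies the point chosen by [get] with the explicit sum. *)
Lemma orth_projE E n (w : 'I_n -> H) x : orthonormal_basis ip E w ->
  orth_proj ip E x = pr w x.
Proof.
move=> [ow ->]; rewrite /orth_proj; have /getPex[] : exists y, linear_span (range w) y /\
    forall z, linear_span (range w) z -> ip (x - y) z = 0.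
  by exists (pr w x); split; [exact: pr_span|move=> z; exact: pr_ortho].
set y := get _ => Ey yo.
apply/eqP; rewrite -subr_eq0 -normr_eq0 -sqrf_eq0 hn.
have sp : linear_span (range w) (y - pr w x).
  by rewrite addrC -scaleN1r; apply: linear_spanP => //; exact: pr_span.
rewrite (_ : ip _ _ = ip (x - pr w x) (y - pr w x) - ip (x - y) (y - pr w x)).
  by rewrite (yo _ sp) (pr_ortho x ow sp) subr0.
by rewrite -ipBl; congr (ip _ _); rewrite opprB [RHS]addrC addrA subrK.
Qed.

Section HilbertBasis.
Variable e : nat -> H.
Hypothesis he : hilbert_basis ip e.

Lemma span_range_nat (x : H) : linear_span (range e) x ->
  exists N, linear_span (range (fun i : 'I_N => e i)) x.
Proof.
move=> [n [c [w [we ->]]]].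
have /choice[k kP] i : exists k, e k = w i by have [k _ <-] := we i; exists k.
exists (\max_(i < n) k i).+1, n, c, w; split=> // i.
have ki : (k i < (\max_(i < n) k i).+1)%N by rewrite ltnS; exact: leq_bigmax.
by exists (Ordinal ki) => //=.
Qed.

(** By density some finite combination lies within [eps] of [x]; it uses only the first [N] vectors,
    and every later projection is at least as close to [x] because projections are best
    approximations. *)
Lemma pr_basis_cvg x : pr (fun i : 'I_n => e i) x @[n --> \oo] --> x.
Proof.
have on n : Defs.orthonormal ip (fun i : 'I_n => e i).
  by move=> i j; rewrite he.1.
apply/cvgrPdist_lt => eps eps0.
have [|y [/= yx /span_range_nat[N sN]]] := he.2 (ball x eps) _ (ball_open x eps).
  by exists x; exact: ballxx.
exists N => // n /= Nn; rewrite -ball_normE /= in yx; apply: le_lt_trans yx.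
apply: dist_pr_le => //; apply: linear_span_sub sN => _ [i _ <-].
by exists (widen_ord Nn i).
Qed.
End HilbertBasis.
End Hilbert.

(** * Nonnegative trace class operators as sums of squares *)

Lemma nneseries_EFin_cvg (R : realType) (u : nat -> R) (l : R) :
  (\sum_(i < n) u i) @[n --> \oo] --> l ->
  (\sum_(k <oo) (u k)%:E = l%:E)%E.
Proof.
move=> ul; apply/cvg_lim => //.
rewrite (_ : (fun n => _) = EFin \o (fun n => \sum_(i < n) u i)).
  by apply/fine_cvgP; split; [exact: nearW|exact: ul].
by apply/funext => n /=; rewrite sumEFin big_mkord.
Qed.

Section Cholesky.
Context {R : realType} {H : completeNormedModType R} (ip : {dot H for idfun}).
Hypothesis hn : hilbert_norm ip.
Implicit Types (x y z : H) (c : R).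

Lemma sqr_norm_pr n (w : 'I_n -> H) x : Defs.orthonormal ip w ->
  `|pr ip w x| ^+ 2 = \sum_(i < n) ip x (w i) ^+ 2.
Proof.
move=> ow; rewrite hn /pr ip_suml; apply: eq_bigr => i _.
rewrite ipZl ip_sumr (bigD1 i)//= big1 => [|k ki].
  by rewrite ipZr ow eqxx mulr1 addr0.
by rewrite ipZr ow eq_sym (negbTE ki) mulr0.
Qed.

Lemma parseval (e : nat -> H) x : hilbert_basis ip e ->
  (\sum_(k <oo) (ip x (e k) ^+ 2)%:E = (`|x| ^+ 2)%:E)%E.
Proof.
move=> he; apply: nneseries_EFin_cvg.
have on n : Defs.orthonormal ip (fun i : 'I_n => e i) by move=> i j; rewrite he.1.
have h : `|pr ip (fun i : 'I_n => e i) x| @[n --> \oo] --> `|x|.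
  by apply: cvg_norm; exact: pr_basis_cvg.
rewrite (_ : (fun n => _) = fun n => `|pr ip (fun i : 'I_n => e i) x| ^+ 2).
  by rewrite expr2; under eq_fun do rewrite expr2; exact: cvgM.
by apply/funext => n; rewrite sqr_norm_pr.
Qed.

(* Independence of the trace from the Hilbert basis, by exchanging the two summations. *)
Lemma trace_exchange (Q : H -> R) (y : nat -> H) (e : nat -> H) :
  hilbert_basis ip e ->
  (forall x, \sum_(k <oo) (ip x (y k) ^+ 2)%:E = (Q x)%:E)%E ->
  (\sum_(j <oo) (Q (e j))%:E = \sum_(k <oo) (`|y k| ^+ 2)%:E)%E.
Proof.
move=> he hQ; transitivity (\sum_(j <oo) \sum_(k <oo) (ip (e j) (y k) ^+ 2)%:E)%E.
  by apply: eq_eseriesr => j _; rewrite hQ.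
rewrite nneseries_interchange => [|k j]; last by rewrite lee_fin sqr_ge0.
apply: eq_eseriesr => k _; rewrite -(parseval (y k) he).
by apply: eq_eseriesr => j _; rewrite ipC.
Qed.

Lemma pr_form_cvg (A : {linear H -> H}) (e : nat -> H) x : continuous A ->
  hilbert_basis ip e ->
  ip (A (x - pr ip (fun i : 'I_n => e i) x)) (x - pr ip (fun i : 'I_n => e i) x)
    @[n --> \oo] --> 0.
Proof.
move=> cA he.
have d0 : x - pr ip (fun i : 'I_n => e i) x @[n --> \oo] --> 0.
  by rewrite -(subrr x); apply: cvgB; [exact: cvg_cst|exact: pr_basis_cvg].
have Ad0 : A (x - pr ip (fun i : 'I_n => e i) x) @[n --> \oo] --> A 0.
  by apply: continuous_cvg => //; exact: cA.
rewrite linear0 in Ad0.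
apply/norm_cvg0P.
have h : `|A (x - pr ip (fun i : 'I_n => e i) x)| *
    `|x - pr ip (fun i : 'I_n => e i) x| @[n --> \oo] --> `|0 : H| * `|0 : H|.
  by apply: cvgM; exact: cvg_norm.
rewrite normr0 mulr0 in h; apply: squeeze_cvgr (cvg_cst 0) h.
by apply: nearW => n; rewrite normr_ge0/= ip_CauchySchwarz.
Qed.

Variables (A : {linear H -> H}) (e : nat -> H).
Hypotheses (cA : continuous A) (sA : selfadjoint ip A) (nA : nonnegative ip A).
Hypothesis he : hilbert_basis ip e.

(** The k-th column of the Cholesky factor of the residual operator [T]. At a zero pivot the
    convention that 0 has inverse 0 makes the column zero. *)
Definition cholesky_step (k : nat) (T : H -> H) :=
  (Num.sqrt (ip (T (e k)) (e k)))^-1 *: T (e k).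

(** Successive Schur complements: the k-th operator is A minus the first k rank one terms. *)
Fixpoint cholesky_rest (k : nat) : H -> H :=
  if k is k'.+1 then
    fun x => cholesky_rest k' x -
      ip x (cholesky_step k' (cholesky_rest k')) *:
        cholesky_step k' (cholesky_rest k')
  else A.

Let T := cholesky_rest.
Let y k := cholesky_step k (T k).

Lemma cholesky_restS k x : T k.+1 x = T k x - ip x (y k) *: y k.
Proof. by []. Qed.

Lemma cholesky_rest_linear k c x z : T k (c *: x + z) = c *: T k x + T k z.
Proof.
elim: k => [|k IH]; first by rewrite /T/= linearP.
rewrite !cholesky_restS IH; move: (y k) => v.
by rewrite ipDl ipZl scalerDl scalerBr scalerA opprD addrACA.
Qed.

Lemma cholesky_rest_sym k x z : ip (T k x) z = ip x (T k z).
Proof.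
elim: k => [|k IH]; first exact: sA.
rewrite !cholesky_restS; move: (y k) => v.
by rewrite ipBl ipBr IH ipZl ipZr (ipC ip v z) mulrC.
Qed.

Lemma cholesky_formS k x : ip (T k.+1 x) x = ip (T k x) x - ip x (y k) ^+ 2.
Proof. by rewrite cholesky_restS ipBl ipZl (ipC ip (y k)). Qed.

(** The subtracted square is [ip (T k x) (e k) ^+ 2] divided by the pivot, which Cauchy-Schwarz for
    the form of [T k] bounds by [ip (T k x) x]. *)
Lemma cholesky_form_ge0 k x : 0 <= ip (T k x) x.
Proof.
elim: k x => [|k IH] x; first exact: nA.
rewrite cholesky_formS subr_ge0 /y /cholesky_step ipZr exprMn exprVn sqr_sqrtr//.
have [->|s0] := eqVneq (ip (T k (e k)) (e k)) 0; first by rewrite invr0 mul0r.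
rewrite mulrC ler_pdivrMr ?lt_def ?s0 ?IH// -cholesky_rest_sym.
apply: (@form_CauchySchwarz _ _ (fun u v => ip (T k u) v)) => [c u v w|u v|u].
- by rewrite cholesky_rest_linear ipDl ipZl.
- by rewrite cholesky_rest_sym ipC.
- exact: IH.
Qed.

Lemma cholesky_form_le k x : ip (T k x) x <= ip (A x) x.
Proof.
elim: k => [//|k IH]; rewrite cholesky_formS.
by apply: le_trans IH; rewrite lerBlDr lerDl sqr_ge0.
Qed.

Lemma cholesky_form_sum k x : \sum_(i < k) ip x (y i) ^+ 2 = ip (A x) x - ip (T k x) x.
Proof.
elim: k => [|k IH]; first by rewrite big_ord0 subrr.
by rewrite big_ord_recr/= IH cholesky_formS; ring.
Qed.

(** Step k eliminates [e k], since [T k (e k)] equals its component along the new column; a vector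
    already eliminated stays so, because the symmetry of [T k] makes it orthogonal to the new
    column. *)
Lemma cholesky_rest_basis k j : (j < k)%N -> T k (e j) = 0.
Proof.
elim: k => // k IH; rewrite ltnS leq_eqVlt => /predU1P[->|jk].
  have h : T k (e k) = ip (e k) (y k) *: y k; last by rewrite cholesky_restS -h subrr.
  have s0 := cholesky_form_ge0 k (e k).
  rewrite /y /cholesky_step ipZr scalerA -(cholesky_rest_sym k (e k) (e k)).
  have [se|se] := eqVneq (ip (T k (e k)) (e k)) 0; last first.
    by rewrite mulrAC -invfM -expr2 sqr_sqrtr// mulVf// scale1r.
  (* Zero pivot: Cauchy-Schwarz for the form of [T k], applied to [e k] and [T k (e k)], forces
     [T k (e k)] to vanish. *)
  rewrite se sqrtr0 invr0 !mul0r scale0r.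
  apply/eqP; rewrite -normr_eq0 -sqrf_eq0 hn -sqrf_eq0.
  apply/eqP/le_anti; rewrite sqr_ge0 andbT.
  have := @form_CauchySchwarz _ _ (fun u v => ip (T k u) v) _ _ _ (e k) (T k (e k)).
  rewrite se mul0r; apply => [c u v w|u v|u].
  - by rewrite cholesky_rest_linear ipDl ipZl.
  - by rewrite cholesky_rest_sym ipC.
  - exact: cholesky_form_ge0.
rewrite cholesky_restS IH// sub0r /y /cholesky_step ipZr -cholesky_rest_sym IH//.
by rewrite ip0l mulr0 scale0r oppr0.
Qed.

Lemma cholesky_rest_pr k x : T k (pr ip (fun i : 'I_k => e i) x) = 0.
Proof.
have T0 : T k 0 = 0.
  have := cholesky_rest_linear k (-1) 0 0.
  by rewrite scaler0 addr0 scaleN1r addNr.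
rewrite /pr; elim/big_ind : _ => // [u v u0 v0|i _].
  by rewrite -[u]scale1r cholesky_rest_linear u0 v0 scaler0 addr0.
by rewrite -[_ *: _]addr0 cholesky_rest_linear T0 cholesky_rest_basis// scaler0 addr0.
Qed.

(** [T k] is symmetric and kills the projection z of [x] on the first k basis vectors, so its form
    at [x] equals its form at x - z. The latter is at most the form of A at x - z, which tends to 0
    by continuity of A. *)
Lemma cholesky_sum x :
  (\sum_(k <oo) (ip x (cholesky_step k (cholesky_rest k)) ^+ 2)%:E = (ip (A x) x)%:E)%E.
Proof.
apply: nneseries_EFin_cvg; under eq_fun do rewrite cholesky_form_sum.
suff T0 : ip (T k x) x @[k --> \oo] --> 0.
  have h : ip (A x) x - ip (T k x) x @[k --> \oo] --> ip (A x) x - 0.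
    by apply: cvgB => //; exact: cvg_cst.
  by rewrite subr0 in h.
apply: squeeze_cvgr (cvg_cst 0) (pr_form_cvg x cA he).
apply: nearW => k; rewrite cholesky_form_ge0/=.
apply: le_trans (cholesky_form_le k _).
set z := pr _ _ _; have z0 : T k z = 0 by exact: cholesky_rest_pr.
have -> : T k (x - z) = T k x.
  by rewrite addrC -scaleN1r cholesky_rest_linear z0 scaler0 add0r.
by rewrite ipBr (cholesky_rest_sym k x z) z0 ip0r subr0.
Qed.

Lemma cholesky : (\sum_(j <oo) (ip (A (e j)) (e j))%:E < +oo)%E ->
  exists y : nat -> H,
    (forall x, \sum_(k <oo) (ip x (y k) ^+ 2)%:E = (ip (A x) x)%:E)%E /\
    (\sum_(k <oo) (`|y k| ^+ 2)%:E < +oo)%E.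
Proof.
exists (fun k => cholesky_step k (cholesky_rest k)); split; first exact: cholesky_sum.
by rewrite -(trace_exchange he cholesky_sum).
Qed.

Variables (u : nat -> H) (lam : nat -> R).
Hypotheses (hu : hilbert_basis ip u) (Au : forall j, A (u j) = lam j *: u j).

Lemma eigenvalueE j : lam j = ip (A (u j)) (u j).
Proof. by rewrite Au ipZl hu.1 eqxx mulr1. Qed.

Lemma eigenvalue_ge0 j : 0 <= lam j.
Proof. by rewrite eigenvalueE nA. Qed.

Lemma eigenbasis_form x :
  (\sum_(k <oo) (lam k * ip x (u k) ^+ 2)%:E = (ip (A x) x)%:E)%E.
Proof.
apply: nneseries_EFin_cvg.
have c1 : A (pr ip (fun i : 'I_n => u i) x) @[n --> \oo] --> A x.
  by apply: continuous_cvg; [exact: cA|exact: pr_basis_cvg].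
have : ip (A (pr ip (fun i : 'I_n => u i) x)) x @[n --> \oo] --> ip (A x) x.
  exact: cvg_ipl.
rewrite (_ : (fun n => _) = (fun n => \sum_(i < n) lam i * ip x (u i) ^+ 2))//.
apply/funext => n; rewrite /pr linear_sum ip_suml; apply: eq_bigr => i _.
by rewrite linearZ/= Au !ipZl (ipC ip (u i)); ring.
Qed.
End Cholesky.

(** * Functions of the symbol class *)

Section SymbolClassBounds.
Context {R : realType} {H : completeNormedModType R} (ip : {dot H for idfun}).
Variables (A : {linear H -> H}) (f : H -> R).
Hypothesis hf : symbol_class ip A f.
Implicit Types (x y z : H) (c : R).

Lemma Cinfty_expansion x (eps : R) : 0 < eps -> \forall k \near (0 : H),
  `|f (x + k) - f x - 'D_k (f : H -> R^o) x| <= eps * `|k|.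
Proof.
move=> e0; have [_ _ h] := hf.1; have := h 0%N x eps e0; apply: filterS => k.
by move=> /(_ [::] erefl); rewrite big_nil mulr1.
Qed.

Lemma Cinfty_deriveZ x c k : 'D_(c *: k) (f : H -> R^o) x = c * 'D_k (f : H -> R^o) x.
Proof.
have [h _ _] := hf.1; have /= h0 := h x [::] [::] 1 0 0.
have /= := h x [::] [::] c k 0; rewrite addr0 => ->.
move: h0; rewrite scaler0 addr0 mul1r => h0.
suff -> : 'D_0 (f : H -> R^o) x = 0 by rewrite addr0.
by apply: (addIr ('D_0 (f : H -> R^o) x)); rewrite -h0 add0r.
Qed.

(** The first order expansion with [eps] equal to 1 and the bound on the first differential give a
    Lipschitz estimate near [x]. *)
Lemma Cinfty_continuous : continuous f.
Proof.
move=> x; have [_ /(_ 1%N x)[C hC] _] := hf.1.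
have C1 : 0 < `|C| + 1 by rewrite ltr_wpDl.
have C2 : 0 < `|C| + 1 + 1 by rewrite ltr_wpDl.
apply/cvgrPdist_lt => e e0.
have /nbhs_norm0P[d /= d0 hd] := Cinfty_expansion x ltr01.
have m0 : 0 < Num.min d (e / (`|C| + 1 + 1)) by rewrite lt_min d0 divr_gt0.
apply/nbhs_normP; exists (Num.min d (e / (`|C| + 1 + 1))) => //= y.
rewrite /ball_/= lt_min => /andP[yd ye].
have /= h1 := hd (y - x); rewrite /= distrC in h1; have {h1} := h1 yd.
rewrite mul1r [x + _]addrC subrK => h1.
have := hC [:: y - x] erefl; rewrite /= big_seq1 => h2.
have h3 : `|f y - f x| <= (`|C| + 1) * `|x - y|.
  rewrite -[f y - f x](subrK ('D_(y - x) (f : H -> R^o) x)).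
  apply: le_trans (ler_normD _ _) _; rewrite mulrDl mul1r addrC lerD//.
    by apply: le_trans h2 _; rewrite (distrC y) ler_wpM2r// ler_norm.
rewrite distrC; apply: le_lt_trans h3 _.
apply: (@le_lt_trans _ _ ((`|C| + 1 + 1) * `|x - y|)).
  by rewrite ler_wpM2r// lerDl.
by rewrite mulrC -ltr_pdivlMr.
Qed.

Lemma is_derive_segment x v (t : R) :
  is_derive t 1 (fun s : R => f (x + s *: v) : R^o) ('D_v (f : H -> R^o) (x + t *: v)).
Proof.
suff h : (fun s : R => s^-1 *: (f (x + (s *: 1 + t) *: v) - f (x + t *: v) : R^o))
    @ 0^' --> 'D_v (f : H -> R^o) (x + t *: v).
  by apply: DeriveDef; [apply/cvg_ex; exists ('D_v (f : H -> R^o) (x + t *: v))|exact/cvg_lim].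
apply/cvgrPdist_le => e e0.
have v1 : 0 < `|v| + 1 by rewrite ltr_wpDl.
have e1 : 0 < e / (`|v| + 1) by rewrite divr_gt0.
have /nbhs_norm0P[d /= d0 hd] := Cinfty_expansion (x + t *: v) e1.
rewrite near_withinE; apply/(@nbhs_normP R R^o) => /=; exists (d / (`|v| + 1)); first by rewrite /= divr_gt0.
move=> s /=; rewrite /ball_/= sub0r normrN => sd s0; have sv : `|s *: v| < d.
  rewrite normrZ; apply: (@le_lt_trans _ _ (`|s| * (`|v| + 1))).
    by rewrite ler_wpM2l// lerDl.
  by rewrite -ltr_pdivlMr.
have /= := hd _ sv; rewrite Cinfty_deriveZ -(addrA x) -scalerDl [t + s]addrC.
rewrite [s%:A](_ : _ = s); last by rewrite -[RHS]mulr1.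
set D := 'D_v _ _; set a := f _; set b := f _ => h.
have sn : 0 < `|s| by rewrite normr_gt0.
rewrite -(ler_pM2l sn) -normrM mulrBr [s * (s^-1 *: _)](mulVKf s0) distrC.
apply: le_trans h _; rewrite normrZ mulrCA ler_wpM2l//.
by rewrite mulrAC ler_pdivrMr// ler_wpM2l ?lerDl// ltW.
Qed.

Lemma symbol_norm_has_inf : has_inf [set C | symbol_bound ip A f C].
Proof. by case: hf => _ [C hC]; split; [exists C|exists 0 => D [/ltW]]. Qed.

Lemma symbol_norm_ge0 : 0 <= symbol_norm ip A f.
Proof. by apply: lb_le_inf; [case: symbol_norm_has_inf|move=> D [/ltW]]. Qed.

Lemma le_symbol_norm x : `|f x| <= symbol_norm ip A f.
Proof. by apply: lb_le_inf; [case: symbol_norm_has_inf|move=> D []]. Qed.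

(** The mean value theorem gives the bound for each admissible constant; dividing by the square root
    carries it over to the infimum of these constants. *)
Lemma symbol_class_lipschitz x y :
  `|f x - f y| <= symbol_norm ip A f * Num.sqrt (quad_form ip A (x - y)).
Proof.
set s := Num.sqrt _; have hC C : symbol_bound ip A f C -> `|f x - f y| <= C * s.
  move=> [_ _ hC]; pose g (t : R) := f (y + t *: (x - y)).
  have := @MVT_segment R g (fun t => 'D_(x - y) (f : H -> R^o) (y + t *: (x - y))) 0 1 ler01.
  case=> [t _|t|c _].
  - exact: is_derive_segment.
  - apply: continuous_subspaceT => {}t; apply: (@differentiable_continuous _ R^o R^o).
    by apply/derivable1_diffP; case: (is_derive_segment y (x - y) t).
  - rewrite /g scale0r addr0 scale1r [y + _]addrC subrK subr0 mulr1 => ->.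
    by have := hC (y + c *: (x - y)) [:: x - y] isT; rewrite /= big_seq1.
(* Division is impossible here, but a single admissible constant already gives [f x = f y]. *)
have [s0|s0] := eqVneq s 0.
  case: hf => _ [C hC0]; have := hC _ hC0; by rewrite s0 !mulr0.
have sp : 0 < s by rewrite lt_def s0 sqrtr_ge0.
rewrite -ler_pdivrMr//; apply: lb_le_inf; first by case: symbol_norm_has_inf.
by move=> D /hC; rewrite ler_pdivrMr.
Qed.
End SymbolClassBounds.

(** * Continuous functionals *)

Section HahnBanach.
Context {R : realType} {B : normedModType R} (v : B).
Implicit Types (G : set (B * R)).

(** A partial linear functional dominated by the norm, encoded by its graph so that unions of chains
    are again of this kind. Single-valuedness follows from domination: an element (0, r) of [G] has
    r <= 0, and so has its opposite. *)
Definition dominated_graph G :=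
  (forall c p q, G p -> G q -> G (c *: p.1 + q.1, c * p.2 + q.2)) /\
  (forall p, G p -> p.2 <= `|p.1|).

(** The value at [x0] must lie above every [q.2 - |q.1 - x0|] and below every [|q.1 + x0| - q.2].
    The triangle inequality separates the two families, and the supremum of the first is taken. *)
Lemma dominated_graph_extension G x0 : dominated_graph G -> G (0, 0) ->
  exists c, dominated_graph
    [set p | exists q t, G q /\ p = (q.1 + t *: x0, q.2 + t * c)].
Proof.
move=> [Glin Gle] G0.
pose D := [set q.2 - `|q.1 - x0| | q in G].
have Dub q : G q -> ubound D (`|q.1 + x0| - q.2).
  move=> Gq _ [p Gp <-]; have := Gle _ (Glin 1 _ _ Gp Gq); rewrite /= scale1r mul1r.
  rewrite lerBrDr addrAC lerBlDr => /le_trans; apply.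
  have -> : p.1 + q.1 = (q.1 + x0) + (p.1 - x0) by rewrite addrACA subrr addr0 addrC.
  exact: ler_normD.
have hD : has_sup D.
  by split; [exists (0 - `|0 - x0|), (0, 0)|exists (`|0 + x0| - 0); exact: (Dub (0, 0))].
pose c := sup D.
have c1 q : G q -> q.2 - `|q.1 - x0| <= c.
  by move=> Gq; apply: ub_le_sup; [case: hD|exists q].
have c2 q : G q -> c <= `|q.1 + x0| - q.2.
  by move=> Gq; apply: ge_sup; [case: hD|exact: Dub].
have Gsc a q : G q -> G (a *: q.1, a * q.2).
  by move=> Gq; have := Glin a _ _ Gq G0; rewrite !addr0.
exists c; split.
  move=> a _ _ [q [t [Gq ->]]] [q' [t' [Gq' ->]]].
  exists (a *: q.1 + q'.1, a * q.2 + q'.2), (a * t + t'); split; first exact: Glin.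
  by congr pair => /=; [rewrite scalerDr scalerA scalerDl addrACA|ring].
move=> _ [q [t [Gq ->]]] /=.
(* Scaling by the inverse of [|t|] reduces the two signs of [t] to the two bounds [c1] and [c2]. *)
have [t0|t0|->] := ltgtP t 0; last by rewrite scale0r mul0r !addr0 Gle.
- have s0 : 0 < - t by rewrite oppr_gt0.
  have := c1 _ (Gsc (- t)^-1 _ Gq); rewrite /= => h.
  have -> : q.1 + t *: x0 = (- t) *: ((- t)^-1 *: q.1 - x0).
    by rewrite scalerBr scalerA divff ?gt_eqF// scale1r scaleNr opprK.
  rewrite normrZ gtr0_norm//; move: h; rewrite lerBlDr.
  rewrite -(ler_pM2l s0) mulrDr mulrA divff ?gt_eqF// mul1r mulNr.
  by move=> h; rewrite -lerBrDr addrC.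
- have := c2 _ (Gsc t^-1 _ Gq); rewrite /= => h.
  have -> : q.1 + t *: x0 = t *: (t^-1 *: q.1 + x0).
    by rewrite scalerDr scalerA divff ?gt_eqF// scale1r.
  rewrite normrZ gtr0_norm//; move: h; rewrite lerBrDr.
  by rewrite -(ler_pM2l t0) mulrDr mulrA divff ?gt_eqF// mul1r addrC.
Qed.

Lemma dominated_graph_functional :
  exists2 G, dominated_graph G & G (v, `|v|) /\ forall x, exists r, G (x, r).
Proof.
pose P G := G = set0 \/ (dominated_graph G /\ G (v, `|v|)).
have [F FP Ftot|G [PG Gmax]] := @Zorn_bigcup _ P.
  have [F0|/existsNP[X /not_implyP[FX X0]]] := pselect (forall X, F X -> X = set0).
    by left; rewrite -subset0 => p [X FX]; rewrite (F0 _ FX).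
  have good Y p : F Y -> Y p -> dominated_graph Y /\ Y (v, `|v|).
    by move=> /FP[->|].
  right; split; last first.
    have /set0P[p Xp] : X != set0 by exact/eqP.
    by exists X => //; case: (good X p).
  split=> [c p q [Y FY Yp] [Z FZ Zq]|p [Y FY Yp]].
    have [YZ|ZY] := Ftot _ _ FY FZ.
      by exists Z => //; apply: (good Z q _ _).1.1 => //; exact: YZ.
    by exists Y => //; apply: (good Y p _ _).1.1 => //; exact: ZY.
  exact: (good Y p FY Yp).1.2.
case: PG => [G0|[Gd Gv]].
  pose G1 : set (B * R) := [set p | exists t, p = (t *: v, t * `|v|)].
  have G1v : G1 (v, `|v|) by exists 1; rewrite scale1r mul1r.
  exfalso; apply: (Gmax G1).
    by rewrite properEneq G0; split; [apply/eqP => h; have := G1v; rewrite -h|exact: sub0set].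
  right; split=> //; split=> [c _ _ [t ->] [s ->]|_ [t ->]].
    by exists (c * t + s); rewrite /= scalerA -scalerDl mulrA -mulrDl.
  by rewrite /= normrZ ler_wpM2r// ler_norm.
exists G => //; split=> // x; apply: contrapT => /forallNP nx.
have G00 : G (0, 0).
  by have := Gd.1 (-1) _ _ Gv Gv; rewrite /= scaleN1r mulN1r !addNr.
have [c Gc] := dominated_graph_extension x Gd G00.
set G' := (X in dominated_graph X) in Gc.
have GG' : G `<=` G'.
  by move=> [a b] Gab; exists (a, b), 0; rewrite scale0r mul0r !addr0.
apply: (Gmax G').
  rewrite properEneq; split=> //; apply/eqP => h.
  apply: (nx c); rewrite h; exists (0, 0), 1; split=> //=.
  by rewrite scale1r mul1r !add0r.
by right; split=> //; exact: GG'.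
Qed.

(** A functional of norm at most 1 that attains the norm at [v]. It detects nonzero vectors of B in
    the proof that B' is dense in H. *)
Lemma hahn_banach_norm :
  exists y : {scalar B},
    [/\ continuous (y : B -> R^o), forall x, `|y x| <= `|x| & y v = `|v|].
Proof.
have [G [Glin Gle] [Gv /choice[y yG]]] := dominated_graph_functional.
have Gsub p q : G p -> G q -> p.1 = q.1 -> p.2 = q.2.
  suff le p' q' : G p' -> G q' -> p'.1 = q'.1 -> p'.2 <= q'.2.
    by move=> Gp Gq pq; apply/le_anti; rewrite !le.
  move=> {p q} Gp Gq pq; have := Gle _ (Glin (-1) _ _ Gq Gp).
  by rewrite /= pq scaleN1r addNr normr0 mulN1r addrC subr_le0.
have y_lin : linear_for *%R y.
  move=> c x z; apply: (Gsub (_, _) (_, _) (yG _) _ _) => //=.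
  exact: (Glin c (x, y x) (z, y z)).
pose Y : {scalar B} := HB.pack y (GRing.isLinear.Build R B R *%R y y_lin).
have yle x : `|y x| <= `|x|.
  rewrite ler_norml (Gle _ (yG x)) andbT lerNl -normrN.
  have -> : - y x = y (- x) by rewrite -[RHS]/(Y (- x)) linearN.
  exact: (Gle _ (yG (- x))).
exists Y; split=> //; last exact: (Gsub (_, _) (_, _) (yG _) Gv).
move=> x; apply/cvgrPdist_lt => e e0; apply/nbhs_normP; exists e => //= z.
rewrite /ball_/= => xz; apply: le_lt_trans xz.
by rewrite -(linearB Y) /=; exact: yle.
Qed.
End HahnBanach.

(** * Riesz representation of bounded functionals *)

Section Riesz.
Context {R : realType} {H : completeNormedModType R} (ip : {dot H for idfun}).
Hypothesis hn : hilbert_norm ip.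

(** The projection z of a point outside the kernel lies in the closure of the kernel, hence in the
    kernel by the bound on [phi]; the remainder b spans the orthogonal complement of the kernel. *)
Lemma riesz (phi : {scalar H}) (M : R) : (forall x, `|phi x| <= M * `|x|) ->
  exists a, forall x, phi x = ip a x.
Proof.
move=> hM; have [h|/existsNP[x0 /eqP px0]] := pselect (forall x, phi x = 0).
  by exists 0 => x; rewrite h ip0l.
have [|c u w u0 w0|z cz zo] := @projection_closure _ _ _ hn [set s | phi s = 0] x0.
- by rewrite /= linear0.
- by rewrite /= linearP/= u0 w0 mulr0 addr0.
have z0 : phi z = 0.
  apply/eqP; rewrite -normr_eq0; apply/eqP/le_anti; rewrite normr_ge0 andbT.
  apply/ler_addgt0Pl => e e0; rewrite addr0.
  have M1 : 0 < `|M| + 1 by rewrite ltr_wpDl.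
  have [s [/= ps zs]] := cz _ (nbhsx_ballx z (e / (`|M| + 1)) (divr_gt0 e0 M1)).
  rewrite -[z](subrK s) linearD/= ps addr0; apply: le_trans (hM _) _.
  move: zs; rewrite -ball_normE/= => /ltW zs.
  apply: (@le_trans _ _ ((`|M| + 1) * `|z - s|)).
    by rewrite ler_wpM2r// (le_trans (ler_norm M))// lerDl.
  by rewrite mulrC -ler_pdivlMr.
set b := x0 - z in zo; have pb : phi b = phi x0 by rewrite linearB/= z0 subr0.
have b0 : ip b b != 0.
  rewrite -hn sqrf_eq0 normr_eq0; apply: contra_neq px0 => b0.
  by rewrite -pb b0 linear0.
exists ((phi b / ip b b) *: b) => x.
have pZ a w : phi (a *: w) = a * phi w by rewrite linearZ.
(* This combination lies in the kernel, so it is orthogonal to [b], which determines [phi x]. *)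
have /zo : phi (phi b *: x - phi x *: b) = 0.
  by rewrite linearB !pZ mulrC subrr.
rewrite ipBr !ipZr => /subr0_eq h; rewrite ipZl mulrAC h mulfK//.
Qed.
End Riesz.

(** * Absolute moments of the normal distribution *)

Section NormalMoments.
Context {R : realType}.
Implicit Types (s p x t : R).

Lemma continuous_norm_powR p : 0 < p -> continuous (fun x : R => `|x| `^ p).
Proof.
move=> p0 x; have [->|x0] := eqVneq x 0.
  apply/cvgrPdist_lt => e e0; have e1 : 0 < e `^ p^-1 by exact: powR_gt0.
  apply/nbhs_normP; exists (e `^ p^-1) => //= y.
  rewrite /ball_/= sub0r normrN normr0 powR0 ?gt_eqF// sub0r normrN => ye.
  rewrite ger0_norm ?powR_ge0//.
  have -> : e = (e `^ p^-1) `^ p by rewrite -powRrM mulVf ?gt_eqF// powRr1 ?ltW.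
  by rewrite gt0_ltr_powR// nnegrE ?powR_ge0.
have nx0 : 0 < `|x| by rewrite normr_gt0.
apply: (@continuous_comp _ _ _ (fun z : R => `|z|) (fun z : R => z `^ p)).
  exact: norm_continuous.
apply/differentiable_continuous/derivable1_diffP/derivable_powR.
by rewrite in_itv/= nx0.
Qed.

(** The density and the Radon-Nikodym derivative have the same integral over every measurable set,
    so they agree almost everywhere. *)
Lemma integral_normal_prob s (f : R -> \bar R) : s != 0 ->
  measurable_fun setT f -> (forall x, 0 <= f x)%E ->
  (\int[normal_prob 0 s]_x f x =
   \int[lebesgue_measure]_x (f x * (normal_pdf 0 s x)%:E))%E.
Proof.
move=> s0 mf f0.
have dom := normal_prob_dominates 0 s.
pose nu : {finite_measure set _ -> \bar R} := normal_prob 0 s.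
rewrite -(@Radon_Nikodym_SigmaFinite.change_of_variables _ _ _ nu _ dom)//.
apply: ae_eq_integral => //.
- apply: emeasurable_funM => //.
  exact: (measurable_int _ (Radon_Nikodym_SigmaFinite.f_integrable dom)).
- by apply: emeasurable_funM => //; apply/measurable_EFinP; exact: measurable_normal_pdf.
- apply: ae_eqe_mul2l; apply: integral_ae_eq => //.
  + exact: Radon_Nikodym_SigmaFinite.f_integrable.
  + by apply/measurable_EFinP; exact: measurable_normal_pdf.
  + by move=> E _ mE; rewrite -Radon_Nikodym_SigmaFinite.f_integral.
Qed.

(** The quotient of [(1 + e) * normal_pdf 0 (s * (1 + e)) x] by [normal_pdf 0 s x] is exp(k x^2),
    where k is the coefficient of [x ^+ 2] on the left; then exp y >= 1 + y. *)
Lemma normal_pdf_dilation s e x : 0 < s -> 0 < e ->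
  normal_pdf 0 s x * (1 + (1 - (1 + e) ^- 2) / (2 * s ^+ 2) * x ^+ 2) <=
  (1 + e) * normal_pdf 0 (s * (1 + e)) x.
Proof.
move=> s0 e0; have r0 : 0 < 1 + e by rewrite addr_gt0.
set k := _ / _; have kE : k = (1 - (1 + e) ^- 2) / (2 * s ^+ 2) by [].
clearbody k; rewrite !normal_pdfE ?mulf_neq0 ?gt_eqF// /normal_fun !subr0.
have -> : normal_peak (s * (1 + e)) = (1 + e)^-1 * normal_peak s.
  rewrite /normal_peak -invfM; congr (_^-1).
  have -> : (s * (1 + e)) ^+ 2 * pi *+ 2 = (1 + e) ^+ 2 * (s ^+ 2 * pi *+ 2) by ring.
  by rewrite sqrtrM ?sqr_ge0// sqrtr_sqr gtr0_norm.
rewrite !mulrA divff ?gt_eqF// mul1r -!mulrA ler_wpM2l ?normal_peak_ge0//.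
have -> : - x ^+ 2 / ((s * (1 + e)) ^+ 2 *+ 2) = - x ^+ 2 / (s ^+ 2 *+ 2) + k * x ^+ 2.
  have aux (X a b : R) : a != 0 -> b != 0 ->
      - X / (2 * (a * b)) = - X / (2 * a) + (1 - b^-1) / (2 * a) * X.
    by move=> a0 b0; field; rewrite a0 b0.
  rewrite kE exprMn -[(_ * _) *+ 2]mulr_natl -[s ^+ 2 *+ 2]mulr_natl.
  by apply: aux; rewrite expf_neq0// gt_eqF.
by rewrite expRD ler_wpM2l ?expR_ge0// expR_ge1Dx.
Qed.

(** The hypothesis amounts to m <= 2 a (1 + e)^2 / (2 + e), whose right side tends to [a] with
    [e]. *)
Lemma moment_bound_algebra (a e m : R) : 0 < a -> 0 < e ->
  (1 - (1 + e) ^- 2) / (2 * a) * m <= e -> m <= a + 2 * a * e.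
Proof.
move=> a0 e0 h; have r0 : 0 < 1 + e by rewrite addr_gt0.
have h3 : m * (e * (2 + e)) <= e * (2 * a * (1 + e) ^+ 2).
  rewrite [leLHS](_ : _ = (1 - (1 + e) ^- 2) / (2 * a) * m * (2 * a * (1 + e) ^+ 2)).
    by rewrite ler_wpM2r// ?mulr_ge0 ?sqr_ge0 ?ltW.
  by field; rewrite !gt_eqF.
rewrite mulrCA ler_pM2l// in h3.
rewrite -(@ler_pM2r _ (2 + e)) ?addr_gt0//; apply: le_trans h3 _.
rewrite -subr_ge0 (_ : _ - _ = a * e); first by rewrite mulr_ge0 ?ltW.
by ring.
Qed.

(* Comparing the normalisations of the normal densities of deviations s and
   (1 + e) s bounds the second moment, because exp y >= 1 + y. *)
Lemma normal_moment2_le s : 0 < s ->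
  (\int[normal_prob 0 s]_x (x ^+ 2)%:E <= (s ^+ 2)%:E)%E.
Proof.
move=> s0; have sn0 : s != 0 by rewrite gt_eqF.
have mx : measurable_fun [set: R] (fun x : R => (x ^+ 2)%:E).
  by apply/measurable_EFinP; exact: measurable_funX.
rewrite integral_normal_prob//; last by move=> x; rewrite lee_fin sqr_ge0.
have mpdf r : measurable_fun [set: R] (fun x : R => (normal_pdf 0 r x)%:E).
  by apply/measurable_EFinP; exact: measurable_normal_pdf.
set M := (X in (X <= _)%E).
have M0 : (0 <= M)%E.
  by apply: integral_ge0 => x _; rewrite -EFinM lee_fin mulr_ge0 ?sqr_ge0 ?normal_pdf_ge0.
(* The dilation inequality integrated: the two densities contribute total masses 1 and 1 + e. *)
have key e : 0 < e ->
    (1 + ((1 - (1 + e) ^- 2) / (2 * s ^+ 2))%:E * M <= (1 + e)%:E)%E.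
  move=> e0; set k := _ / _; have r0 : 0 < 1 + e by rewrite addr_gt0.
  have k0 : 0 <= k.
    apply: divr_ge0; last by rewrite mulr_ge0 ?sqr_ge0.
    by rewrite subr_ge0 invf_le1 ?exprn_gt0// exprn_ege1// lerDl ltW.
  have e1 : ((1 + e)%:E = \int[lebesgue_measure]_x
      ((1 + e)%:E * (normal_pdf 0 (s * (1 + e)) x)%:E))%E.
    rewrite ge0_integralZl//; first by rewrite integral_normal_pdf mule1.
    - exact: mpdf.
    - by move=> x _; rewrite lee_fin normal_pdf_ge0.
    - by rewrite lee_fin ltW.
  rewrite [leRHS]e1 /M -ge0_integralZl; last 4 first.
    exact: measurableT.
    by apply: emeasurable_funM; [exact: mx|exact: mpdf].
    by move=> x _; rewrite -EFinM lee_fin mulr_ge0 ?sqr_ge0 ?normal_pdf_ge0.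
    by rewrite lee_fin.
  have -> : 1%E = (\int[lebesgue_measure]_x (normal_pdf 0 s x)%:E)%E.
    by rewrite integral_normal_pdf.
  have mkx : measurable_fun [set: R] (fun x : R => k%:E * ((x ^+ 2)%:E * (normal_pdf 0 s x)%:E))%E.
    apply: emeasurable_funM; first exact: measurable_cst.
    by apply: emeasurable_funM; [exact: mx|exact: mpdf].
  rewrite -ge0_integralD; last 5 first.
    exact: measurableT.
    by move=> x _; rewrite lee_fin normal_pdf_ge0.
    exact: mpdf.
    by move=> x _; rewrite -!EFinM lee_fin; do 2![apply: mulr_ge0 => //]; rewrite ?sqr_ge0 ?normal_pdf_ge0.
    exact: mkx.
  apply: ge0_le_integral.
  - exact: measurableT.
  - by move=> x _; apply: adde_ge0; rewrite -?EFinM lee_fin ?normal_pdf_ge0//; do 2![apply: mulr_ge0 => //]; rewrite ?sqr_ge0 ?normal_pdf_ge0.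
  - by apply: emeasurable_funD; [exact: mpdf|exact: mkx].
  - by apply: emeasurable_funM; [exact: measurable_cst|exact: mpdf].
  move=> x _; rewrite -!EFinM -EFinD lee_fin.
  by rewrite mulrA -[X in X + _]mul1r -mulrDl mulrC; exact: normal_pdf_dilation.
apply/lee_addgt0Pr => d d0.
(* Chosen so that the slack [2 * s ^+ 2 * e] of [moment_bound_algebra] equals [d]. *)
pose e := d / (2 * s ^+ 2).
have e0 : 0 < e by rewrite divr_gt0// mulr_gt0// exprn_gt0.
(* An infinite second moment would make the left side of [key] infinite, because the coefficient of
   [M] is positive. *)
have := key e e0; case: M M0 {key} => [m| |]//= m0; last first.
  rewrite gt0_muley ?addey ?leye_eq// lte_fin divr_gt0//; last by rewrite mulr_gt0// exprn_gt0.
  by rewrite subr_gt0 invf_lt1 ?exprn_gt0 ?addr_gt0// exprn_egt1// ltrDl.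
rewrite -EFinM -!EFinD !lee_fin => h.
have s2 : 0 < s ^+ 2 by rewrite exprn_gt0.
have -> : d = 2 * s ^+ 2 * e by rewrite /e mulrC divfK// gt_eqF// mulr_gt0.
have h2 : (1 - (1 + e) ^- 2) / (2 * s ^+ 2) * m <= e by move: h; rewrite lerD2l.
exact: moment_bound_algebra.
Qed.

End NormalMoments.

(** * Gamma integrals and absolute moments of order greater than 2 *)

Section GammaMoments.
Context {R : realType}.
Implicit Types (s p x t : R).

(** One Taylor term of exp(t/2), of order n + 1 with n >= q, already dominates t^q; this explains
    the constant 2^(n+1) (n+1)!. *)
Lemma powR_expR_le q : 0 <= q -> exists2 C : R, 0 < C &
  forall t, 0 <= t -> t `^ q * expR (- t) <= C * expR (- 2^-1 * t).
Proof.
move=> q0; have [n qn] : exists n : nat, q <= n%:R.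
  by exists (Num.bound q); exact: ltW (archi_boundP q0).
exists (2 ^+ n.+1 * n.+1`!%:R); first by rewrite mulr_gt0 ?exprn_gt0// ltr0n fact_gt0.
move=> t t0; rewrite (_ : - t = 2^-1 * - t + - 2^-1 * t); last by field.
rewrite expRD mulrA ler_wpM2r ?expR_ge0//.
have f0 : 0 < n.+1`!%:R :> R by rewrite ltr0n fact_gt0.
have h : 2 ^- n.+1 * (1 + t ^+ n.+1) / n.+1`!%:R <= expR (2^-1 * t).
  apply: le_trans (@expR_ge1Dxn _ (2^-1 * t) n _); last by rewrite mulr_ge0.
  rewrite mulrDr mulr1 mulrDl exprMn exprVn lerD2r.
  rewrite -invfM invf_le1 ?mulr_gt0 ?exprn_gt0//.
  rewrite -natrX -natrM ler1n muln_gt0 expn_gt0 fact_gt0//.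
have -> : 2^-1 * - t = - (2^-1 * t) by rewrite mulrN.
rewrite expRN ler_pdivrMr ?expR_gt0//.
apply: (@le_trans _ _ (1 + t ^+ n.+1)); last first.
  move: h; rewrite -(ler_pM2l (x := 2 ^+ n.+1 * n.+1`!%:R)) ?mulr_gt0 ?exprn_gt0//.
  rewrite (_ : _ * (_ / _) = 1 + t ^+ n.+1)//; field.
  by rewrite gt_eqF//= expf_neq0.
have [t1|t1] := leP t 1.
  apply: (@le_trans _ _ 1); last by rewrite lerDl exprn_ge0.
  have [->|tn0] := eqVneq t 0.
    by rewrite /powR eqxx; case: eqP => _ //=; rewrite ?ler01.
  rewrite -(powRr0 t); apply: ger_powR => //.
  by rewrite lt_def tn0 t0 t1.
rewrite -powR_mulrn//; apply: (@le_trans _ _ (t `^ n.+1%:R)); last by rewrite lerDr.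
by apply: ler_powR; rewrite ?(ltW t1)// (le_trans qn)// ler_nat.
Qed.

(** The integrand of [Gamma (q + 1)] on the positive axis; the absolute value makes it continuous on
    the whole line. *)
Let Gfun q (t : R) := `|t| `^ q * expR (- t).

Lemma continuous_Gamma_integrand q : 0 < q -> continuous (Gfun q).
Proof.
move=> q0 t; apply: cvgM; first exact: continuous_norm_powR.
by apply: continuous_comp; [exact: continuousN|exact: continuous_expR].
Qed.

Lemma measurable_Gamma_integrand q : 0 < q -> measurable_fun [set: R] (Gfun q).
Proof. by move=> q0; apply: continuous_measurable_fun; exact: continuous_Gamma_integrand. Qed.

(** [Gamma] is a real-valued integral, which carries no information about an infinite one;
    finiteness is what allows [Gamma] to bound the extended integrals below. *)
Lemma Gamma_integrable q : 0 < q ->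
  (\int[lebesgue_measure]_(t in `]0%R, +oo[) (Gfun q t)%:E < +oo)%E.
Proof.
move=> q0; have [C C0 hC] := powR_expR_le (ltW q0).
have mG := measurable_Gamma_integrand q0.
have me : measurable_fun [set: R] (exponential_pdf (2^-1 : R)).
  exact: measurable_exponential_pdf.
(* The exponential density of rate 1/2 is exp(-t/2)/2, hence the factor 2. *)
apply: (@le_lt_trans _ _ (\int[lebesgue_measure]_(t in `]0%R, +oo[)
    ((2 * C)%:E * (exponential_pdf 2^-1 t)%:E))%E).
  apply: ge0_le_integral.
  - exact: measurable_itv.
  - by move=> t _; rewrite lee_fin mulr_ge0 ?powR_ge0 ?expR_ge0.
  - by apply: measurable_funTS; apply/measurable_EFinP.
  - by apply: measurable_funTS; apply: emeasurable_funM; [exact: measurable_cst|apply/measurable_EFinP].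
  - move=> t; rewrite /= in_itv/= andbT => t0; rewrite -EFinM lee_fin.
    rewrite exponential_pdfE ?(ltW t0)// mulrA (mulrAC 2) divff// mul1r.
    by rewrite /Gfun gtr0_norm//; exact: hC (ltW t0).
rewrite ge0_integralZl; last 4 first.
- exact: measurable_itv.
- by apply: measurable_funTS; apply/measurable_EFinP.
- by move=> t _; rewrite lee_fin exponential_pdf_ge0.
- by rewrite lee_fin mulr_ge0 ?ltW.
apply: (@le_lt_trans _ _ ((2 * C)%:E * 1)%E); last by rewrite mule1 ltry.
apply: lee_wpmul2l; first by rewrite lee_fin mulr_ge0 ?ltW.
rewrite -(@integral_exponential_pdf R 2^-1)//.
apply: ge0_subset_integral => //.
- exact/measurable_EFinP.
- by move=> t _; rewrite lee_fin exponential_pdf_ge0.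
Qed.

Lemma Gamma_ge0 s : 0 <= Gamma s.
Proof.
by apply: Rintegral_ge0 => t _; rewrite mulr_ge0 ?powR_ge0 ?expR_ge0.
Qed.

Lemma integral_Gamma_le q (M : R) : 0 < q ->
  (\int[lebesgue_measure]_(t in `[0%R, M]) (Gfun q t)%:E <= (Gamma (q + 1))%:E)%E.
Proof.
move=> q0; have mG := measurable_Gamma_integrand q0.
have -> : (Gamma (q + 1))%:E = (\int[lebesgue_measure]_(t in `]0%R, +oo[) (Gfun q t)%:E)%E.
  rewrite /Gamma /Rintegral addrK.
  rewrite (_ : (\int[_]_(x in _) _)%E = (\int[lebesgue_measure]_(t in `]0%R, +oo[) (Gfun q t)%:E)%E).
    rewrite fineK// ge0_fin_numE ?Gamma_integrable//.
    by apply: integral_ge0 => t _; rewrite lee_fin mulr_ge0 ?powR_ge0 ?expR_ge0.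
  apply: eq_integral => t; rewrite inE/= in_itv/= andbT => t0.
  by rewrite /Gfun gtr0_norm.
rewrite integral_itv_obnd_cbnd; last by apply: measurable_funTS; apply/measurable_EFinP.
apply: ge0_subset_integral.
- exact: measurable_itv.
- exact: measurable_itv.
- by apply: measurable_funTS; apply/measurable_EFinP.
- by move=> t _; rewrite lee_fin mulr_ge0 ?powR_ge0 ?expR_ge0.
- by move=> t; rewrite /= !in_itv/= => /andP[-> _].
Qed.

(** The substitution t^2 / (2 s^2) turns the half-line moment into a Gamma integral, on a bounded
    interval as the substitution rule demands. [K_const p] to the power p is the p-th absolute
    moment of the standard normal law; the factor 1/2 accounts for the half line. *)
Lemma integral_powR_normal_le p s (M : R) : 2 < p -> 0 < s -> 0 <= M ->
  (\int[lebesgue_measure]_(t in `[0%R, M]) (`|t| `^ p * normal_pdf 0 s t)%:E <=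
    (2^-1 * (s `^ p * K_const p `^ p))%:E)%E.
Proof.
move=> p2 s0 M0; have sn0 : s != 0 by rewrite gt_eqF.
have p0 : 0 < p by apply: lt_trans p2.
pose q := (p - 1) / 2; have q0 : 0 < q by rewrite divr_gt0// subr_gt0 (lt_trans _ p2)// ltr1n.
have q2 : 2%:R * q = p - 1 by rewrite /q mulrC divfK.
pose F t := (2 * s ^+ 2)^-1 * t ^+ 2.
have dF (t : R) : is_derive t 1 (F : R -> R^o) (s ^- 2 * t).
  rewrite (_ : F = (2 * s ^+ 2)^-1 *: ((id : R -> R^o) ^+ 2)); last by apply/funext.
  apply: is_derive_eq; rewrite /GRing.scale/= expr1 mulr1.
  by field; rewrite sn0.
have F' : (F^`())%classic = fun t => s ^- 2 * t.
  by apply/funext => t; rewrite derive1E; exact: derive_val.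
have cF : continuous F.
  by move=> t; apply/(@differentiable_continuous _ R^o R^o)/derivable1_diffP; case: (dF t).
have cF' : continuous (F^`())%classic.
  by rewrite F' => t; apply: cvgM; [exact: cvg_cst|exact: cvg_id].
have F0 : F 0 = 0 by rewrite /F expr0n mulr0.
have s20 : 0 < 2 * s ^+ 2 by rewrite mulr_gt0// exprn_gt0.
have sub : (\int[lebesgue_measure]_(t in `[F 0%R, F M]) (Gfun q t)%:E =
    \int[lebesgue_measure]_(t in `[0%R, M]) (((Gfun q \o F) * (F^`())%classic) t)%:E)%E.
  apply: integration_by_substitution_increasing => //.
  - move=> x y; rewrite !in_itv/= => /andP[x0 _] /andP[y0 _] xy.
    by rewrite /F ltr_pM2l ?invr_gt0// ltr_sqr ?nnegrE.
  - by apply: cvgP; apply: cvg_at_right_filter; exact: cF'.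
  - by apply: cvgP; apply: cvg_at_left_filter; exact: cF'.
  - split; first by move=> x _; case: (dF x).
    + by apply: cvg_at_right_filter; exact: cF.
    + by apply: cvg_at_left_filter; exact: cF.
  - by apply: continuous_subspaceT; exact: continuous_Gamma_integrand.
(* With t^2 = 2 s^2 F(t) and p = 2q + 1, t^p is (2 s^2)^q F(t)^q t, and t is s^2 F'(t); [k] collects
   the constants. *)
pose k := normal_peak s * (2 * s ^+ 2) `^ q * s ^+ 2.
have k0 : 0 <= k by rewrite mulr_ge0 ?sqr_ge0// mulr_ge0 ?normal_peak_ge0 ?powR_ge0.
have mGF : measurable_fun [set: R] ((Gfun q \o F) * (F^`())%classic).
  apply: continuous_measurable_fun => t; apply: cvgM; last exact: cF'.
  by apply: continuous_comp; [exact: cF|exact: continuous_Gamma_integrand].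
have -> : (\int[lebesgue_measure]_(t in `[0%R, M]) (`|t| `^ p * normal_pdf 0 s t)%:E =
    k%:E * \int[lebesgue_measure]_(t in `[F 0%R, F M]) (Gfun q t)%:E)%E.
  rewrite sub -ge0_integralZl; last 4 first.
  - exact: measurable_itv.
  - by apply: measurable_funTS; apply/measurable_EFinP.
  - move=> t; rewrite /= in_itv/= => /andP[t0 _]; rewrite lee_fin F'.
    by rewrite !mulr_ge0 ?powR_ge0 ?expR_ge0// invr_ge0 sqr_ge0.
  - by rewrite lee_fin.
  apply: eq_integral => t; rewrite inE/= in_itv/= => /andP[t0 _].
  rewrite -EFinM; congr EFin; rewrite /= !fctE/= F' /Gfun normal_pdfE//.
  rewrite /normal_fun subr0 ger0_norm// /k.
  have -> : - t ^+ 2 / (s ^+ 2 *+ 2) = - F t.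
    by rewrite /F -[_ *+ 2]mulr_natl mulNr mulrC.
  have Ft0 : 0 <= F t by rewrite mulr_ge0 ?sqr_ge0// invr_ge0 ltW.
  have -> : t `^ p = (2 * s ^+ 2) `^ q * `|F t| `^ q * t.
    rewrite (ger0_norm Ft0) -powRM ?(ltW s20)// (_ : 2 * s ^+ 2 * F t = t ^+ 2); last first.
      by rewrite /F mulVKf// gt_eqF.
    rewrite -powR_mulrn// -powRrM q2 -[X in _ * X](powRr1 t0).
    rewrite -powRD ?subrK//; apply/implyP => /eqP.
    by move=> h; rewrite h ltxx in p0.
  by move: (normal_peak s) (_ `^ q) (_ `^ q) (expR _) => a b c d; field.
rewrite F0; apply: le_trans (lee_wpmul2l _ (integral_Gamma_le (F M) q0)) _.
  by rewrite lee_fin.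
(* What remains is an identity between constants: both sides are s^p 2^(p/2 - 1) pi^(-1/2)
   Gamma((p+1)/2). *)
rewrite -EFinM lee_fin le_eqVlt; apply/orP; left; apply/eqP.
have -> : q + 1 = (p + 1) / 2 by rewrite /q; field.
have pi0 : 0 < pi :> R by exact: pi_gt0.
have G0 := Gamma_ge0 ((p + 1) / 2).
rewrite /K_const !powRM ?mulr_ge0 ?powR_ge0// -!powRrM mulVf ?gt_eqF// powRr1//.
rewrite /k /normal_peak.
have -> : Num.sqrt (s ^+ 2 * pi *+ 2) = s * pi `^ 2^-1 * 2 `^ 2^-1.
  have -> : s ^+ 2 * pi *+ 2 = s ^+ 2 * (pi * 2) by ring.
  rewrite (sqrtrM (pi * 2) (sqr_ge0 s)) (sqrtrM 2 (ltW pi0)) sqrtr_sqr gtr0_norm// mulrA.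
  by rewrite !powR12_sqrt ?(ltW pi0).
have -> : - (2 * p)^-1 * p = - 2^-1 by field; rewrite gt_eqF.
rewrite powRN powRM ?sqr_ge0//.
have -> : (s ^+ 2) `^ q = s `^ p / s.
  rewrite -powR_mulrn ?ltW// -powRrM q2 powRB ?powRr1 ?ltW//.
  by apply/implyP => _; rewrite gt_eqF.
have -> : 2 `^ (2^-1 * p) = 2 `^ q * 2 `^ 2^-1 :> R.
  rewrite -powRD; first by congr (_ `^ _); rewrite /q; field.
  by apply/implyP => _; rewrite pnatr_eq0.
have -> : 2 `^ q * 2 `^ 2^-1 = 2 `^ q * 2 / 2 `^ 2^-1 :> R.
  rewrite -mulrA; congr (_ * _); rewrite powR12_sqrt//.
  have h : Num.sqrt 2 != 0 :> R by rewrite gt_eqF// sqrtr_gt0.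
  by apply: (mulIf h); rewrite mulfVK// -expr2 sqr_sqrtr.
have a0 : pi `^ 2^-1 != 0 :> R by rewrite gt_eqF// powR_gt0.
have b0 : 2 `^ 2^-1 != 0 :> R by rewrite gt_eqF// powR_gt0.
move: (pi `^ 2^-1) (2 `^ 2^-1) (2 `^ q) (s `^ p) (Gamma _) a0 b0 => a b c d e a0 b0.
by field; rewrite a0 b0 sn0.
Qed.

(** By symmetry the moment is twice the half-line integral, which is the monotone limit of the
    integrals over [0, n]. *)
Lemma normal_momentp_le p s : 2 < p -> 0 < s ->
  (\int[normal_prob 0 s]_x (`|x| `^ p)%:E <= (s `^ p * K_const p `^ p)%:E)%E.
Proof.
move=> p2 s0; have sn0 : s != 0 by rewrite gt_eqF.
have p0 : 0 < p by apply: lt_trans p2.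
have mp : measurable_fun [set: R] (fun x : R => `|x| `^ p).
  by apply: continuous_measurable_fun; exact: continuous_norm_powR.
rewrite integral_normal_prob//; last exact/measurable_EFinP.
under eq_integral do rewrite -EFinM.
have cf : continuous (fun t : R => `|t| `^ p * normal_pdf 0 s t).
  by move=> t; apply: cvgM; [exact: continuous_norm_powR|exact: continuous_normal_pdf].
have f0 t : 0 <= `|t| `^ p * normal_pdf 0 s t by rewrite mulr_ge0 ?powR_ge0 ?normal_pdf_ge0.
rewrite (ge0_symfun_integralT f0 cf); last first.
  by move=> t /=; rewrite normrN !normal_pdfE// /normal_fun !subr0 sqrrN.
have -> : [set t : R | 0 <= t] = \bigcup_n `[0%R, (n%:R : R)]%classic.
  apply/seteqP; split=> [t /= t0|t [n _]/=]; last by rewrite in_itv/= => /andP[].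
  exists (Num.bound t) => //=; rewrite in_itv/= t0/=; exact: ltW (archi_boundP t0).
have : (\int[lebesgue_measure]_(t in `[0%R, (n%:R : R)]) (`|t| `^ p * normal_pdf 0 s t)%:E
    @[n --> \oo] --> \int[lebesgue_measure]_(t in \bigcup_n `[0%R, (n%:R : R)]%classic) (`|t| `^ p * normal_pdf 0 s t)%:E)%E.
  apply: ge0_nondecreasing_set_cvg_integral.
  - move=> n m nm; apply/subsetPset => t /=; rewrite !in_itv/= => /andP[-> h]/=.
    by rewrite (le_trans h)// ler_nat.
  - by move=> n; exact: measurable_itv.
  - by move=> n; apply: measurable_funTS; apply/measurable_EFinP; exact: continuous_measurable_fun.
  - by move=> n t _; rewrite lee_fin.
move=> h; set I := (X in (2%:E * X)%E).
have {h} : (I <= (2^-1 * (s `^ p * K_const p `^ p))%:E)%E.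
  apply: (cvge_to_le h); apply: nearW => n; exact: integral_powR_normal_le.
move=> /(lee_wpmul2l (_ : 0 <= 2%:E)%E) h.
by apply: le_trans (h _) _ => //; rewrite -EFinM mulrA divff// mul1r.
Qed.
End GammaMoments.

(** * Elements of the dual of B inside H *)

Section GaussOneDim.
Context {R : realType}.

Lemma gauss_measure1E (h : R) (S : set (1.-tuple R)) : 0 < h ->
  gauss_measure h S = normal_prob 0 (Num.sqrt h) [set t | S (cons_tuple t [tuple])].
Proof.
move=> h0; rewrite /gauss_measure /normal_prob [in RHS]integral_mkcond/=.
apply: eq_integral => t _; rewrite patchE normal_pdfE ?gt_eqF ?sqrtr_gt0//.
rewrite /gauss_density big_ord_recl big_ord0 addr0/= /normal_peak /normal_fun subr0.
rewrite sqr_sqrtr ?ltW// indicE.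
have -> : (t \in [set t0 | S (cons_tuple t0 [tuple])]) = (cons_tuple t [tuple] \in S).
  by apply/idP/idP; rewrite !inE.
case: ifPn => _; last by rewrite mulr0.
rewrite mulr1; congr (_ * expR _)%:E.
  rewrite div1r powRN powR12_sqrt; last by rewrite !mulr_ge0 ?pi_ge0 ?ltW.
  by congr (Num.sqrt _)^-1; ring.
by rewrite (tnth_nth 0)/= -[h *+ 2]mulr_natl.
Qed.

(** The complement is an interval of length 1/c, on which the density is at most 1. *)
Lemma normal_prob_gt_abs (c : R) : 0 < c ->
  ((1 - c^-1)%:E <= normal_prob 0 1 [set t : R | (2^-1 < `|t| * c)%R])%E.
Proof.
move=> c0; have -> : [set t : R | 2^-1 < `|t| * c] = ~` `[- (2 * c)^-1, (2 * c)^-1]%classic.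
  apply/seteqP; split=> t /=; rewrite in_itv/= -ler_norml invfM.
    by move=> h; apply/negP; rewrite -ltNge ltr_pdivrMr.
  by move=> /negP; rewrite -ltNge ltr_pdivrMr.
rewrite probability_setC; last exact: measurable_itv.
rewrite EFinB leeB// /normal_prob.
apply: (@le_trans _ _ (\int[lebesgue_measure]_(t in `[(- (2 * c)^-1)%R, ((2 * c)^-1)%R]) 1)%E).
  apply: ge0_le_integral.
  - exact: measurable_itv.
  - by move=> t _; rewrite lee_fin normal_pdf_ge0.
  - by apply: measurable_funTS; apply/measurable_EFinP; exact: measurable_normal_pdf.
  - exact: measurable_cst.
  - move=> t _; rewrite lee_fin; apply: le_trans (normal_pdf_ub _ _ _) _ => //.
    have pi2 : 0 < pi *+ 2 :> R by rewrite pmulrn_lgt0// pi_gt0.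
    rewrite /normal_peak expr1n mul1r invf_le1 ?sqrtr_gt0//.
    rewrite -[leLHS]sqrtr1 ler_sqrt ?(ltW pi2)//.
    by rewrite -mulr_natr; have := pi_ge2 R; lra.
rewrite integral_cst//= mul1e lebesgue_measure_itv/= lte_fin.
case: ifPn => _; last by rewrite lee_fin invr_ge0 ltW.
rewrite -EFinB lee_fin opprK invfM -mulrDl.
by rewrite (_ : 2^-1 + 2^-1 = 1 :> R) ?mul1r//; field.
Qed.
End GaussOneDim.

(** * Boundedness of the inclusion and density of B' in H *)

Section DualDensity.
Context {R : realType} {H B : completeNormedModType R}.
Variables (ip : {dot H for idfun}) (iota : {linear H -> B}).
Hypotheses (hn : hilbert_norm ip) (hw : wiener_completion ip iota).

(* Orthogonality to finitely many vectors can be dropped one vector at a time: a bound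
   on a hyperplane extends to the whole space. *)
Lemma bound_orthogonal (s : seq H) :
  (exists M, forall x, (forall w, w \in s -> ip w x = 0) -> `|iota x| <= M * `|x|) ->
  exists M, forall x, `|iota x| <= M * `|x|.
Proof.
elim: s => [[M hM]|w s IH [M hM]]; first by exists M => x; apply: hM.
apply: IH; have [h0|/existsNP[v /not_implyP[vs /eqP wv]]] :=
    pselect (forall x, (forall u, u \in s -> ip u x = 0) -> ip w x = 0).
  exists M => x xs; apply: hM => u; rewrite inE => /predU1P[->|]; first exact: h0.
  exact: xs.
exists (`|w| / `|ip w v| * `|iota v| + `|M| * (1 + `|w| / `|ip w v| * `|v|)) => x xs.
(* Subtracting [c *: v] makes [x] orthogonal to [w] while keeping it orthogonal to [s]; the
   correction is bounded by a multiple of [|x|]. *)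
pose c := ip w x / ip w v.
have hc : `|c| <= `|w| / `|ip w v| * `|x|.
  rewrite normrM normfV mulrAC ler_wpM2r// ?invr_ge0//.
  exact: ip_CauchySchwarz.
have hx : `|iota (x - c *: v)| <= M * `|x - c *: v|.
  apply: hM => u; rewrite inE => /predU1P[->|us].
    by rewrite ipBr ipZr /c divfK// subrr.
  by rewrite ipBr ipZr xs// vs// mulr0 subrr.
have -> : iota x = c *: iota v + iota (x - c *: v).
  by rewrite linearB linearZ/= addrCA subrr addr0.
apply: le_trans (ler_normD _ _) _; rewrite normrZ [in leRHS]mulrDl lerD//.
  by rewrite mulrAC ler_wpM2r.
apply: le_trans hx _; apply: (@le_trans _ _ (`|M| * `|x - c *: v|)).
  by rewrite ler_wpM2r// ler_norm.
rewrite -mulrA ler_wpM2l// mulrDl mul1r; apply: le_trans (ler_normB _ _) _.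
by rewrite lerD// normrZ mulrAC ler_wpM2r.
Qed.

(** Gross measurability with eps = 1/2 is applied to the line through a unit vector v orthogonal to
    [E0]: the Gaussian mass of |t| |iota v| > 1/2 is less than 1/2 but at least 1 - 1/|iota v|, so
    |iota v| <= 2. Orthogonality to [E0] is then removed by [bound_orthogonal]. *)
Lemma iota_bounded : exists M, forall x, `|iota x| <= M * `|x|.
Proof.
have [_ _ /(_ 2^-1)[|E0 [[n [w ->]] hE]]] := hw; first by rewrite invr_gt0.
apply: (@bound_orthogonal [seq w i | i <- enum 'I_n]).
exists 2 => x xw; have [->|x0] := eqVneq x 0; first by rewrite linear0 !normr0 mulr0.
have nx0 : `|x| != 0 by rewrite normr_eq0.
pose v := `|x|^-1 *: x.
have v1 : Defs.orthonormal ip (fun _ : 'I_1 => v).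
  move=> i j; rewrite !ord1 eqxx ipZl ipZr -hn mulrA -invfM -expr2.
  by rewrite mulVf// expf_neq0.
have vE (i : 'I_1) z : linear_span (range w) z -> ip v z = 0.
  move=> [m [c [u [uw ->]]]]; rewrite ip_sumr big1// => k _.
  have [j _ <-] := uw k; rewrite ipZr ipZl ipC xw ?mulr0//.
  by apply/mapP; exists j => //; rewrite mem_enum.
have := hE 1%N (fun=> v) v1 vE.
have xE : x = `|x| *: v by rewrite scalerA divff// scale1r.
rewrite [in X in _ -> X]xE [X in _ -> `|X| <= _]linearZ/= normrZ normr_id -xE.
clearbody v => {v1 vE xE}; rewrite gauss_measure1E// sqrtr1.
set S := (X in normal_prob _ _ X).
have -> : S = [set t : R | 2^-1 < `|t| * `|iota v|].
  apply/seteqP; split=> t; rewrite /S/= big_ord_recl big_ord0 addr0/=.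
    by rewrite (tnth_nth 0)/= linearZ/= normrZ.
  by rewrite (tnth_nth 0)/= linearZ/= normrZ.
move=> h; rewrite mulrC ler_wpM2r//.
have [->//|v0] := eqVneq (`|iota v|) 0.
have cv : 0 < `|iota v| by rewrite lt_def v0 normr_ge0.
have := le_lt_trans (normal_prob_gt_abs cv) h; rewrite lte_fin => h2.
rewrite leNgt; apply/negP => h3.
have : `|iota v|^-1 < 2^-1 by rewrite ltf_pV2 ?posrE.
by move: h2; move: (`|iota v|^-1) => a; lra.
Qed.

Lemma dual_repr_linear c (y z : {scalar B}) a b :
  dual_repr ip iota y a -> dual_repr ip iota z b ->
  exists2 w : {scalar B}, dual_repr ip iota w (c *: a + b) &
    forall x, w x = c * y x + z x.
Proof.
move=> [cy ya] [cz zb].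
have wl : linear_for *%R (fun x => c * y x + z x).
  by move=> k x x'; rewrite !linearP/=; ring.
pose w : {scalar B} := HB.pack (fun x => c * y x + z x) (GRing.isLinear.Build R B R *%R _ wl).
exists w => //; split=> [x|x].
  by apply: (@cvgD _ R^o); [apply: (@cvgM R); [exact: cvg_cst|exact: cy]|exact: cz].
by rewrite /= ya zb ipDl ipZl.
Qed.

Lemma dual_repr0 : exists2 w : {scalar B}, dual_repr ip iota w 0 & forall x, w x = 0.
Proof.
have wl : linear_for *%R (fun _ : B => 0 : R) by move=> k x x'; rewrite mulr0 addr0.
pose w : {scalar B} := HB.pack (fun _ : B => 0 : R) (GRing.isLinear.Build R B R *%R _ wl).
exists w => //; split=> [x|x]; first exact: cvg_cst.
by rewrite ip0l.
Qed.

(** Let z be the projection of [x] on the closure of the image of B'. A norming functional of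
    [iota (x - z)], restricted to H, is represented by an element of that image, hence vanishes at x
    - z. So [iota (x - z)] is 0, and [iota] is injective. *)
Lemma dual_dense : dense [set a | exists y, dual_repr ip iota y a].
Proof.
have [inj _ _] := hw; have [M hM] := iota_bounded.
move=> O [x Ox] oO; set D := [set a | _].
have [||z cz zo] := @projection_closure _ _ _ hn D x.
- by have [w hw0 _] := dual_repr0; exists w.
- move=> c a b [y ya] [z zb]; have [w hw1 _] := dual_repr_linear c ya zb.
  by exists w.
suff xz : x = z by rewrite -xz in cz; rewrite setIC; apply: cz; exact: open_nbhs_nbhs.
apply/eqP; rewrite -subr_eq0; apply/eqP/inj; rewrite linear0.
apply/eqP; rewrite -normr_eq0; apply/eqP.
have [y [cy yle <-]] := hahn_banach_norm (iota (x - z)).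
have pl : linear_for *%R (y \o iota) by move=> c u v; rewrite /= !linearP.
pose phi : {scalar H} := HB.pack (y \o iota) (GRing.isLinear.Build R H R *%R _ pl).
have [u|a phia] := @riesz _ _ _ hn phi M; first exact: le_trans (yle _) (hM u).
rewrite -[LHS]/(phi (x - z)) phia ipC; apply: zo; by exists y; split=> // u; rewrite -phia.
Qed.
End DualDensity.

(** * Summability and Fatou arguments *)

Section Summability.
Context {R : realType}.

Lemma nneseries_fin_cvg (v : nat -> R) : (forall n, 0 <= v n) ->
  (\sum_(n <oo) (v n)%:E < +oo)%E ->
  cvgn (series v) /\ (\sum_(n <oo) (v n)%:E = (limn (series v))%:E)%E.
Proof.
move=> v0 vfin; have S0 : (0 <= \sum_(n <oo) (v n)%:E)%E.
  by apply: nneseries_ge0 => n _ _; rewrite lee_fin.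
have Sfin : (\sum_(n <oo) (v n)%:E)%E \is a fin_num by rewrite ge0_fin_numE.
have cv : cvgn (series v).
  apply: nondecreasing_is_cvgn.
    apply/nondecreasing_seqP => n; rewrite /series/= big_nat_recr//= lerDl//.
  exists (fine (\sum_(n <oo) (v n)%:E)%E) => _ [n _ <-].
  rewrite -lee_fin fineK// /series/= -sumEFin.
  by apply: nneseries_lim_ge => k _ _; rewrite lee_fin.
split=> //; apply: nneseries_EFin_cvg.
by under eq_fun do rewrite -(big_mkord xpredT).
Qed.

Lemma nneseries_lty_cvg0 (v : nat -> R) : (forall n, 0 <= v n) ->
  (\sum_(n <oo) (v n)%:E < +oo)%E -> v n @[n --> \oo] --> 0.
Proof.
by move=> v0 /(nneseries_fin_cvg v0)[cv _]; exact: cvg_series_cvg_0.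
Qed.

Lemma half_geometric_lty : (\sum_(n <oo) ((1 / (2 ^ (n + 1))%:R : R)%:E) < +oo)%E.
Proof.
have /cvg_lim -> // := @cvg_geometric_eseries_half R 1 0.
by rewrite ltry.
Qed.
End Summability.

Section MeasureLemmas.
Context d (T : measurableType d) (R : realType) (mu : probability T R).
Implicit Types (f g : T -> R).

Lemma ae_summable (u : nat -> T -> R) :
  (forall n, measurable_fun setT (u n)) -> (forall n x, 0 <= u n x) ->
  (\sum_(n <oo) \int[mu]_x (u n x)%:E < +oo)%E ->
  {ae mu, forall x, (\sum_(n <oo) (u n x)%:E < +oo)%E}.
Proof.
move=> mu_ u0; have mE n : measurable_fun setT (fun x => (u n x)%:E).
  exact/measurable_EFinP.
have s0 x : (0 <= \sum_(n <oo) (u n x)%:E)%E.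
  by apply: nneseries_ge0 => n _ _; rewrite lee_fin.
rewrite -integral_nneseries//; last by move=> n x _; rewrite lee_fin.
move=> h; have : mu.-integrable setT (fun x => \sum_(n <oo) (u n x)%:E)%E.
  apply/integrableP; split.
    by apply: ge0_emeasurable_sum => // n x _ _; rewrite lee_fin.
  by under eq_integral do rewrite gee0_abs//.
move=> /integrable_ae; move=> /(_ measurableT); apply: filterS => x /(_ I).
by rewrite ge0_fin_numE.
Qed.

(** The geometric rate makes the sum of the squares integrable, so it is finite almost everywhere
    and its terms tend to 0. *)
Lemma ae_cvg_of_summable (g : nat -> T -> R) f :
  (forall n, measurable_fun setT (g n)) -> measurable_fun setT f ->
  (forall n, \int[mu]_x ((g n x - f x) ^+ 2)%:E <= (1 / (2 ^ (n + 1))%:R)%:E)%E ->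
  {ae mu, forall x, g n x @[n --> \oo] --> f x}.
Proof.
move=> mg mf h.
have : {ae mu, forall x, (\sum_(n <oo) ((g n x - f x) ^+ 2)%:E < +oo)%E}.
  apply: ae_summable => [n|n x|]; [|exact: sqr_ge0|].
    by apply: measurable_funX; exact: measurable_funB.
  apply: le_lt_trans half_geometric_lty; apply: lee_nneseries => n _.
    by move=> _; apply: integral_ge0 => x _; rewrite lee_fin sqr_ge0.
  exact: h.
apply: filterS => x /nneseries_lty_cvg0 => /(_ (fun=> sqr_ge0 _)) c0.
apply/subr_cvg0/cvgrPdist_lt => e e0.
have e2 : 0 < e ^+ 2 by rewrite exprn_gt0.
move/cvgrPdist_lt : c0 => /(_ _ e2); apply: filterS => n.
by rewrite !sub0r !normrN ger0_norm ?sqr_ge0// -[X in X < _]real_normK ?num_real// ltr_sqr ?nnegrE// ltW.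
Qed.

(** Fatou's lemma in the form used throughout: a uniform upper bound passes to the integral of an
    almost everywhere limit. *)
Lemma integral_fatou_le (g : nat -> T -> R) f (c : R) :
  (forall n, measurable_fun setT (g n)) -> measurable_fun setT f ->
  (forall n x, 0 <= g n x) ->
  {ae mu, forall x, g n x @[n --> \oo] --> f x} ->
  (\forall n \near \oo, \int[mu]_x (g n x)%:E <= c%:E)%E ->
  (\int[mu]_x (f x)%:E <= c%:E)%E.
Proof.
move=> mg mf g0 gf gc.
have mgE n : measurable_fun setT (fun x => (g n x)%:E) by exact/measurable_EFinP.
have lim_le : (limn_einf (fun n => \int[mu]_x (g n x)%:E) <= c%:E)%E.
  rewrite limn_einf_lim; apply: lime_le; first exact: is_cvg_einfs.
  move: gc => [N _ gc]; exists N => // n /= Nn.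
  by apply: le_trans (gc n Nn); apply: ereal_inf_lbound; exists n => /=.
apply: le_trans lim_le; apply: le_trans (fatou mu measurableT mgE _); last first.
  by move=> n x _; rewrite lee_fin.
have mlim : measurable_fun setT (fun x => limn_einf ((fun n x => (g n x)%:E)^~ x)).
  under eq_fun do rewrite limn_einf_lim.
  apply: emeasurable_fun_cvg => [n|x _]; last exact: is_cvg_einfs.
  by apply: measurable_fun_einfs.
have f0 : {ae mu, forall x, (f x)%:E = limn_einf (fun n => (g n x)%:E)}.
  apply: filterS gf => x gfx.
  have h : (g n x)%:E @[n --> \oo] --> (f x)%:E.
    by apply/fine_cvgP; split; [exact: nearW|exact: gfx].
  by have [-> _] := cvg_limn_einf_sup h.
have -> : (\int[mu]_x (f x)%:E = \int[mu]_x limn_einf (fun n => (g n x)%:E))%E.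
  apply: ae_eq_integral => //; first exact/measurable_EFinP.
  by apply: filterS f0 => x ->.
by [].
Qed.
End MeasureLemmas.

Section ContinuousMeasurable.
Context {R : realType} {B : completeNormedModType R}.

Lemma continuous_borel_measurable (f : B -> R) : continuous f ->
  measurable_fun setT (f : borelType B -> R).
Proof.
move=> cf; apply: (measurability _ (RGenOpens.measurableE R)) => _ [_ [a [b ->] <-]].
rewrite setTI; apply: sub_sigma_algebra.
by apply: open_comp => [x _|]; [exact: cf|exact: interval_open].
Qed.
End ContinuousMeasurable.

(** * The random variables l_a *)

Lemma cvg_norm_powR {R : realType} (V : normedModType R) (T : Type)
  (F : set_system T) {FF : Filter F} (u : T -> V) (l : V) (p : R) : 0 < p ->
  u t @[t --> F] --> l -> `|u t| `^ p @[t --> F] --> `|l| `^ p.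
Proof.
move=> p0 ul; rewrite -[`|l|]normr_id; under eq_fun do rewrite -[`|_|]normr_id.
apply: (@continuous_cvg _ _ _ F _ (fun t => `|u t|) (fun t : R => `|t| `^ p)).
  exact: continuous_norm_powR.
exact: cvg_norm.
Qed.

Section GaussianProcess.
Context {R : realType} {H B : completeNormedModType R}.
Variables (ip : {dot H for idfun}) (iota : {linear H -> B}) (h : R).
Variables (mu : probability (borelType B) R) (ell : H -> borelType B -> R).
Hypotheses (hn : hilbert_norm ip) (hw : wiener_completion ip iota) (h0 : 0 < h).
Hypotheses (hmu : wiener_measure ip iota h mu) (hell : is_ell ip iota mu ell).

Lemma ell_measurable a : measurable_fun setT (ell a).
Proof.
have [hl _ _] := hell; have := hl a; rewrite inE => /andP[]; rewrite inE.
by [].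
Qed.

(** The case of a single functional in [wiener_measure], read as equality of the image measure with
    a normal law and transported to integrals. *)
Lemma dual_law (y : {scalar B}) a (f : R -> \bar R) : dual_repr ip iota y a ->
  ip a a = 1 -> measurable_fun setT f -> (forall t, 0 <= f t)%E ->
  (\int[mu]_x f (y x) = \int[normal_prob 0 (Num.sqrt h)]_t f t)%E.
Proof.
move=> ya a1 mf f0.
have my : measurable_fun setT (y : borelType B -> R).
  by case: ya => cy _; exact: continuous_borel_measurable.
have my' : measurable_fun setT (y : borelType B -> measurableTypeR R) by exact: my.
pose phi : {mfun borelType B >-> measurableTypeR R} :=
  HB.pack (y : borelType B -> measurableTypeR R) (isMeasurableFun.Build _ _ _ _ _ my').
rewrite -[LHS]/(\int[mu]_(x in phi @^-1` setT) ((f \o phi) x))%E.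
rewrite -(@ge0_integral_pushforward _ _ _ (measurableTypeR R) _ phi my' mu setT f)//.
apply: (@eq_measure_integral _ (measurableTypeR R) R setT (normal_prob 0 (Num.sqrt h))
  (pushforward mu phi) f) => A mA _.
pose S : set (1.-tuple R) := [set v | A (tnth v ord0)].
have mS : measurable S.
  by rewrite -[S]setTI; exact: (measurable_tnth ord0).
have o1 : Defs.orthonormal ip (fun _ : 'I_1 => a) by move=> i j; rewrite !ord1 eqxx.
have := @hmu 1%N (fun=> y) (fun=> a) (fun=> ya) o1 S mS.
rewrite gauss_measure1E//.
have -> : [set t | S (cons_tuple t [tuple])] = A.
  by apply/seteqP; split=> t; rewrite /S/= (tnth_nth 0).
move=> e; apply: etrans e; rewrite /pushforward; congr (mu _).
by apply/seteqP; split=> x; rewrite /S/= tnth_mktuple.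
Qed.

Lemma ell_moment_dual p (c : R) a y : 0 < p ->
  (\int[normal_prob 0 (Num.sqrt h)]_t (`|t| `^ p)%:E <= c%:E)%E ->
  dual_repr ip iota y a ->
  (\int[mu]_x (`|ell a x| `^ p)%:E <= (c * `|a| `^ p)%:E)%E.
Proof.
move=> p0 hc ya; have [_ hd _] := hell.
have mp : measurable_fun [set: R] (fun t : R => `|t| `^ p).
  by apply: continuous_measurable_fun; exact: continuous_norm_powR.
have mpE : measurable_fun [set: R] (fun t : R => (`|t| `^ p)%:E) by exact/measurable_EFinP.
have aeint (g : borelType B -> R) : measurable_fun setT g ->
    {ae mu, forall x, ell a x = g x} ->
    (\int[mu]_x (`|ell a x| `^ p)%:E = \int[mu]_x (`|g x| `^ p)%:E)%E.
  move=> mg eg; apply: ae_eq_integral => //.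
  - by apply/measurable_EFinP; apply: (measurableT_comp mp); exact: ell_measurable.
  - by apply/measurable_EFinP; apply: (measurableT_comp mp).
  - by apply: filterS eg => x ->.
have [a0|a0] := eqVneq a 0.
  have [w ww w0] := dual_repr0 ip iota.
  rewrite (aeint (cst 0)).
  - rewrite /= normr0 powR0 ?gt_eqF// integral0 a0 normr0 powR0 ?gt_eqF// mulr0//.
  - exact: measurable_cst.
  - by rewrite a0; apply: filterS (hd _ _ ww) => x ->; exact: w0.
have na : `|a| != 0 by rewrite normr_eq0.
have [w0 ww0 w00] := dual_repr0 ip iota.
(* Normalisation of [a] to a unit vector, for which the law is known; the added zero comes from the
   form of [dual_repr_linear]. *)
have [w ww wE] := dual_repr_linear `|a|^-1 ya ww0.
have a1 : ip (`|a|^-1 *: a + 0) (`|a|^-1 *: a + 0) = 1.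
  by rewrite addr0 ipZl ipZr -hn mulrA -invfM -expr2 mulVf// expf_neq0.
have my (v : {scalar B}) b : dual_repr ip iota v b ->
    measurable_fun setT (v : borelType B -> R).
  by case=> cv _; exact: continuous_borel_measurable.
rewrite (aeint y); [|exact: my ya|exact: hd].
have yE x : `|y x| `^ p = `|a| `^ p * `|w x| `^ p.
  by rewrite -powRM// wE w00 addr0 normrM normfV normr_id mulVKf.
under eq_integral do rewrite yE EFinM.
rewrite ge0_integralZl; last 4 first.
- exact: measurableT.
- by apply/measurable_EFinP; apply: (measurableT_comp mp); exact: my ww.
- by move=> x _; rewrite lee_fin powR_ge0.
- by rewrite lee_fin powR_ge0.
rewrite (@dual_law w _ (fun t => (`|t| `^ p)%:E) ww a1 mpE); last first.
  by move=> t; rewrite lee_fin powR_ge0.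
by rewrite mulrC EFinM lee_wpmul2l// lee_fin powR_ge0.
Qed.

Lemma ell_continuous a (eps : R) : 0 < eps -> exists2 r : R, 0 < r &
  forall b, `|a - b| < r -> (\int[mu]_x ((ell b x - ell a x) ^+ 2)%:E <= eps%:E)%E.
Proof.
move=> e0; have [_ _ hc] := hell.
have s0 : (0 < (Num.sqrt eps)%:E)%E by rewrite lte_fin sqrtr_gt0.
have /= h1 : \forall b \near a,
    ('N[mu]_2%:E[EFin \o (ell b \- ell a)%R] < (Num.sqrt eps)%:E)%E.
  apply: (hc a [set z | z < (Num.sqrt eps)%:E]%E).
  by apply: open_nbhs_nbhs; split; [exact: open_ereal_lt_ereal|].
have /nbhs_ballP[r /= r0 hr] := h1; exists r => // b bar.
have /= := hr b; rewrite -ball_normE /= => /(_ bar) /ltW N2.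
have N0 := Lnorm_ge0 mu 2%:E (EFin \o (ell b \- ell a)%R).
have -> : (\int[mu]_x ((ell b x - ell a x) ^+ 2)%:E =
    'N[mu]_2%:E[EFin \o (ell b \- ell a)%R] `^ 2)%E.
  rewrite poweR_Lnorm//; apply: eq_integral => x _ /=.
  by rewrite powR_mulrn// real_normK// num_real.
have -> : eps%:E = ((Num.sqrt eps)%:E `^ 2)%E.
  by rewrite poweR_EFin powR_mulrn ?sqrtr_ge0// sqr_sqrtr// ltW.
by apply: gt0_ler_poweR => //; rewrite in_itv/= leey andbT// lee_fin sqrtr_ge0.
Qed.

Lemma dual_approx a (r : R) : 0 < r ->
  exists2 b, exists y, dual_repr ip iota y b & `|a - b| < r.
Proof.
move=> r0; have [|b [/= ba bD]] := dual_dense hn hw _ (ball_open a r).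
  by exists a; exact: ballxx.
by exists b => //; move: ba; rewrite -ball_normE.
Qed.

Lemma ell_approx a (eps : R) : 0 < eps -> exists b, [/\ exists y, dual_repr ip iota y b,
  `|a - b| < eps & (\int[mu]_x ((ell b x - ell a x) ^+ 2)%:E <= eps%:E)%E].
Proof.
move=> e0; have [r r0 hr] := ell_continuous a e0.
have m0 : 0 < Num.min r eps by rewrite lt_min r0 e0.
have [b bD] := dual_approx a m0; rewrite lt_min => /andP[bar bae].
by exists b; split=> //; exact: hr.
Qed.

(** Elements of B' approach [a] so fast that their l converge almost everywhere to [ell a]; the
    moment bound for them then passes to the limit by Fatou. *)
Lemma ell_moment p (c : R) a : 0 < p -> 0 <= c ->
  (\int[normal_prob 0 (Num.sqrt h)]_t (`|t| `^ p)%:E <= c%:E)%E ->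
  (\int[mu]_x (`|ell a x| `^ p)%:E <= (c * `|a| `^ p)%:E)%E.
Proof.
move=> p0 c0 hc.
have mp : measurable_fun [set: R] (fun t : R => `|t| `^ p).
  by apply: continuous_measurable_fun; exact: continuous_norm_powR.
have e0 n : 0 < 1 / (2 ^ (n + 1))%:R :> R by rewrite divr_gt0// ltr0n expn_gt0.
have /choice[b bP] n := ell_approx a (e0 n).
have ae1 : {ae mu, forall x, ell (b n) x @[n --> \oo] --> ell a x}.
  apply: ae_cvg_of_summable => [n||n]; [exact: ell_measurable..|by case: (bP n)].
have b_a : b n @[n --> \oo] --> a.
  apply/cvgrPdist_lt => e e1.
  have : (fun n => 1 / (2 ^ (n + 1))%:R : R) @ \oo --> 0.
    apply: nneseries_lty_cvg0; last exact: half_geometric_lty.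
    by move=> n; exact: ltW.
  move=> /cvgrPdist_lt/(_ e e1); apply: filterS => n.
  rewrite sub0r normrN gtr0_norm//; apply: lt_trans; by case: (bP n).
have nb : `|b n| `^ p @[n --> \oo] --> `|a| `^ p.
  exact: cvg_norm_powR.
apply/lee_addgt0Pr => e e1; rewrite -EFinD.
apply: (@integral_fatou_le _ _ _ mu (fun n x => `|ell (b n) x| `^ p)).
- by move=> n; apply: (measurableT_comp mp); exact: ell_measurable.
- by apply: (measurableT_comp mp); exact: ell_measurable.
- by move=> n x; exact: powR_ge0.
- apply: filterS ae1 => x xc.
  exact: cvg_norm_powR.
have : c * `|b n| `^ p @[n --> \oo] --> c * `|a| `^ p by apply: cvgM => //; exact: cvg_cst.
move=> /cvgrPdist_lt/(_ e e1); apply: filterS => n; rewrite ltr_norml => /andP[hb _].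
have [[y yb] _ _] := bP n; apply: le_trans (ell_moment_dual p0 hc yb) _.
by rewrite lee_fin; move: hb; move: (c * _) (c * _) => u v; lra.
Qed.

Lemma ae_eq_of_integral_sqr0 (g : borelType B -> R) : measurable_fun setT g ->
  (forall eps : R, 0 < eps -> (\int[mu]_x ((g x) ^+ 2)%:E <= eps%:E)%E) ->
  {ae mu, forall x, g x = 0}.
Proof.
move=> mg hg.
have mg2 : measurable_fun setT (fun x => ((g x) ^+ 2)%:E).
  by apply/measurable_EFinP; exact: measurable_funX.
have i0 : (\int[mu]_x `|((g x) ^+ 2)%:E| = 0)%E.
  under eq_integral do rewrite gee0_abs ?lee_fin ?sqr_ge0//.
  apply/le_anti/andP; split.
    by apply/lee_addgt0Pr => e e0; rewrite add0e; exact: hg.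
  by apply: integral_ge0 => x _; rewrite lee_fin sqr_ge0.
have [/(_ i0) + _] := @ae_eq_integral_abs _ _ _ mu setT measurableT _ mg2.
apply: filterS => x /(_ I)/= [] /eqP.
by rewrite sqrf_eq0 => /eqP.
Qed.

(** On B' the variables are evaluations, for which linearity is exact. Approximating [a] and [b]
    there writes the defect [g] as a combination of three errors that are small in L^2. *)
Lemma ell_linear c a b :
  {ae mu, forall x, ell (c *: a + b) x = c * ell a x + ell b x}.
Proof.
have [_ hd _] := hell.
pose g x := ell (c *: a + b) x - (c * ell a x + ell b x).
have m1 k v : measurable_fun setT (fun x => k * ell v x).
  by apply: measurable_funM; [exact: measurable_cst|exact: ell_measurable].
have mg : measurable_fun setT g.
  apply: measurable_funB; first exact: ell_measurable.
  by apply: measurable_funD => //; exact: ell_measurable.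
suff : {ae mu, forall x, g x = 0} by apply: filterS => x /subr0_eq.
apply: ae_eq_of_integral_sqr0 => // eps e0.
(* The inequality (c u + v - t)^2 <= 3 c^2 u^2 + 3 v^2 + 3 t^2, with each of the three mean squares
   at most eps/k, gives exactly [eps]. *)
pose k := 3 * (2 + c ^+ 2); have k0 : 0 < k by rewrite mulr_gt0// ltr_wpDr ?sqr_ge0.
have ek : 0 < eps / k by rewrite divr_gt0.
have [r r0 hr] := ell_continuous (c *: a + b) ek.
have [ra ra0 hra] := ell_continuous a ek.
have [rb rb0 hrb] := ell_continuous b ek.
have c1 : 0 < `|c| + 1 by rewrite ltr_wpDl.
(* The second radius ensures that [c *: a' + b'] lies within [r] of [c *: a + b], half of [r] being
   reserved for [b']. *)
have [|a' [y ya]] := @dual_approx a (Num.min ra (r / 2 / (`|c| + 1))).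
  by rewrite lt_min ra0/= !divr_gt0.
rewrite lt_min => /andP[/hra ha ha2].
have [|b' [z zb]] := @dual_approx b (Num.min rb (r / 2)).
  by rewrite lt_min rb0/= divr_gt0.
rewrite lt_min => /andP[/hrb hb hb2].
have {}hr : (\int[mu]_x ((ell (c *: a' + b') x - ell (c *: a + b) x) ^+ 2)%:E <= (eps / k)%:E)%E.
  apply: hr; rewrite opprD addrACA -scalerBr; apply: le_lt_trans (ler_normD _ _) _.
  rewrite [X in _ < X](splitr r) normrZ; apply: ler_ltD => //.
  move: ha2; rewrite ltr_pdivlMr// => /ltW; apply: le_trans.
  by rewrite mulrC ler_wpM2l// lerDl.
have [w ww wE] := dual_repr_linear c ya zb.
have g_ae : {ae mu, forall x, g x = (c * (ell a' x - ell a x) + (ell b' x - ell b x)) -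
    (ell (c *: a' + b') x - ell (c *: a + b) x)}.
  apply: filterS3 (hd _ _ ww) (hd _ _ ya) (hd _ _ zb) => x h1 h2 h3.
  by rewrite /g h1 h2 h3 wE; ring.
have msq v v' : measurable_fun setT (fun x => ((ell v x - ell v' x) ^+ 2)%:E).
  apply/measurable_EFinP; apply: measurable_funX.
  by apply: measurable_funB; exact: ell_measurable.
apply: (@le_trans _ _ (\int[mu]_x ((3 * c ^+ 2)%:E * ((ell a' x - ell a x) ^+ 2)%:E +
   (3%:E * ((ell b' x - ell b x) ^+ 2)%:E +
    3%:E * ((ell (c *: a' + b') x - ell (c *: a + b) x) ^+ 2)%:E)))%E).
  apply: ae_ge0_le_integral.
  - exact: measurableT.
  - by move=> x _; rewrite lee_fin sqr_ge0.
  - by apply/measurable_EFinP; exact: measurable_funX.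
  - by move=> x _; rewrite -!EFinM -!EFinD lee_fin !addr_ge0// mulr_ge0 ?sqr_ge0// mulr_ge0 ?sqr_ge0.
  - apply: emeasurable_funD; first by apply: emeasurable_funM => //; exact: msq.
    by apply: emeasurable_funD; apply: emeasurable_funM => //; exact: msq.
  - apply: filterS g_ae => x gx _; rewrite -!EFinM -!EFinD lee_fin gx.
    move: (ell a' x - _) (ell b' x - _) (ell (_ + _) x - _) => u v t; rewrite -subr_ge0.
    rewrite (_ : _ - _ = (c * u - v) ^+ 2 + (c * u + t) ^+ 2 + (v + t) ^+ 2); last by ring.
    by rewrite !addr_ge0 ?sqr_ge0.
have p v v' x : (0 <= ((ell v x - ell v' x) ^+ 2)%:E)%E by rewrite lee_fin sqr_ge0.
have pM (t : R) v v' x : 0 <= t -> (0 <= t%:E * ((ell v x - ell v' x) ^+ 2)%:E)%E.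
  by move=> t0; rewrite mule_ge0.
have mM (t : R) v v' : measurable_fun setT (fun x => t%:E * ((ell v x - ell v' x) ^+ 2)%:E)%E.
  by apply: emeasurable_funM => //; exact: msq.
have c3 : 0 <= 3 * c ^+ 2 by rewrite mulr_ge0 ?sqr_ge0.
rewrite ge0_integralD; last 5 first.
- exact: measurableT.
- by move=> x _; exact: pM.
- exact: mM.
- by move=> x _; apply: adde_ge0; exact: pM.
- by apply: emeasurable_funD; exact: mM.
rewrite ge0_integralD; last 5 first.
- exact: measurableT.
- by move=> x _; exact: pM.
- exact: mM.
- by move=> x _; exact: pM.
- exact: mM.
rewrite !ge0_integralZl//.
apply: (@le_trans _ _ ((3 * c ^+ 2)%:E * (eps / k)%:E + (3%:E * (eps / k)%:E + 3%:E * (eps / k)%:E))%E).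
  by apply: leeD; [exact: lee_wpmul2l|apply: leeD; exact: lee_wpmul2l].
rewrite -!EFinM -!EFinD lee_fin le_eqVlt; apply/orP; left; apply/eqP.
by rewrite /k; field; rewrite gt_eqF// ltr_wpDr ?sqr_ge0.
Qed.

Lemma ell_zero : {ae mu, forall x, ell 0 x = 0}.
Proof.
apply: filterS (ell_linear (-1) 0 0) => x.
by rewrite scaler0 addr0 mulN1r addNr.
Qed.

Lemma ell_sum n (c : 'I_n -> R) (a : 'I_n -> H) :
  {ae mu, forall x, \sum_(i < n) c i * ell (a i) x = ell (\sum_(i < n) c i *: a i) x}.
Proof.
elim: n c a => [|n IH] c a.
  by apply: filterS ell_zero => x; rewrite !big_ord0.
apply: filterS2 (IH (fun i => c (widen_ord (leqnSn n) i)) (fun i => a (widen_ord (leqnSn n) i)))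
  (ell_linear (c ord_max) (a ord_max) (\sum_(i < n) c (widen_ord (leqnSn n) i) *: a (widen_ord (leqnSn n) i))).
by move=> x h1 h2; rewrite !big_ord_recr/= h1 addrC -h2 addrC.
Qed.
End GaussianProcess.

(** * L^p norms on a probability space *)

Section VectorMeasurability.
Context d (T : measurableType d) (R : realType) (H : normedModType R).

(** Testing against continuous functions keeps all measurability statements real valued, and still
    suffices because symbols are continuous. *)
Definition continuously_measurable (G : T -> H) :=
  forall f : H -> R, continuous f -> measurable_fun setT (f \o G).

(** Rounding [g] down to multiples of 1/(k+1) leaves countably many values; on each of them the map
    is a continuous function, composed with a fixed translation, of [G]. Continuity of [f] gives the
    limit in k. *)
Lemma continuously_measurable_addZ (G : T -> H) (g : T -> R) v :
  continuously_measurable G -> measurable_fun setT g ->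
  continuously_measurable (fun x => G x + g x *: v).
Proof.
move=> hG mg f cf.
pose q (k : nat) x : R := (Num.floor (k.+1%:R * g x))%:~R / k.+1%:R.
have qP k x : `|g x - q k x| <= k.+1%:R^-1.
  have k0 : 0 < k.+1%:R :> R by rewrite ltr0n.
  have /andP[h1 h2] := floor_itv (k.+1%:R * g x).
  rewrite -(ler_pM2l k0) divff ?gt_eqF// -{1}(gtr0_norm k0) -normrM mulrBr /q.
  rewrite mulrCA divff ?gt_eqF// mulr1 ger0_norm ?subr_ge0//.
  by rewrite lerBlDr addrC ltW// -[X in _ + X]/(1%:~R) -intrD.
apply: (@measurable_fun_cvg _ _ _ _ (fun k x => f (G x + q k x *: v))); last first.
  move=> x _; apply: continuous_cvg; first exact: cf.
  apply: cvgD; first exact: cvg_cst.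
  apply: cvgZr_tmp => //; apply/cvgrPdist_le => e e0.
  have : (k.+1%:R^-1 : R) @[k --> \oo] --> 0 by exact: cvg_harmonic.
  move=> /cvgrPdist_le/(_ e e0); apply: filterS => k.
  by rewrite sub0r normrN ger0_norm//; apply: le_trans; exact: qP.
move=> k _ Y mY; rewrite setTI.
have -> : (fun x => f (G x + q k x *: v)) @^-1` Y =
   \bigcup_(z : int) ([set x | Num.floor (k.+1%:R * g x) = z] `&`
     ((fun u => f (u + (z%:~R / k.+1%:R) *: v)) \o G) @^-1` Y).
  apply/seteqP; split=> [x Yx|x [z _ [/= <-]]//].
  by exists (Num.floor (k.+1%:R * g x)).
apply: countable_bigcupT_measurable => [|z]; first exact: countableP.
apply: measurableI; last first.
  rewrite -[X in measurable X]setTI; apply: hG => // u.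
  apply: continuous_comp; last exact: cf.
  by apply: cvgD; [exact: cvg_id|exact: cvg_cst].
have -> : [set x | Num.floor (k.+1%:R * g x) = z] =
    (fun x => k.+1%:R * g x) @^-1` `[z%:~R, (z + 1)%:~R[%classic.
  apply/seteqP; split=> x /=; rewrite in_itv/=; first by move=> <-; exact: floor_itv.
  exact: floor_def.
rewrite -[X in measurable X]setTI.
have mkg : measurable_fun setT (fun x => k.+1%:R * g x).
  by apply: measurable_funM; [exact: measurable_cst|].
by apply: mkg => //; exact: measurable_itv.
Qed.

Lemma continuously_measurable_sum n (g : 'I_n -> T -> R) (w : 'I_n -> H) :
  (forall i, measurable_fun setT (g i)) ->
  continuously_measurable (fun x => \sum_(i < n) g i x *: w i).
Proof.
elim: n g w => [|n IH] g w mg f cf.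
  rewrite (_ : f \o _ = cst (f 0)); first exact: measurable_cst.
  by apply/funext => x /=; rewrite big_ord0.
under [X in f \o X]eq_fun do rewrite big_ord_recr/=.
by apply: continuously_measurable_addZ => //; apply: IH => i; exact: mg.
Qed.
End VectorMeasurability.

Section LpBounds.
Context d (T : measurableType d) (R : realType) (mu : probability T R).
Implicit Types (g : T -> R) (p : R).

Lemma measurable_norm_powR g p : 0 < p -> measurable_fun setT g ->
  measurable_fun setT (fun x => (`|g x| `^ p)%:E).
Proof.
move=> p0 mg; apply/measurable_EFinP.
apply: (measurableT_comp (f := fun t : R => `|t| `^ p)) mg.
by apply: continuous_measurable_fun; exact: continuous_norm_powR.
Qed.

Lemma LnormE g p :
  ('N[mu]_p%:E[EFin \o g] = (\int[mu]_x (`|g x| `^ p)%:E) `^ p^-1)%E.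
Proof. by rewrite unlock. Qed.

Lemma Lnorm_le g p (K : R) : 0 < p -> 0 <= K ->
  (\int[mu]_x (`|g x| `^ p)%:E <= (K `^ p)%:E)%E -> ('N[mu]_p%:E[EFin \o g] <= K%:E)%E.
Proof.
move=> p0 K0 h; rewrite LnormE.
have -> : K%:E = ((K `^ p)%:E `^ p^-1)%E.
  by rewrite poweR_EFin -powRrM mulfV ?gt_eqF// powRr1.
apply: gt0_ler_poweR => //; first by rewrite invr_ge0 ltW.
- rewrite in_itv/= leey andbT; apply: integral_ge0 => x _.
  by rewrite lee_fin powR_ge0.
- by rewrite in_itv/= leey andbT lee_fin powR_ge0.
Qed.

(* Integrating the tangent inequality s^t <= t s + 1 - t at s = g^2 / K^2. *)
Lemma integral_powR_le_sqr g p (K : R) : 0 < p -> p <= 2 -> 0 < K -> measurable_fun setT g ->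
  (\int[mu]_x ((g x) ^+ 2)%:E <= (K ^+ 2)%:E)%E ->
  (\int[mu]_x (`|g x| `^ p)%:E <= (K `^ p)%:E)%E.
Proof.
move=> p0 p2 K0 mg h.
pose t := p / 2; have t0 : 0 < t by rewrite divr_gt0.
have t1 : t <= 1 by rewrite ler_pdivrMr// mul1r.
have pt : p = 2%:R * t by rewrite /t mulrC divfK.
clearbody t; have tangent (s : R) : 0 <= s -> s `^ t <= t * s + (1 - t).
  move=> s0; have [->|tn1] := eqVneq t 1; first by rewrite powRr1// subrr addr0 mul1r.
  have tl1 : t < 1 by rewrite lt_neqAle tn1 t1.
  (* Young's inequality for the product of s^t and 1, with conjugate exponents 1/t and 1/(1-t). *)
  have := @conjugate_powR R (s `^ t) 1 t^-1 (1 - t)^-1.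
  rewrite mulr1 powR_ge0 ler01 !invr_gt0 t0 subr_gt0 tl1 !invrK addrC subrK powR1.
  rewrite -powRrM mulfV ?gt_eqF// powRr1// mul1r => /(_ isT isT isT isT erefl).
  by rewrite [s * t]mulrC.
have mg2 : measurable_fun setT (fun x => ((g x) ^+ 2)%:E).
  by apply/measurable_EFinP; exact: measurable_funX.
apply: (@le_trans _ _ (\int[mu]_x ((K `^ p * t / K ^+ 2)%:E * ((g x) ^+ 2)%:E +
    (K `^ p * (1 - t))%:E))%E).
  apply: ge0_le_integral.
  - exact: measurableT.
  - by move=> x _; rewrite lee_fin powR_ge0.
  - exact: measurable_norm_powR.
  - apply: emeasurable_funD; last exact: measurable_cst.
    by apply: emeasurable_funM => //; exact: measurable_cst.
  move=> x _; rewrite -EFinM -EFinD lee_fin.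
  have -> : `|g x| `^ p = K `^ p * ((g x ^+ 2 / K ^+ 2) `^ t).
    rewrite pt !powRrM !powR_mulrn ?(ltW K0)// real_normK ?num_real// -powRM ?sqr_ge0//; last first.
      by apply: divr_ge0; exact: sqr_ge0.
    by rewrite mulrC divfK// expf_neq0// gt_eqF.
  have := tangent (g x ^+ 2 / K ^+ 2) (divr_ge0 (sqr_ge0 _) (sqr_ge0 _)).
  move=> /(ler_wpM2l (powR_ge0 K p)) /le_trans; apply.
  by rewrite le_eqVlt; apply/orP; left; apply/eqP; ring.
have c0 : 0 <= K `^ p * t / K ^+ 2 by rewrite divr_ge0 ?sqr_ge0// mulr_ge0 ?powR_ge0 ?ltW.
have c1 : 0 <= K `^ p * (1 - t) by rewrite mulr_ge0 ?powR_ge0// subr_ge0.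
rewrite ge0_integralD; last 5 first.
- exact: measurableT.
- by move=> x _; rewrite -EFinM lee_fin mulr_ge0 ?sqr_ge0.
- by apply: emeasurable_funM => //; exact: measurable_cst.
- by move=> x _; rewrite lee_fin.
- exact: measurable_cst.
rewrite integral_cst//= probability_setT mule1 ge0_integralZl//; last first.
  by move=> x _; rewrite lee_fin sqr_ge0.
apply: (@le_trans _ _ ((K `^ p * t / K ^+ 2)%:E * (K ^+ 2)%:E + (K `^ p * (1 - t))%:E)%E).
  by apply: leeD => //; exact: lee_wpmul2l.
rewrite -EFinM -EFinD lee_fin divfK ?expf_neq0 ?gt_eqF// -mulrDr addrC subrK mulr1//.
Qed.

(** The tangent inequality divides by the bound, which may be 0 here; it is therefore applied to
    [K + e]. *)
Lemma Lnorm_le_sqr g p (K : R) : 0 < p -> p <= 2 -> 0 <= K -> measurable_fun setT g ->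
  (\int[mu]_x ((g x) ^+ 2)%:E <= (K ^+ 2)%:E)%E ->
  ('N[mu]_p%:E[EFin \o g] <= K%:E)%E.
Proof.
move=> p0 p2 K0 mg h; apply/lee_addgt0Pr => e e0; rewrite -EFinD.
have Ke : 0 < K + e by rewrite ltr_wpDl.
apply: Lnorm_le => //; first exact: ltW.
apply: integral_powR_le_sqr => //; apply: le_trans h _.
by rewrite lee_fin ler_sqr ?nnegrE ?(ltW Ke)// lerDl ltW.
Qed.

(* For bounded functions all L^p convergences follow from convergence in L^2:
   |g|^p <= M^(p-1) |g| and |g| <= (a + g^2 / a) / 2. *)
Lemma integral_powR_bounded_le g p (M a V : R) : 1 <= p -> 0 < a -> 0 <= M ->
  measurable_fun setT g -> (forall x, `|g x| <= M) ->
  (\int[mu]_x ((g x) ^+ 2)%:E <= V%:E)%E ->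
  (\int[mu]_x (`|g x| `^ p)%:E <= (M `^ (p - 1) * (a + V / a))%:E)%E.
Proof.
move=> p1 a0 M0 mg gM h.
have p0 : 0 < p by exact: lt_le_trans p1.
have mg2 : measurable_fun setT (fun x => ((g x) ^+ 2)%:E).
  by apply/measurable_EFinP; exact: measurable_funX.
have c0 : 0 <= M `^ (p - 1) / a by rewrite divr_ge0 ?powR_ge0// ltW.
apply: (@le_trans _ _ (\int[mu]_x ((M `^ (p - 1) / a)%:E * ((g x) ^+ 2)%:E +
    (M `^ (p - 1) * a)%:E))%E).
  apply: ge0_le_integral.
  - exact: measurableT.
  - by move=> x _; rewrite lee_fin powR_ge0.
  - exact: measurable_norm_powR.
  - apply: emeasurable_funD; last exact: measurable_cst.
    by apply: emeasurable_funM => //; exact: measurable_cst.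
  move=> x _; rewrite -EFinM -EFinD lee_fin -mulr_powRB1//.
  apply: (@le_trans _ _ (M `^ (p - 1) * `|g x|)).
    rewrite mulrC ler_wpM2r// ge0_ler_powR ?nnegrE ?subr_ge0//.
  rewrite -mulrA -mulrDr ler_wpM2l ?powR_ge0// -(real_normK (num_real (g x))).
  rewrite -(ler_pM2l a0) mulrDr mulrA divff ?gt_eqF// mul1r.
  rewrite -subr_ge0; move: `|g x| => u.
  rewrite (_ : _ - _ = 2^-1 * (u - a) ^+ 2 + 2^-1 * u ^+ 2 + 2^-1 * a ^+ 2); last by field.
  by rewrite !addr_ge0// mulr_ge0 ?sqr_ge0.
rewrite ge0_integralD; last 5 first.
- exact: measurableT.
- by move=> x _; rewrite -EFinM lee_fin mulr_ge0 ?sqr_ge0.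
- by apply: emeasurable_funM => //; exact: measurable_cst.
- by move=> x _; rewrite lee_fin mulr_ge0 ?powR_ge0 ?ltW.
- exact: measurable_cst.
rewrite integral_cst//= probability_setT mule1 ge0_integralZl//; last first.
  by move=> x _; rewrite lee_fin sqr_ge0.
apply: (@le_trans _ _ ((M `^ (p - 1) / a)%:E * V%:E + (M `^ (p - 1) * a)%:E)%E).
  by apply: leeD => //; exact: lee_wpmul2l.
by rewrite -EFinM -EFinD lee_fin le_eqVlt; apply/orP; left; apply/eqP; ring.
Qed.

Lemma Lnorm_cvg0_of_sqr (g : nat -> T -> R) p (M : R) (V : nat -> R) : 1 <= p -> 0 <= M ->
  (forall n, measurable_fun setT (g n)) -> (forall n x, `|g n x| <= M) ->
  (forall n, \int[mu]_x ((g n x) ^+ 2)%:E <= (V n)%:E)%E -> V n @[n --> \oo] --> 0 ->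
  ('N[mu]_p%:E[EFin \o g n] @[n --> \oo] --> 0)%E.
Proof.
move=> p1 M0 mg gM gV V0; have p0 : 0 < p by exact: lt_le_trans p1.
have key e : 0 < e -> (\forall n \near \oo, 'N[mu]_p%:E[EFin \o g n] <= e%:E)%E.
  move=> e0; pose C := M `^ (p - 1) + 1; have C0 : 0 < C by rewrite ltr_wpDl ?powR_ge0.
  have ep : 0 < e `^ p by exact: powR_gt0.
  (* As soon as V n <= a^2, the bound M^(p-1) (a + V n / a) is at most 2 C a, that is e^p. *)
  pose a := e `^ p / (2 * C); have a0 : 0 < a by rewrite divr_gt0// mulr_gt0.
  have : 0 < a ^+ 2 by rewrite exprn_gt0.
  move=> a2; move/cvgrPdist_le : V0 => /(_ _ a2); apply: filterS => n.
  rewrite sub0r normrN => Vn; apply: Lnorm_le => //; first exact: ltW.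
  apply: le_trans (integral_powR_bounded_le p1 a0 M0 (mg n) (gM n) (gV n)) _.
  rewrite lee_fin; apply: (@le_trans _ _ (C * (a + a))).
    apply: (@le_trans _ _ (M `^ (p - 1) * (a + a))).
      rewrite ler_wpM2l ?powR_ge0// lerD2l ler_pdivrMr// -expr2.
      exact: le_trans (ler_norm _) Vn.
    by rewrite ler_wpM2r ?addr_ge0 ?(ltW a0)// lerDl.
  by rewrite le_eqVlt; apply/orP; left; apply/eqP; rewrite /a; field; rewrite gt_eqF.
apply/fine_cvgP; split.
  apply: filterS (key 1 ltr01) => n h.
  by rewrite ge0_fin_numE ?Lnorm_ge0// (le_lt_trans h)// ltry.
apply/cvgrPdist_le => e e0; apply: filterS (key e e0) => n h /=.
have fn : 'N[mu]_p%:E[EFin \o g n]%E \is a fin_num.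
  by rewrite ge0_fin_numE ?Lnorm_ge0// (le_lt_trans h)// ltry.
rewrite sub0r normrN ger0_norm ?fine_ge0 ?Lnorm_ge0//.
by rewrite -lee_fin fineK.
Qed.

Lemma bounded_Lfun g p (M : R) : 1 <= p -> 0 <= M -> measurable_fun setT g ->
  (forall x, `|g x| <= M) -> g \in Lfun mu p%:E.
Proof.
move=> p1 M0 mg gM; have p0 : 0 < p by exact: lt_le_trans p1.
rewrite inE; apply/andP; split; rewrite inE//=; rewrite /finite_norm.
apply: le_lt_trans (ltry M); apply: Lnorm_le => //.
apply: (@le_trans _ _ (\int[mu]_x (M `^ p)%:E)%E); last first.
  by rewrite integral_cst//= probability_setT mule1.
apply: ge0_le_integral => //.
- exact: measurable_norm_powR.
- by move=> x _; rewrite lee_fin ge0_ler_powR ?nnegrE// ltW.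
Qed.
End LpBounds.

(** * Estimates between two projections *)

(* Weighted power mean inequality; it follows by summing Young's inequality
   t m^(r-1) <= t^r / r + (1 - 1/r) m^r at the mean m = (sum of a t) / L. *)
Lemma weighted_power_mean {R : realType} (a t : nat -> R) (L r : R) n : 1 < r ->
  (forall k, 0 <= a k) -> (forall k, 0 <= t k) -> \sum_(k < n) a k <= L ->
  (\sum_(k < n) a k * t k) `^ r <= L `^ (r - 1) * \sum_(k < n) a k * t k `^ r.
Proof.
move=> r1 a0 t0 aL; have r0 : 0 < r by exact: lt_trans r1.
set S := \sum_(k < n) a k * t k; set P := \sum_(k < n) _ * _ `^ _.
have S0 : 0 <= S by apply: sumr_ge0 => k _; exact: mulr_ge0.
have P0 : 0 <= P by apply: sumr_ge0 => k _; rewrite mulr_ge0 ?powR_ge0.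
have [->|Sn0] := eqVneq S 0.
  by rewrite powR0 ?gt_eqF// mulr_ge0 ?powR_ge0.
have L0 : 0 < L.
  rewrite lt_neqAle (le_trans _ aL) ?sumr_ge0// andbT; apply: contra_neq Sn0 => L0.
  rewrite /S big1// => k _; have : \sum_(k < n) a k = 0.
    by apply/le_anti; rewrite {2}L0 aL sumr_ge0.
  by move=> /psumr_eq0P -> //; rewrite mul0r.
pose m := S / L; have m0 : 0 < m by rewrite divr_gt0// lt_def Sn0.
have r10 : 0 < r - 1 by rewrite subr_gt0.
pose q := r / (r - 1); have q0 : 0 < q by rewrite divr_gt0.
have young k : t k * m `^ (r - 1) <= t k `^ r / r + m `^ r * (1 - r^-1).
  have := @conjugate_powR R (t k) (m `^ (r - 1)) r q (t0 k) (powR_ge0 _ _) r0 q0.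
  have qi : q^-1 = 1 - r^-1 by rewrite invf_div mulrBl divff ?gt_eqF// mul1r.
  have qr : (r - 1) * q = r by rewrite mulrC divfK// gt_eqF.
  by rewrite -powRrM qr qi addrC subrK => /(_ erefl).
have : S * m `^ (r - 1) <= P / r + L * (m `^ r * (1 - r^-1)).
  apply: (@le_trans _ _ (\sum_(k < n) (a k * t k `^ r / r + a k * (m `^ r * (1 - r^-1))))).
    rewrite mulr_suml; apply: ler_sum => k _.
    by rewrite -!mulrA -mulrDr ler_wpM2l.
  rewrite big_split/= -!mulr_suml lerD2l ler_wpM2r//.
  by rewrite mulr_ge0 ?powR_ge0// subr_ge0 invf_le1// ltW.
have -> : S * m `^ (r - 1) = L * m `^ r.
  rewrite -(mulr_powRB1 (ltW m0) r0) mulrA; congr (_ * _).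
  by rewrite /m mulrC divfK ?gt_eqF.
(* Multiplied by r, the summed inequality reads r L m^r <= P + (r - 1) L m^r. *)
rewrite -(ler_pM2l r0) mulrDr (mulrCA r P) divff ?gt_eqF// mulr1 => hP.
have {}hP : L * m `^ r <= P.
  have -> : L * m `^ r = r * (L * m `^ r) - r * (L * (m `^ r * (1 - r^-1))).
    by field; rewrite gt_eqF.
  by rewrite lerBlDr.
have -> : S `^ r = L `^ (r - 1) * (L * m `^ r).
  rewrite mulrA [_ * L]mulrC mulr_powRB1 ?(ltW L0)// -powRM ?(ltW L0) ?(ltW m0)//.
  by rewrite /m mulrC divfK// gt_eqF.
by rewrite ler_wpM2l ?powR_ge0.
Qed.

Section Estimates.
Context {R : realType} {H B : completeNormedModType R}.
Variables (ip : {dot H for idfun}) (iota : {linear H -> B}) (h : R).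
Variables (mu : probability (borelType B) R) (ell : H -> borelType B -> R).
Hypotheses (hn : hilbert_norm ip) (hw : wiener_completion ip iota) (h0 : 0 < h).
Hypotheses (hmu : wiener_measure ip iota h mu) (hell : is_ell ip iota mu ell).

Lemma ip_tilde_pi n (w : 'I_n -> H) x y :
  ip (tilde_pi ell w x) y = \sum_(i < n) ip y (w i) * ell (w i) x.
Proof.
rewrite /tilde_pi ip_suml; apply: eq_bigr => i _.
by rewrite ipZl (ipC ip y) mulrC.
Qed.

(** The coefficients of [tilde_pi] paired with [y] are those of [pr ip w y], so linearity of l moves
    the projection from the random point to [y]. The exceptional null set may depend on [y]. *)
Lemma ip_tilde_pi_ae n (w : 'I_n -> H) m (w' : 'I_m -> H) y :
  {ae mu, forall x, ip (tilde_pi ell w x - tilde_pi ell w' x) y =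
    ell (pr ip w y - pr ip w' y) x}.
Proof.
apply: filterS3 (ell_sum hn hw hell (fun i => ip y (w i)) w)
  (ell_sum hn hw hell (fun i => ip y (w' i)) w')
  (ell_linear hn hw hell (-1) (pr ip w' y) (pr ip w y)) => x e1 e2 e3.
rewrite ipBl !ip_tilde_pi e1 e2 -/(pr ip w y) -/(pr ip w' y).
have -> : pr ip w y - pr ip w' y = -1 *: pr ip w' y + pr ip w y.
  by rewrite scaleN1r addrC.
by rewrite e3 mulN1r addrC.
Qed.

Lemma measurable_ip_tilde_pi n (w : 'I_n -> H) m (w' : 'I_m -> H) y :
  measurable_fun setT (fun x => ip (tilde_pi ell w x - tilde_pi ell w' x) y).
Proof.
under eq_fun do rewrite ipBl !ip_tilde_pi.
by apply: measurable_funB; apply: measurable_sum => i; apply: measurable_funM => //;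
  exact: (ell_measurable hell).
Qed.

Lemma measurable_comp_tilde_pi n (w : 'I_n -> H) (f : H -> R) : continuous f ->
  measurable_fun setT (f \o tilde_pi ell w).
Proof.
by move=> cf; apply: continuously_measurable_sum => // i; exact: (ell_measurable hell).
Qed.

Lemma normal_moment2_sqrt :
  (\int[normal_prob 0 (Num.sqrt h)]_t (`|t| `^ 2)%:E <= h%:E)%E.
Proof.
have := @normal_moment2_le R (Num.sqrt h); rewrite sqr_sqrtr ?(ltW h0)// => /(_ _).
rewrite sqrtr_gt0 => /(_ h0); congr (_ <= _)%E; apply: eq_integral => t _.
by rewrite powR_mulrn// real_normK// num_real.
Qed.

(** Sum and integral are exchanged, and each term is an absolute moment of a single l. The weights
    are free so that one statement serves the Cholesky vectors with weights 1 and the eigenvectors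
    weighted by the eigenvalues. *)
Lemma weighted_moment (lam : nat -> R) (y : nat -> H) (p c : R)
    n (w : 'I_n -> H) m (w' : 'I_m -> H) :
  (forall k, 0 <= lam k) -> 0 < p -> 0 <= c ->
  (\int[normal_prob 0 (Num.sqrt h)]_t (`|t| `^ p)%:E <= c%:E)%E ->
  (\int[mu]_x (\sum_(k <oo)
      (lam k * `|ip (tilde_pi ell w x - tilde_pi ell w' x) (y k)| `^ p)%:E) <=
   c%:E * \sum_(k <oo) (lam k * `|pr ip w (y k) - pr ip w' (y k)| `^ p)%:E)%E.
Proof.
move=> lam0 p0 c0 hc.
have mk k : measurable_fun setT (fun x =>
    (`|ip (tilde_pi ell w x - tilde_pi ell w' x) (y k)| `^ p)%:E).
  by apply: measurable_norm_powR => //; exact: measurable_ip_tilde_pi.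
rewrite integral_nneseries//; last 2 first.
- move=> k; under eq_fun do rewrite EFinM.
  by apply: emeasurable_funM => //; exact: measurable_cst.
- by move=> k x _; rewrite lee_fin mulr_ge0 ?powR_ge0.
rewrite -nneseriesZl; last by move=> k _; rewrite lee_fin mulr_ge0 ?powR_ge0.
apply: lee_nneseries => [k _|k _].
  by move=> _; apply: integral_ge0 => x _; rewrite lee_fin mulr_ge0 ?powR_ge0.
under eq_integral do rewrite EFinM.
rewrite ge0_integralZl//; last by rewrite lee_fin.
rewrite EFinM muleCA; apply: lee_wpmul2l; first by rewrite lee_fin.
rewrite -EFinM; apply: le_trans (ell_moment hn hw h0 hmu hell _ p0 c0 hc).
rewrite le_eqVlt; apply/orP; left; apply/eqP; apply: ae_eq_integral => //.
- by apply: measurable_norm_powR => //; exact: (ell_measurable hell).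
- by apply: filterS (ip_tilde_pi_ae w w' (y k)) => x ->.
Qed.

Variables (A : {linear H -> H}) (f : H -> R).
Hypothesis hf : symbol_class ip A f.
Let N := symbol_norm ip A f.

Lemma sqr_estimate (lam : nat -> R) (y : nat -> H) n (w : 'I_n -> H) m (w' : 'I_m -> H) :
  (forall k, 0 <= lam k) ->
  (forall x, \sum_(k <oo) (lam k * ip x (y k) ^+ 2)%:E = (ip (A x) x)%:E)%E ->
  (\int[mu]_x (((f \o tilde_pi ell w) x - (f \o tilde_pi ell w') x) ^+ 2)%:E <=
   (N ^+ 2 * h)%:E * \sum_(k <oo) (lam k * `|pr ip w (y k) - pr ip w' (y k)| ^+ 2)%:E)%E.
Proof.
move=> lam0 hQ; have cf := Cinfty_continuous hf.
have wm := weighted_moment y w w' lam0 (ltr0n R 2) (ltW h0) normal_moment2_sqrt.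
have msum : measurable_fun setT (fun x => \sum_(k <oo)
    (lam k * `|ip (tilde_pi ell w x - tilde_pi ell w' x) (y k)| `^ 2)%:E)%E.
  apply: ge0_emeasurable_sum => [k x _ _|k _]; first by rewrite lee_fin mulr_ge0 ?powR_ge0.
  under eq_fun do rewrite EFinM; apply: emeasurable_funM; first exact: measurable_cst.
  by apply: measurable_norm_powR => //; exact: measurable_ip_tilde_pi.
apply: (@le_trans _ _ (\int[mu]_x ((N ^+ 2)%:E * \sum_(k <oo)
    (lam k * `|ip (tilde_pi ell w x - tilde_pi ell w' x) (y k)| `^ 2)%:E))%E).
  apply: ge0_le_integral.
  - exact: measurableT.
  - by move=> x _; rewrite lee_fin sqr_ge0.
  - apply/measurable_EFinP; apply: measurable_funX.
    by apply: measurable_funB; exact: measurable_comp_tilde_pi.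
  - by apply: emeasurable_funM => //; exact: measurable_cst.
  move=> x _; set v := tilde_pi ell w x - _.
  have -> : (\sum_(k <oo) (lam k * `|ip v (y k)| `^ 2)%:E = (ip (A v) v)%:E)%E.
    rewrite -hQ; apply: eq_eseriesr => k _.
    by rewrite powR_mulrn// real_normK// num_real.
  have hl := symbol_class_lipschitz hf (tilde_pi ell w x) (tilde_pi ell w' x).
  rewrite -/v in hl; rewrite -EFinM lee_fin -[leLHS]real_normK ?num_real//=.
  have q0 : 0 <= ip (A v) v by rewrite -lee_fin -hQ; apply: nneseries_ge0 => k _ _;
    rewrite lee_fin mulr_ge0 ?sqr_ge0.
  have -> : N ^+ 2 * ip (A v) v = (N * Num.sqrt (quad_form ip A v)) ^+ 2.
    by rewrite exprMn sqr_sqrtr.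
  by rewrite ler_sqr ?nnegrE// mulr_ge0 ?sqrtr_ge0//; exact: symbol_norm_ge0.
rewrite ge0_integralZl//; last 2 first.
- by move=> x _; apply: nneseries_ge0 => k _ _; rewrite lee_fin mulr_ge0 ?powR_ge0.
- by rewrite lee_fin sqr_ge0.
rewrite (EFinM (N ^+ 2)) -muleA; apply: lee_wpmul2l; first by rewrite lee_fin sqr_ge0.
apply: le_trans wm _; rewrite le_eqVlt; apply/orP; left; apply/eqP; congr (_ * _)%E.
by apply: eq_eseriesr => k _; rewrite powR_mulrn.
Qed.

(** The quadratic form is raised to the power r = p/2 by the weighted power mean inequality; the
    total weight [L] enters with exponent r - 1, the source of the trace factor in [C_const]. *)
Lemma powR_estimate (lam : nat -> R) (y : nat -> H) (p c L : R)
    n (w : 'I_n -> H) m (w' : 'I_m -> H) :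
  (forall k, 0 <= lam k) -> 2 < p -> 0 <= c ->
  (\int[normal_prob 0 (Num.sqrt h)]_t (`|t| `^ p)%:E <= c%:E)%E ->
  (forall n, \sum_(k < n) lam k <= L) ->
  (forall x, \sum_(k <oo) (lam k * ip x (y k) ^+ 2)%:E = (ip (A x) x)%:E)%E ->
  (\int[mu]_x (`|(f \o tilde_pi ell w) x - (f \o tilde_pi ell w') x| `^ p)%:E <=
   (N `^ p * L `^ (p / 2 - 1) * c)%:E *
     \sum_(k <oo) (lam k * `|pr ip w (y k) - pr ip w' (y k)| `^ p)%:E)%E.
Proof.
move=> lam0 p2 c0 hc lamL hQ; have cf := Cinfty_continuous hf.
have p0 : 0 < p by exact: lt_trans p2.
have wm := weighted_moment y w w' lam0 p0 c0 hc.
have N0 : 0 <= N by exact: symbol_norm_ge0.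
pose T x := (\sum_(k <oo) (lam k * `|ip (tilde_pi ell w x - tilde_pi ell w' x) (y k)| `^ p)%:E)%E.
have T0 x : (0 <= T x)%E.
  by apply: nneseries_ge0 => k _ _; rewrite lee_fin mulr_ge0 ?powR_ge0.
have mT : measurable_fun setT T.
  apply: ge0_emeasurable_sum => [k x _ _|k _]; first by rewrite lee_fin mulr_ge0 ?powR_ge0.
  under eq_fun do rewrite EFinM; apply: emeasurable_funM; first exact: measurable_cst.
  by apply: measurable_norm_powR => //; exact: measurable_ip_tilde_pi.
have r1 : 1 < p / 2 by rewrite ltr_pdivlMr// mul1r.
have K0 : 0 <= N `^ p * L `^ (p / 2 - 1) by rewrite mulr_ge0 ?powR_ge0.
apply: (@le_trans _ _ (\int[mu]_x ((N `^ p * L `^ (p / 2 - 1))%:E * T x))%E).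
  apply: ge0_le_integral.
  - exact: measurableT.
  - by move=> x _; rewrite lee_fin powR_ge0.
  - apply: measurable_norm_powR => //.
    by apply: measurable_funB; exact: measurable_comp_tilde_pi.
  - by apply: emeasurable_funM => //; exact: measurable_cst.
  move=> x _; rewrite /T; set v := tilde_pi ell w x - _.
  have q0 : 0 <= ip (A v) v by rewrite -lee_fin -hQ; apply: nneseries_ge0 => k _ _;
    rewrite lee_fin mulr_ge0 ?sqr_ge0.
  have hl := symbol_class_lipschitz hf (tilde_pi ell w x) (tilde_pi ell w' x).
  apply: (@le_trans _ _ ((N `^ p)%:E * (ip (A v) v `^ (p / 2))%:E)%E).
    rewrite -EFinM lee_fin; have -> : ip (A v) v `^ (p / 2) = Num.sqrt (ip (A v) v) `^ p.
      by rewrite -powR12_sqrt// -powRrM mulrC.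
    by rewrite -powRM ?sqrtr_ge0// ge0_ler_powR ?nnegrE ?(ltW p0)// mulr_ge0 ?sqrtr_ge0.
  rewrite EFinM -muleA; apply: lee_wpmul2l; first by rewrite lee_fin powR_ge0.
  (* The power mean inequality concerns finite sums; it is applied to the partial sums, whose powers
     converge. *)
  pose S j := \sum_(k < j) lam k * ip v (y k) ^+ 2.
  have S_cvg : S j @[j --> \oo] --> ip (A v) v.
    have s0 k : 0 <= lam k * ip v (y k) ^+ 2 by rewrite mulr_ge0 ?sqr_ge0.
    have := nneseries_fin_cvg s0; rewrite hQ ltry => /(_ isT)[cS [e]]; rewrite e.
    have -> : S = series (fun k => lam k * ip v (y k) ^+ 2).
      by apply/funext => j; rewrite /S /series/= big_mkord.
    by [].
  have S0 j : 0 <= S j by apply: sumr_ge0 => k _; rewrite mulr_ge0 ?sqr_ge0.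
  have Sr_cvg : S j `^ (p / 2) @[j --> \oo] --> ip (A v) v `^ (p / 2).
    have : `|S j| `^ (p / 2) @[j --> \oo] --> `|ip (A v) v| `^ (p / 2).
      by apply: cvg_norm_powR => //; exact: lt_trans r1.
    by rewrite (ger0_norm q0); under eq_fun do rewrite (ger0_norm (S0 _)).
  have SrE_cvg : (S j `^ (p / 2))%:E @[j --> \oo] --> (ip (A v) v `^ (p / 2))%:E.
    by apply/fine_cvgP; split; [exact: nearW|exact: Sr_cvg].
  apply: (cvge_to_le SrE_cvg); apply: nearW => j.
  have := @weighted_power_mean _ lam (fun k => ip v (y k) ^+ 2) L (p / 2) j r1 lam0
    (fun k => sqr_ge0 _) (lamL j); rewrite -lee_fin => /le_trans; apply.
  rewrite EFinM; apply: lee_wpmul2l; first by rewrite lee_fin powR_ge0.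
  rewrite -sumEFin -(big_mkord xpredT (fun k => (lam k * (ip v (y k) ^+ 2) `^ (p / 2))%:E)).
  have -> : (\sum_(0 <= k < j) (lam k * (ip v (y k) ^+ 2) `^ (p / 2))%:E =
      \sum_(0 <= k < j) (lam k * `|ip v (y k)| `^ p)%:E)%E.
    apply: eq_bigr => k _; congr (_ * _)%:E.
    rewrite -[ip v (y k) ^+ 2]real_normK ?num_real// -powR_mulrn// -powRrM.
    by rewrite mulrC divfK.
  by apply: nneseries_lim_ge => k _ _; rewrite lee_fin mulr_ge0 ?powR_ge0.
rewrite ge0_integralZl//.
by rewrite (EFinM _ c) -muleA; apply: lee_wpmul2l; rewrite ?lee_fin.
Qed.
End Estimates.

(** * Limits in mean square *)

Section Limits.
Context {R : realType}.

(** Dominated convergence for series: beyond an index [K] the sum is below the tail of [b], and the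
    first [K] terms tend to 0. *)
Lemma tannery (a : nat -> nat -> R) (b : nat -> R) :
  (forall n k, 0 <= a n k <= b k) -> (\sum_(k <oo) (b k)%:E < +oo)%E ->
  (forall k, a n k @[n --> \oo] --> 0) ->
  limn (series (a n)) @[n --> \oo] --> 0.
Proof.
move=> ab bfin a0.
have b0 k : 0 <= b k by have /andP[/le_trans] := ab 0%N k; apply.
have [cb _] := nneseries_fin_cvg b0 bfin.
have ca n : cvgn (series (a n)).
  apply: (@series_le_cvg _ _ b) => // k; by have /andP[] := ab n k.
apply/cvgrPdist_le => e e0; have e2 : 0 < e / 2 by rewrite divr_gt0.
move/cvgrPdist_le : (cb) => /(_ _ e2)[K _ hK].
have sum0 : series (a n) K @[n --> \oo] --> 0.
  rewrite /series/=; elim: K {hK} => [|K IH].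
    by under eq_fun do rewrite big_nil; exact: cvg_cst.
  under eq_fun do rewrite big_nat_recr//=.
  have h : \sum_(0 <= i < K) a n i + a n K @[n --> \oo] --> (0 : R) + 0 by apply: cvgD.
  by rewrite addr0 in h.
move/cvgrPdist_le : sum0 => /(_ _ e2); apply: filterS => n.
rewrite !sub0r !normrN => hn.
have S0 : 0 <= limn (series (a n)).
  apply: limr_ge; first exact: ca.
  apply: nearW => m; rewrite /series/=; apply: sumr_ge0 => k _.
  by have /andP[] := ab n k.
rewrite ger0_norm//.
have cB : series b m - series (a n) m @[m --> \oo] --> limn (series b) - limn (series (a n)).
  by apply: cvgB => //; exact: ca.
(* The partial sums of [b] minus [a n] increase, so the tail of [a n] is at most that of [b]. *)
have h3 : series b K - series (a n) K <= limn (series b) - limn (series (a n)).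
  rewrite -(cvg_lim (@Rhausdorff R) cB).
  apply: (@nondecreasing_cvgn_le _ (fun m => series b m - series (a n) m)).
    apply/nondecreasing_seqP => m; rewrite /series/= !big_nat_recr//=.
    have /andP[_] := ab n m; move: (a n m) (b m) (\sum_(_ <= _ < _) _) (\sum_(_ <= _ < _) _).
    by move=> ? ? ? ?; lra.
  by apply/cvg_ex; eexists; exact: cB.
have := hK K (leqnn K); rewrite ler_norml => /andP[_ h1].
have h2 := le_trans (ler_norm _) hn.
move: h1 h2 h3; move: (limn _) (limn _) (series b K) (series (a n) K) => u v s t h1 h2 h3.
rewrite (splitr e); lra.
Qed.
End Limits.

Section CauchyLimit.
Context d (T : measurableType d) (R : realType) (mu : probability T R).

(** A rapidly convergent subsequence has an almost everywhere limit. Fatou along it, with [W]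
    tending to 0, leaves the one-sided rate [W n]. *)
Lemma integral_sqr_cauchy_limit (g : nat -> T -> R) (W : nat -> R) (M : R) : 0 <= M ->
  (forall n, measurable_fun setT (g n)) -> (forall n x, `|g n x| <= M) ->
  (forall n, 0 <= W n) -> W n @[n --> \oo] --> 0 ->
  (forall n m, \int[mu]_x ((g n x - g m x) ^+ 2)%:E <= (W n + W m)%:E)%E ->
  exists f : T -> R, [/\ measurable_fun setT f, forall x, `|f x| <= M &
    forall n, (\int[mu]_x ((g n x - f x) ^+ 2)%:E <= (W n)%:E)%E].
Proof.
move=> M0 mg gM W0 Wc gW.
pose del k : R := 1 / (2 ^ (k + 1))%:R.
have del0 k : 0 < del k by rewrite divr_gt0// ltr0n expn_gt0.
have /choice[r rP] k : exists r : nat, forall n, (r <= n)%N -> W n <= del k ^+ 2 / 2.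
  have d2 : 0 < del k ^+ 2 / 2 by rewrite divr_gt0// exprn_gt0.
  move/cvgrPdist_le : Wc => /(_ _ d2)[r _ hr]; exists r => n /hr.
  by rewrite sub0r normrN; exact: le_trans (ler_norm _).
(* Summing the thresholds gives indices that are nondecreasing and each beyond its own threshold. *)
pose s k := (\sum_(j < k.+1) r j)%N.
have s_r k : (r k <= s k)%N by rewrite /s big_ord_recr/= leq_addl.
have s_nd k : (s k <= s k.+1)%N by rewrite /s [leqRHS]big_ord_recr/= leq_addr.
have ms k : measurable_fun setT (fun x => g (s k.+1) x - g (s k) x) by exact: measurable_funB.
have ae_sum : {ae mu, forall x, (\sum_(k <oo) (`|g (s k.+1) x - g (s k) x|)%:E < +oo)%E}.
  apply: ae_summable => [k|k x|]; [|by []|].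
    by apply: measurableT_comp => //.
  apply: le_lt_trans half_geometric_lty; apply: lee_nneseries => k _.
    by move=> _; apply: integral_ge0 => x _; rewrite lee_fin.
  have h : (\int[mu]_x ((g (s k.+1) x - g (s k) x) ^+ 2)%:E <= (del k ^+ 2)%:E)%E.
    apply: le_trans (gW _ _) _; rewrite lee_fin (splitr (del k ^+ 2)) lerD//.
      by apply: rP; exact: leq_trans (s_r k) (s_nd k).
    exact: rP.
  have := Lnorm_le_sqr ltr01 (ler1n R 2) (ltW (del0 k)) (ms k) h.
  by rewrite Lnorm1.
have ae_cvg : {ae mu, forall x, cvgn (fun k => g (s k) x)}.
  apply: filterS ae_sum => x /nneseries_fin_cvg[//|cx _].
  have : cvgn (series (fun k => g (s k.+1) x - g (s k) x)) by exact: normed_cvg.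
  have -> : series (fun k => g (s k.+1) x - g (s k) x) = fun k => g (s k) x - g (s 0%N) x.
    by apply/funext => k; rewrite /series/= telescope_sumr.
  move=> c1; have -> : (fun k => g (s k) x) = (fun k => (g (s k) x - g (s 0%N) x) + g (s 0%N) x).
    by apply/funext => k; rewrite subrK.
  by apply: is_cvgD => //; exact: is_cvg_cst.
(* The upper limit is measurable, and truncation makes the bound [M] hold at every point, also where
   the subsequence diverges. *)
pose f x := Num.max (- M) (Num.min M (limn_sup (fun k => g (s k) x))).
have mf : measurable_fun setT f.
  apply: measurable_maxr; first exact: measurable_cst.
  apply: measurable_minr; first exact: measurable_cst.
  apply: measurable_fun_limn_sup => [x _|x _|k]; last exact: mg.
    by exists M => _ [k _ <-]; exact: le_trans (ler_norm _) (gM _ _).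
  exists (- M) => _ [k _ <-]; have := gM (s k) x.
  by rewrite ler_norml => /andP[].
have fM x : `|f x| <= M.
  by rewrite ler_norml /f le_max lexx/= ge_max ge_min lexx/= andbT; lra.
exists f; split=> // n.
have ae_f : {ae mu, forall x, g (s k) x @[k --> \oo] --> f x}.
  apply: filterS ae_cvg => x cx; rewrite /f cvg_limn_supE//.
  have l1 : limn (fun k => g (s k) x) <= M.
    by apply: limr_le => //; apply: nearW => k; exact: le_trans (ler_norm _) (gM _ _).
  have l2 : - M <= limn (fun k => g (s k) x).
    apply: limr_ge => //; apply: nearW => k; have := gM (s k) x.
    by rewrite ler_norml => /andP[].
  by rewrite (min_idPr l1) (max_idPr l2).
apply/lee_addgt0Pr => e e0; rewrite -EFinD.
apply: (@integral_fatou_le _ _ _ mu (fun k x => (g n x - g (s k) x) ^+ 2)).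
- by move=> k; apply: measurable_funX; exact: measurable_funB.
- by apply: measurable_funX; exact: measurable_funB.
- by move=> k x; exact: sqr_ge0.
- apply: filterS ae_f => x hx; rewrite expr2; under eq_fun do rewrite expr2.
  by apply: cvgM; apply: cvgB => //; exact: cvg_cst.
have : del k ^+ 2 / 2 @[k --> \oo] --> 0.
  have d0 : del k @[k --> \oo] --> 0.
    apply: nneseries_lty_cvg0; last exact: half_geometric_lty.
    by move=> k; exact: ltW.
  have h : del k * del k * 2^-1 @[k --> \oo] --> (0 * 0 * 2^-1 : R).
    by apply: cvgM; [exact: cvgM|exact: cvg_cst].
  by rewrite !mul0r in h; under eq_fun do rewrite expr2.
move=> /cvgrPdist_le/(_ e e0); apply: filterS => k; rewrite sub0r normrN => he.
apply: le_trans (gW _ _) _; rewrite lee_fin lerD2l.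
exact: le_trans (rP k _ (s_r k)) (le_trans (ler_norm _) he).
Qed.

Lemma integral_sqr_triangle (f g k : T -> R) : measurable_fun setT f ->
  measurable_fun setT g -> measurable_fun setT k ->
  (\int[mu]_x ((f x - k x) ^+ 2)%:E <=
   2%:E * \int[mu]_x ((f x - g x) ^+ 2)%:E + 2%:E * \int[mu]_x ((g x - k x) ^+ 2)%:E)%E.
Proof.
move=> mf mg mk.
have msq (u v : T -> R) : measurable_fun setT u -> measurable_fun setT v ->
    measurable_fun setT (fun x => ((u x - v x) ^+ 2)%:E).
  by move=> mu_ mv; apply/measurable_EFinP; apply: measurable_funX; exact: measurable_funB.
rewrite -!ge0_integralZl//; try exact: msq; try by move=> x _; rewrite lee_fin sqr_ge0.
rewrite -ge0_integralD//; last 4 first.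
- by move=> x _; rewrite -EFinM lee_fin mulr_ge0 ?sqr_ge0.
- by apply: emeasurable_funM => //; exact: msq.
- by move=> x _; rewrite -EFinM lee_fin mulr_ge0 ?sqr_ge0.
- by apply: emeasurable_funM => //; exact: msq.
apply: ge0_le_integral.
- exact: measurableT.
- by move=> x _; rewrite lee_fin sqr_ge0.
- exact: msq.
- by apply: emeasurable_funD; apply: emeasurable_funM => //; exact: msq.
move=> x _; rewrite -!EFinM -EFinD lee_fin -subr_ge0.
rewrite (_ : _ - _ = ((f x - g x) - (g x - k x)) ^+ 2); last by ring.
exact: sqr_ge0.
Qed.
End CauchyLimit.

(** * Stochastic extensions *)

Section Exhaustion.
Context {R : realType} {H : completeNormedModType R} (ip : {dot H for idfun}).
Hypothesis hn : hilbert_norm ip.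

Lemma pr_increasing_cvg (E : nat -> set H) (d : nat -> nat) (w : forall n, 'I_(d n) -> H) x :
  (forall n, E n `<=` E n.+1) -> dense (\bigcup_n E n) ->
  (forall n, orthonormal_basis ip (E n) (w n)) ->
  `|pr ip (w n) x - x| @[n --> \oo] --> 0.
Proof.
move=> Ei Ed wE; apply/cvgrPdist_lt => e e0.
have Ele m n : (m <= n)%N -> E m `<=` E n.
  move=> /subnK <-; elim: (n - m)%N => // k IH; exact: subset_trans IH (Ei _).
have [|s [sx [m _ Es]]] := Ed (ball x e) _ (ball_open x e).
  by exists x; exact: ballxx.
exists m => // n /= mn; rewrite sub0r normrN normr_id distrC.
have [ow EE] := wE n; apply: le_lt_trans (@dist_pr_le _ _ _ hn _ _ x s ow _) _.
  by rewrite -EE; exact: Ele mn _ Es.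
by move: sx; rewrite -ball_normE.
Qed.

Variable e : nat -> H.
Hypothesis he : hilbert_basis ip e.

Lemma orthonormal_initial m : Defs.orthonormal ip (fun i : 'I_m => e i).
Proof. by move=> i j; exact: he.1. Qed.

Lemma pr_initial m j :
  pr ip (fun i : 'I_m => e i) (e j) = if (j < m)%N then e j else 0.
Proof.
rewrite /pr; case: ifP => jm; last first.
  rewrite big1// => i _; rewrite he.1 gtn_eqF ?scale0r//.
  by apply: leq_trans (ltn_ord i) _; rewrite leqNgt jm.
rewrite (bigD1 (Ordinal jm))//= he.1 eqxx scale1r big1 ?addr0// => i ij.
by rewrite he.1 (_ : _ == _ = false) ?scale0r// eq_sym; exact/negbTE.
Qed.

Let F m := linear_span (range (fun i : 'I_m => e i)).

Lemma fin_dim_initial m : fin_dim (F m).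
Proof. by exists m, (fun i : 'I_m => e i). Qed.

Lemma orthonormal_basis_initial m : orthonormal_basis ip (F m) (fun i : 'I_m => e i).
Proof. by split=> //; exact: orthonormal_initial. Qed.

Lemma initial_increasing m : F m `<=` F m.+1.
Proof.
apply: linear_span_sub => _ [i _ <-].
by exists (widen_ord (leqnSn m) i).
Qed.

Lemma initial_dense : dense (\bigcup_m F m).
Proof.
move=> O O0 oO; have [x [Ox ex]] := he.2 O O0 oO; exists x; split=> //.
by have [m mx] := span_range_nat ex; exists m.
Qed.
End Exhaustion.

(** * Existence and boundedness of the extension *)

Section Extension.
Context {R : realType} {H B : completeNormedModType R}.
Variables (ip : {dot H for idfun}) (iota : {linear H -> B}) (h : R).
Variables (mu : probability (borelType B) R) (ell : H -> borelType B -> R).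
Hypotheses (hn : hilbert_norm ip) (hw : wiener_completion ip iota) (h0 : 0 < h).
Hypotheses (hmu : wiener_measure ip iota h mu) (hell : is_ell ip iota mu ell).
Variables (A : {linear H -> H}) (f : H -> R).
Hypothesis hf : symbol_class ip A f.
Let N := symbol_norm ip A f.

Lemma symbol_measurable n (w : 'I_n -> H) : measurable_fun setT (f \o tilde_pi ell w).
Proof. by have cf := Cinfty_continuous hf; refine (measurable_comp_tilde_pi hell w cf). Qed.

Lemma comp_tilde_pi_Lfun p n (w : 'I_n -> H) : 1 <= p ->
  f \o tilde_pi ell w \in Lfun mu p%:E.
Proof.
move=> p1; apply: (@bounded_Lfun _ _ _ _ _ _ N) => //; first exact: symbol_norm_ge0.
  exact: symbol_measurable.
by move=> x; exact: (le_symbol_norm hf).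
Qed.

Section Trace.
Variable y : nat -> H.
Hypothesis hQ : forall x, (\sum_(k <oo) (ip x (y k) ^+ 2)%:E = (ip (A x) x)%:E)%E.
Hypothesis hy : (\sum_(k <oo) (`|y k| ^+ 2)%:E < +oo)%E.

(** For orthonormal [w] this is the trace of (1 - pi) A (1 - pi), with pi the projection onto the
    span of [w]. *)
Let V n (w : 'I_n -> H) := limn (series (fun k => `|pr ip w (y k) - y k| ^+ 2)).

Lemma trace_term_le n (w : 'I_n -> H) k : Defs.orthonormal ip w ->
  0 <= `|pr ip w (y k) - y k| ^+ 2 <= `|y k| ^+ 2.
Proof.
move=> ow; rewrite sqr_ge0/= ler_sqr ?nnegrE// distrC.
exact: dist_pr_norm.
Qed.

Lemma trace_gapE n (w : 'I_n -> H) : Defs.orthonormal ip w ->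
  (\sum_(k <oo) (`|pr ip w (y k) - y k| ^+ 2)%:E = (V w)%:E)%E.
Proof.
move=> ow; apply: (nneseries_fin_cvg _ _).2; first by move=> k; exact: sqr_ge0.
apply: le_lt_trans hy; apply: lee_nneseries => k _; first by move=> _; rewrite lee_fin sqr_ge0.
by rewrite lee_fin; have /andP[] := trace_term_le k ow.
Qed.

Lemma trace_gap_ge0 n (w : 'I_n -> H) : Defs.orthonormal ip w -> 0 <= V w.
Proof.
by move=> ow; rewrite -lee_fin -trace_gapE//; apply: nneseries_ge0 => k _ _; rewrite lee_fin sqr_ge0.
Qed.

Lemma trace_gap_cvg0 (d : nat -> nat) (w : forall n, 'I_(d n) -> H) :
  (forall n, Defs.orthonormal ip (w n)) ->
  (forall x, `|pr ip (w n) x - x| @[n --> \oo] --> 0) -> V (w n) @[n --> \oo] --> 0.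
Proof.
move=> ow wc; apply: (tannery _ hy) => [n k|k]; first exact: trace_term_le.
have c := wc (y k); have : `|pr ip (w n) (y k) - y k| * `|pr ip (w n) (y k) - y k|
    @[n --> \oo] --> (0 * 0 : R) by exact: cvgM.
by rewrite mulr0.
Qed.

Let c0 := 2 * (N ^+ 2 * h).

Lemma lipschitz_const_ge0 : 0 <= c0.
Proof. by rewrite /c0 mulr_ge0// mulr_ge0 ?sqr_ge0// ltW. Qed.

(** Inserting y_k between its two projections separates the families, at the price of the factor 2
    in [c0]. A sum of two terms is the form of Cauchy bound expected by
    [integral_sqr_cauchy_limit]. *)
Lemma sqr_estimate_trace n (w : 'I_n -> H) m (w' : 'I_m -> H) :
  Defs.orthonormal ip w -> Defs.orthonormal ip w' ->
  (\int[mu]_x (((f \o tilde_pi ell w) x - (f \o tilde_pi ell w') x) ^+ 2)%:E <=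
   (c0 * V w + c0 * V w')%:E)%E.
Proof.
move=> ow ow'; have hQ1 x : (\sum_(k <oo) (1 * ip x (y k) ^+ 2)%:E = (ip (A x) x)%:E)%E.
  by rewrite -hQ; apply: eq_eseriesr => k _; rewrite mul1r.
apply: le_trans (sqr_estimate hn hw h0 hmu hell hf w w' (fun=> ler01) hQ1) _.
apply: (@le_trans _ _ ((N ^+ 2 * h)%:E * (2 * V w + 2 * V w')%:E)%E); last first.
  by rewrite -EFinM lee_fin /c0 le_eqVlt; apply/orP; left; apply/eqP; ring.
apply: lee_wpmul2l; first by rewrite lee_fin mulr_ge0 ?sqr_ge0 ?(ltW h0).
rewrite EFinD !EFinM -!trace_gapE// -!nneseriesZl; try by move=> k _; rewrite lee_fin sqr_ge0.
rewrite -nneseriesD; try by move=> k _ _; rewrite -EFinM lee_fin mulr_ge0 ?sqr_ge0.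
apply: lee_nneseries => k _; first by move=> _; rewrite lee_fin mulr_ge0 ?sqr_ge0.
rewrite mul1r -!EFinM -EFinD lee_fin.
set a := pr ip w (y k); set b := pr ip w' (y k); set c := y k.
have -> : a - b = (a - c) + (c - b) by rewrite addrA subrK.
rewrite (distrC b c); have := parallelogram hn (a - c) (c - b).
have := sqr_ge0 `|a - c - (c - b)|; lra.
Qed.

(** The limit is built along the initial spans of one basis, but the bound holds for every
    orthonormal family, so the same [ft] serves all increasing sequences. *)
Lemma extension_exists (e : nat -> H) : hilbert_basis ip e ->
  exists ft : borelType B -> R, [/\ measurable_fun setT ft, forall x, `|ft x| <= N &
    forall n (w : 'I_n -> H), Defs.orthonormal ip w ->
      (\int[mu]_x (((f \o tilde_pi ell w) x - ft x) ^+ 2)%:E <= (2 * c0 * V w)%:E)%E].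
Proof.
move=> he; pose F m := fun i : 'I_m => e i.
have oF m : Defs.orthonormal ip (F m) by exact: orthonormal_initial.
have F0 : V (F m) @[m --> \oo] --> 0.
  apply: trace_gap_cvg0 => // x.
  have := @pr_increasing_cvg _ _ _ hn _ (fun m => m) F x (@initial_increasing _ _ e)
    (initial_dense he) (orthonormal_basis_initial he).
  by apply.
pose g m := f \o tilde_pi ell (F m).
have mg m : measurable_fun setT (g m).
  exact: symbol_measurable.
have c0F : c0 * V (F m) @[m --> \oo] --> 0.
  have : c0 * V (F m) @[m --> \oo] --> c0 * 0 by apply: cvgM => //; exact: cvg_cst.
  by rewrite mulr0.
have [||||ft [mft ftN hft]] := @integral_sqr_cauchy_limit _ _ _ mu g
  (fun m => c0 * V (F m)) N (symbol_norm_ge0 hf) mg.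
- by move=> m x; exact: (le_symbol_norm hf).
- by move=> m; rewrite mulr_ge0 ?lipschitz_const_ge0 ?trace_gap_ge0.
- exact: c0F.
- by move=> m n; exact: sqr_estimate_trace.
exists ft; split=> // n w ow; apply/lee_addgt0Pr => eps eps0.
(* The triangle inequality for squares produces [c0 * V (F m)] four times in all. *)
have e4 : 0 < eps / 4 by rewrite divr_gt0.
move/cvgrPdist_le : c0F => /(_ _ e4)[m _ /(_ m (leqnn m))].
rewrite sub0r normrN => /(le_trans (ler_norm _)) hm.
have mw : measurable_fun setT (f \o tilde_pi ell w).
  exact: symbol_measurable.
apply: le_trans (integral_sqr_triangle mu mw (mg m) mft) _.
apply: (@le_trans _ _ (2%:E * (c0 * V w + c0 * V (F m))%:E + 2%:E * (c0 * V (F m))%:E)%E).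
  by apply: leeD; apply: lee_wpmul2l; rewrite ?lee_fin//; exact: sqr_estimate_trace.
rewrite -!EFinM -!EFinD lee_fin; move: (V w) (V (F m)) hm => v1 v2; lra.
Qed.

Lemma stochastic_extension_exists (e : nat -> H) p : 1 <= p -> hilbert_basis ip e ->
  exists ft : borelType B -> R, stochastic_extension ip mu ell p f ft.
Proof.
move=> p1 he; have [ft [mft ftN hft]] := extension_exists he; exists ft.
have N0 : 0 <= N := symbol_norm_ge0 hf; split.
- exact: continuous_borel_measurable (Cinfty_continuous hf).
- exact: (@bounded_Lfun _ _ _ _ _ _ N).
move=> E _ Ei Ed d w wE; split=> [n|]; first exact: comp_tilde_pi_Lfun.
have ow n : Defs.orthonormal ip (w n) := (wE n).1.
apply: (@Lnorm_cvg0_of_sqr _ _ _ mu (fun n => (f \o tilde_pi ell (w n)) \- ft) p (N + N)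
  (fun n => 2 * c0 * V (w n))) => //.
- by rewrite addr_ge0.
- move=> n; apply: measurable_funB => //.
  exact: symbol_measurable.
- move=> n x; apply: le_trans (ler_normB _ _) _; rewrite lerD//=.
  exact: (le_symbol_norm hf).
- by move=> n; exact: hft.
have : 2 * c0 * V (w n) @[n --> \oo] --> 2 * c0 * 0.
  apply: cvgM; first exact: cvg_cst.
  by apply: trace_gap_cvg0 => // x; exact: pr_increasing_cvg Ei Ed wE.
by rewrite mulr0.
Qed.
End Trace.

Variables (p : R) (ft : borelType B -> R).
Hypotheses (p1 : 1 <= p) (hft : stochastic_extension ip mu ell p f ft).

Let p0 : 0 < p := lt_le_trans ltr01 p1.

Lemma extension_measurable : measurable_fun setT ft.
Proof. by have [_ /andP[/set_mem]] := hft. Qed.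

Lemma extension_initial_cvg (e : nat -> H) : hilbert_basis ip e ->
  Lp_dist mu p (f \o tilde_pi ell (fun i : 'I_m => e i)) ft @[m --> \oo] --> 0%E.
Proof.
move=> he; have [_ _ hE] := hft.
by have [_] := hE _ (fin_dim_initial e) (@initial_increasing _ _ e) (initial_dense he)
  (fun m => m) (fun m i => e i) (orthonormal_basis_initial he); apply.
Qed.

(** The excess of [|ft|] over [N] is at most [|f o pi~ - ft|] at every point, since [f] is bounded
    by [N]. Its L^p norm is thus below quantities that tend to 0. *)
Lemma extension_bounded (e : nat -> H) : hilbert_basis ip e ->
  {ae mu, forall x, `|ft x| <= N}.
Proof.
move=> he; pose r x := Num.max (`|ft x| - N) 0.
have mft := extension_measurable.
have mr : measurable_fun setT r.
  apply: measurable_maxr; last exact: measurable_cst.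
  by apply: measurable_funB; [exact: measurableT_comp|exact: measurable_cst].
have r0 : ('N[mu]_p%:E[EFin \o r] = 0)%E.
  apply/le_anti; rewrite Lnorm_ge0 andbT.
  apply: (cvge_to_ge (extension_initial_cvg he)); apply: nearW => m.
  rewrite /Lp_dist !LnormE; apply: gt0_ler_poweR.
  - by rewrite invr_ge0 ltW.
  - by rewrite in_itv/= leey andbT integral_ge0// => x _; rewrite lee_fin powR_ge0.
  - by rewrite in_itv/= leey andbT integral_ge0// => x _; rewrite lee_fin powR_ge0.
  apply: ge0_le_integral.
  - exact: measurableT.
  - by move=> x _; rewrite lee_fin powR_ge0.
  - exact: measurable_norm_powR.
  - apply: measurable_norm_powR => //; apply: measurable_funB => //.
    exact: symbol_measurable.
  move=> x _; rewrite lee_fin ge0_ler_powR ?nnegrE ?(ltW p0)//=.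
  rewrite ger0_norm ?le_max ?lexx ?orbT// ge_max normr_ge0 andbT.
  have := le_symbol_norm hf (tilde_pi ell (fun i : 'I_m => e i) x).
  rewrite lerBlDr -/N; move: (f _) => a aN; rewrite -{1}(subrK a (ft x)).
  by apply: le_trans (ler_normD _ _) _; rewrite distrC lerD2l.
have rz : EFin \o r = \0%E %[ae mu].
  apply: (@Lnorm_eq0_eq0 _ _ _ mu (EFin \o r) p%:E) => //.
  exact/measurable_EFinP.
apply: filterS rz => x /(_ I)[]; rewrite /r => rx.
by rewrite -subr_le0 -rx le_max lexx.
Qed.
End Extension.

(** * The rate of approximation along an eigenbasis *)

Section Estimate.
Context {R : realType} {H B : completeNormedModType R}.
Variables (ip : {dot H for idfun}) (iota : {linear H -> B}) (h : R).
Variables (mu : probability (borelType B) R) (ell : H -> borelType B -> R).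
Hypotheses (hn : hilbert_norm ip) (hw : wiener_completion ip iota) (h0 : 0 < h).
Hypotheses (hmu : wiener_measure ip iota h mu) (hell : is_ell ip iota mu ell).
Variables (A : {linear H -> H}) (f : H -> R).
Hypothesis hf : symbol_class ip A f.
Let N := symbol_norm ip A f.
Variables (u : nat -> H) (lam : nat -> R).
Hypotheses (hu : hilbert_basis ip u) (lam0 : forall k, 0 <= lam k).
Hypothesis lamQ : forall x, (\sum_(k <oo) (lam k * ip x (u k) ^+ 2)%:E = (ip (A x) x)%:E)%E.
Hypothesis lamS : (\sum_(k <oo) (lam k)%:E < +oo)%E.
Variables (n : nat) (w : 'I_n -> H).
Hypothesis ow : Defs.orthonormal ip w.

Let F m := fun i : 'I_m => u i.
Let X a := limn (series (fun k => lam k * `|pr ip w (u k) - u k| `^ a)).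
Let tail m := limn (series (fun k => if (k < m)%N then 0 else lam k)).

Lemma norm_basis k : `|u k| = 1.
Proof.
by apply/eqP; rewrite -(@eqrXn2 _ 2)// hn hu.1 eqxx expr1n.
Qed.

Lemma tail_cvg0 : tail m @[m --> \oo] --> 0.
Proof.
apply: (tannery _ lamS) => [m k|k]; first by case: ifP => _; rewrite ?lexx ?lam0.
apply: cvg_near_cst; exists k.+1 => // m /= km.
by rewrite (leq_trans (ltnSn k) km).
Qed.

Lemma tailE m : (\sum_(k <oo) (if (k < m)%N then 0 else lam k)%:E = (tail m)%:E)%E.
Proof.
apply: (nneseries_fin_cvg _ _).2 => [k|]; first by case: ifP.
apply: le_lt_trans lamS; apply: lee_nneseries => k _.
  by move=> _; case: ifP => //; rewrite lee_fin.
by rewrite lee_fin; case: ifP.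
Qed.

Lemma eigen_gapE a : 0 < a ->
  (\sum_(k <oo) (lam k * `|pr ip w (u k) - u k| `^ a)%:E = (X a)%:E)%E.
Proof.
move=> a0; apply: (nneseries_fin_cvg _ _).2 => [k|]; first by rewrite mulr_ge0 ?powR_ge0.
apply: le_lt_trans lamS; apply: lee_nneseries => k _.
  by move=> _; rewrite lee_fin mulr_ge0 ?powR_ge0.
rewrite lee_fin ler_piMr//; apply: (@le_trans _ _ (1 `^ a)); last by rewrite powR1.
rewrite ge0_ler_powR ?nnegrE ?(ltW a0)//.
by rewrite -(norm_basis k) distrC; exact: dist_pr_norm.
Qed.

Lemma eigen_gap_ge0 a : 0 < a -> 0 <= X a.
Proof.
move=> a0; rewrite -lee_fin -eigen_gapE//; apply: nneseries_ge0 => k _ _.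
by rewrite lee_fin mulr_ge0 ?powR_ge0.
Qed.

Lemma tail_ge0 m : 0 <= tail m.
Proof.
rewrite -lee_fin -tailE; apply: nneseries_ge0 => k _ _.
by case: ifP => //; rewrite lee_fin.
Qed.

(** Term by term: for k < m the vector u_k is fixed by the second projection; for k >= m it is sent
    to 0, and [|pr ip w (u k)|] is at most 1, which contributes at most [lam k] to [tail m]. *)
Lemma gap_initial_le a m : 0 < a ->
  (\sum_(k <oo) (lam k * `|pr ip w (u k) - pr ip (@F m) (u k)| `^ a)%:E <=
   (X a + tail m)%:E)%E.
Proof.
move=> a0; rewrite EFinD -eigen_gapE// -tailE -nneseriesD; last 2 first.
- by move=> k _ _; rewrite lee_fin mulr_ge0 ?powR_ge0.
- by move=> k _ _; case: ifP => //; rewrite lee_fin.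
apply: lee_nneseries => k _; first by move=> _; rewrite lee_fin mulr_ge0 ?powR_ge0.
rewrite -EFinD lee_fin pr_initial//; case: ifP => _; first by rewrite addr0.
apply: (@le_trans _ _ (lam k)); last by rewrite lerDr mulr_ge0 ?powR_ge0.
rewrite subr0 ler_piMr//; apply: (@le_trans _ _ (1 `^ a)); last by rewrite powR1.
rewrite ge0_ler_powR ?nnegrE ?(ltW a0)//.
by rewrite -(norm_basis k); exact: norm_pr_le.
Qed.

Lemma alpha_gt0 p : 0 < alpha_const (p : R).
Proof. by rewrite /alpha_const; case: ifP => // /(lt_trans _); apply. Qed.

(** For p > 2 the exponent of the trace is (1/2 - 1/p) p = p/2 - 1, as in [powR_estimate]. For p <=
    2 the L^p norm on a probability space is controlled by the L^2 norm, hence the constant 1 and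
    the exponent 2. *)
Lemma Lp_dist_initial_le p m : 1 <= p ->
  (Lp_dist mu p (f \o tilde_pi ell w) (f \o tilde_pi ell (@F m)) <=
   (C_const p lam * h `^ 2^-1 * N *
     (X (alpha_const p) + tail m) `^ (alpha_const p)^-1)%:E)%E.
Proof.
move=> p1; have p0 : 0 < p := lt_le_trans ltr01 p1.
have N0 : 0 <= N := symbol_norm_ge0 hf.
have gm := @gap_initial_le (alpha_const p) m (alpha_gt0 p).
have Y0 : 0 <= X (alpha_const p) + tail m by rewrite addr_ge0 ?eigen_gap_ge0 ?tail_ge0 ?alpha_gt0.
have mdiff : measurable_fun setT ((f \o tilde_pi ell w) \- (f \o tilde_pi ell (@F m))).
  have mw := symbol_measurable hell hf w; have mF := symbol_measurable hell hf (@F m).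
  exact: (measurable_funB mw mF).
rewrite /Lp_dist; move: gm Y0; rewrite /alpha_const /C_const; case: ifPn => p2 gm Y0.
  have L0 : 0 <= limn (series lam).
    have [_ e] := nneseries_fin_cvg lam0 lamS.
    by rewrite -lee_fin -e; apply: nneseries_ge0 => k _ _; rewrite lee_fin.
  have lamL j : \sum_(k < j) lam k <= limn (series lam).
    have [c e] := nneseries_fin_cvg lam0 lamS.
    rewrite -(big_mkord xpredT lam); apply: (@nondecreasing_cvgn_le _ (series lam)) => //.
    by apply/nondecreasing_seqP => i; rewrite /series/= big_nat_recr//= lerDl.
  have sh : 0 < Num.sqrt h by rewrite sqrtr_gt0.
  have K0 : 0 <= K_const p by rewrite /K_const !mulr_ge0 ?powR_ge0.
  apply: Lnorm_le => //; first by rewrite !mulr_ge0 ?powR_ge0.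
  apply: le_trans (powR_estimate hn hw h0 hmu hell hf w (@F m) lam0 p2 _
    (normal_momentp_le p2 sh) lamL lamQ) _; first by rewrite mulr_ge0 ?powR_ge0.
  apply: (@le_trans _ _ ((N `^ p * limn (series lam) `^ (p / 2 - 1) *
      (Num.sqrt h `^ p * K_const p `^ p))%:E * (X p + tail m)%:E)%E).
    by apply: lee_wpmul2l => //; rewrite lee_fin !mulr_ge0 ?powR_ge0.
  rewrite -EFinM lee_fin; move: (K_const p) K0 => Kp K0.
  rewrite !powRM ?mulr_ge0 ?powR_ge0// -!powRrM mulVf ?gt_eqF// powRr1//.
  have -> : h `^ (2^-1 * p) = Num.sqrt h `^ p.
    by rewrite -powR12_sqrt ?(ltW h0)// -powRrM.
  rewrite (_ : (2^-1 - p^-1) * p = p / 2 - 1); last by field; rewrite gt_eqF.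
  by rewrite le_eqVlt; apply/orP; left; apply/eqP; ring.
rewrite -leNgt in p2; apply: Lnorm_le_sqr => //; first by rewrite !mulr_ge0 ?powR_ge0.
apply: le_trans (sqr_estimate hn hw h0 hmu hell hf w (@F m) lam0 lamQ) _.
apply: (@le_trans _ _ ((N ^+ 2 * h)%:E * (X 2 + tail m)%:E)%E).
  apply: lee_wpmul2l; first by rewrite lee_fin mulr_ge0 ?sqr_ge0 ?(ltW h0).
  apply: le_trans gm; rewrite le_eqVlt; apply/orP; left; apply/eqP.
  by apply: eq_eseriesr => k _; rewrite powR_mulrn.
rewrite -EFinM lee_fin !exprMn -!(powR_mulrn 2) ?powR_ge0// -!powRrM mulVf//.
rewrite !powRr1 ?(ltW h0)// powR1 mul1r powR_mulrn//.
by rewrite le_eqVlt; apply/orP; left; apply/eqP; ring.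
Qed.

(** Minkowski's inequality through the projection on the first m eigenvectors; as m grows, the
    second distance and the eigenvalue tail both tend to 0. *)
Lemma Lp_dist_extension_le p ft : 1 <= p -> stochastic_extension ip mu ell p f ft ->
  (Lp_dist mu p (f \o tilde_pi ell w) ft <=
   (C_const p lam * h `^ 2^-1 * N * X (alpha_const p) `^ (alpha_const p)^-1)%:E)%E.
Proof.
move=> p1 hft; set a := alpha_const p; have a0 : 0 < a := alpha_gt0 p.
pose K m := C_const p lam * h `^ 2^-1 * N * (X a + tail m) `^ a^-1.
have KE m : `|X a + tail m| = X a + tail m by rewrite ger0_norm// addr_ge0 ?eigen_gap_ge0 ?tail_ge0.
have Kc : K m @[m --> \oo] --> C_const p lam * h `^ 2^-1 * N * X a `^ a^-1.
  apply: cvgM; first exact: cvg_cst.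
  have : `|X a + tail m| `^ a^-1 @[m --> \oo] --> `|X a + 0| `^ a^-1.
    apply: cvg_norm_powR; first by rewrite invr_gt0.
    by apply: cvgD; [exact: cvg_cst|exact: tail_cvg0].
  by rewrite addr0 (ger0_norm (eigen_gap_ge0 a0)); under eq_fun do rewrite KE.
have KEc : (K m)%:E @[m --> \oo] --> (C_const p lam * h `^ 2^-1 * N * X a `^ a^-1)%:E.
  by apply/fine_cvgP; split; [exact: nearW|exact: Kc].
have Dc := extension_initial_cvg hft hu.
have Sc : ((K m)%:E + Lp_dist mu p (f \o tilde_pi ell (@F m)) ft)%E @[m --> \oo] -->
    ((C_const p lam * h `^ 2^-1 * N * X a `^ a^-1)%:E + 0)%E.
  by apply: cvgeD.
rewrite adde0 in Sc; apply: (cvge_to_ge Sc); apply: nearW => m.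
apply: le_trans (leeD (Lp_dist_initial_le m p1) (lexx _)).
have mw := symbol_measurable hell hf w; have mF := symbol_measurable hell hf (@F m).
have mft := extension_measurable hft.
have := @minkowski_EFin _ _ _ mu ((f \o tilde_pi ell w) \- (f \o tilde_pi ell (@F m)))
  ((f \o tilde_pi ell (@F m)) \- ft) p (measurable_funB mw mF) (measurable_funB mF mft) p1.
rewrite /Lp_dist; congr (_ <= _)%E; congr (Lnorm _ _ _).
by apply/funext => x /=; rewrite addrA subrK.
Qed.
End Estimate.

Unset Implicit Arguments.
Theorem proposition3p10 (R : realType) (H B : completeNormedModType R)
  (ip : {dot H for idfun}) (iota : {linear H -> B}) (h p : R)
  (mu : probability (borelType B) R) (ell : H -> borelType B -> R)
  (A : {linear H -> H}) :
  hilbert_norm ip -> separable_infinite_dim (H := H) ->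
  wiener_completion ip iota ->
  0 < h -> wiener_measure ip iota h mu -> is_ell ip iota mu ell ->
  selfadjoint ip A -> nonnegative ip A -> trace_class ip A ->
  1 <= p ->
  forall f : H -> R, symbol_class ip A f ->
  (exists ft : borelType B -> R, stochastic_extension ip mu ell p f ft) /\
  forall ft : borelType B -> R, stochastic_extension ip mu ell p f ft ->
    {ae mu, forall x, `|ft x| <= symbol_norm ip A f} /\
    forall (u : nat -> H) (lam : nat -> R), hilbert_basis ip u ->
      (forall j, A (u j) = lam j *: u j) ->
    forall E : set H, fin_dim E ->
    forall (n : nat) (w : 'I_n -> H), orthonormal_basis ip E w ->
      (Lp_dist mu p (f \o tilde_pi ell w) ft <=
       (C_const p lam * h `^ 2^-1 * symbol_norm ip A f *
        limn (series (fun j =>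
          lam j * `|orth_proj ip E (u j) - u j| `^ alpha_const p))
        `^ (alpha_const p)^-1)%:E)%E.
Proof.
move=> hn _ hw h0 hmu hell sA nA [cA tcA] p1 f hf.
(* A continuous, selfadjoint, nonnegative operator is its own absolute value. *)
have [e [he eS]] := tcA A (And4 cA sA nA (fun x y => erefl)).
have [y [yQ yS]] := cholesky hn cA sA nA he eS.
split; first exact: (stochastic_extension_exists hn hw h0 hmu hell hf yQ yS p1 he).
move=> ft hft; split; first exact: (extension_bounded hell hf p1 hft he).
move=> u lam hu Au E _ n w wE.
have lam0 := eigenvalue_ge0 nA hu Au.
(* The trace is finite in some basis, so the Cholesky vectors are square summable; exchanging sums
   moves this to the eigenbasis. *)
have lamS : (\sum_(k <oo) (lam k)%:E < +oo)%E.
  rewrite (eq_eseriesr (fun k _ => congr1 EFin (eigenvalueE hu Au k))).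
  by rewrite (trace_exchange hn hu yQ).
under eq_fun do rewrite (orth_projE hn _ wE).
have lamQ := eigenbasis_form hn cA hu Au.
exact: (Lp_dist_extension_le hn hw h0 hmu hell hf hu lam0 lamQ lamS wE.1 p1 hft).
Qed.
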